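(* Assume that $U$ is closed-valued with Borel graph and that $f,g$ satisfy the regularity conditions stated in the context. Let $u^0\in\mathfrak U$, with trajectory $x^0=x^{u^0}$, be weakly uniformly overtaking optimal. Then for some unbounded sequence $\tau=(\tau_n)_{n\in\mathbb N}$ of times in $\mathbb T$ there exists a $\tau$-vanishing Lagrange multiplier $(\lambda^0,\psi^0)\in\Lambda$.
   Context: Setting. $\mathbb T=[0,\infty)$, $\mathbb X=\mathbb R^m$, $\mathbb U$ is a finite-dimensional Euclidean space. $U$ assigns to each $t\in\mathbb T$ a subset $U(t)\subset\mathbb U$; $\mathfrak U$ is the set of Borel measurable locally bounded $u:\mathbb T\to\mathbb U$ with $u(t)\in U(t)$. Let $f:\mathbb T\times\mathbb X\times\mathbb U\to\mathbb X$, $g:\mathbb T\times\mathbb X\times\mathbb U\to\mathbb R$, $x_{**}\in\mathbb X$. For $u\in\mathfrak U$, $x^u$ solves $\dot x=f(t,x,u(t))$, $x(0)=x_{**}$, and $J^u(T)=\int_0^T g(t,x^u(t),u(t))\,dt$. Regularity conditions on $f,g$: each of $a=f,\ g,\ \partial f/\partial x,\ \partial g/\partial x$ is defined on $\mathbb T\times\mathbb X\times\mathbb U$, is Carath\'eodory (Borel in $t$ for all $(x,u)$, continuous in $(x,u)$ for a.e. $t$), and for each compact $K\subset\mathbb X\times\mathbb U$ there are locally integrable $L^a_K,M^a_K:\mathbb T\to\mathbb T$ with $\|a(t,x,u)-a(t,y,u)\|\le L^a_K(t)\|x-y\|$ and $\|a(t,x,u)\|\le M^a_K(t)$ for all $(x,u),(y,u)\in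 K$, $t\in\mathbb T$. Moreover $f$ has sublinear growth in $x$: for each compact $C\subset\mathbb U$ there is a locally integrable $l_C$ with $\|f(t,x,u)\|\le l_C(t)(1+\|x\|)$ for $u\in C$. $u^0\in\mathfrak U$ is weakly uniformly overtaking optimal if $\liminf_{t\to\infty}\sup_{u\in\mathfrak U}(J^u(t)-J^{u^0}(t))=0$. Multipliers. Shadow prices $\psi$ are row vectors. $\mathcal H(x,t,u,\lambda,\psi)=\psi f(t,x,u)+\lambda g(t,x,u)$ for $\lambda\ge0$. A Lagrange multiplier associated with $(x^0,u^0)$ is a nontrivial pair $(\lambda,\psi)\in[0,1]\times C(\mathbb T,\mathbb X)$ with, for a.e. $t$, $\dot\psi(t)=-\frac{\partial\mathcal H}{\partial x}(x^0(t),t,u^0(t),\lambda,\psi(t))$ and $\sup_{p\in U(t)}\mathcal H(x^0(t),t,p,\lambda,\psi(t))=\mathcal H(x^0(t),t,u^0(t),\lambda,\psi(t))$. $\Lambda$ is the set of such multipliers with either $\lambda=1$, or $\lambda=0$ and $\|\psi(0)\|=1$. Consider the system (S) for $(\psi,x,\lambda)$, $\lambda\ge0$: $\dot\psi=-\frac{\partial\mathcal H}{\partial x}(x(t),t,u^0(t),\lambda,\psi(t))$, $\dot x=f(t,x(t),u^0(t))$, $\dot\lambda=0$. A Lagrange multiplier $(\lambda^0,\psi^0)$ associated with $(x^0,u^0)$ is $\tau$-vanishing if there are a subsequence $\tau'$ of $\tau$ (with $\tau'_n\uparrow\infty$) and solutions $(\psi_n,x_n,\lambda_n)$ of (S) converging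 pointwise to $(\psi^0,x^0,\lambda^0)$ with $\psi_n(\tau'_n)=0$ for every $n$. *)

(* Defs.v *)
From HB Require Import structures.
From mathcomp Require Import all_boot all_order all_algebra.
From mathcomp Require Import all_classical all_reals all_analysis.

Set Implicit Arguments.
Unset Strict Implicit.
Unset Printing Implicit Defensive.

Import Order.TTheory GRing.Theory Num.Theory.
Import numFieldNormedType.Exports.

Local Open Scope classical_set_scope.
Local Open Scope ring_scope.

(* Conventions.  The time axis [0, +oo[ is the half-line of R : realType:
   functions of time have domain R, but only their values at t >= 0 matter.
   States, controls and shadow prices are all row vectors, so the product
   psi f of a row vector with a column vector reads psi *m (f t x u)^T, and
   'J (f t ^~ u) x is the transpose of the Jacobian matrix df/dx.  The norm
   `|_| of the library is the sup norm of the entries; it is used only in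
   estimates with an existentially quantified coefficient, where all norms
   are interchangeable. *)

Section Time.
Context {R : realType}.
Notation mu := (@lebesgue_measure R).

Definition ae_time (P : R -> Prop) : Prop :=
  {ae mu, forall t : R, 0 <= t -> P t}.

Definition borel_in_time (V : ptopologicalType) (h : R -> V) : Prop :=
  measurable_fun (`[0, +oo[%classic : set R)
    (h : R -> g_sigma_algebraType (@open V)).

(* Measurability in the library is Borel measurability; the representative L'
   allows L to be merely Lebesgue measurable. *)
Definition loc_integrable (L : R -> R) : Prop :=
  exists L' : R -> R,
    (forall T : R, mu.-integrable `[0, T] (EFin \o L')) /\
    ae_time (fun t => L t = L' t).

Definition abs_continuous (V : normedModType R) (a b : R) (y : R -> V) : Prop :=
  forall e : R, 0 < e -> exists2 d : R, 0 < d &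
    forall (n : nat) (I : 'I_n -> R * R),
      (forall i, a <= (I i).1 /\ (I i).1 <= (I i).2 /\ (I i).2 <= b) ->
      trivIset setT (fun i => `](I i).1, (I i).2[%classic) ->
      \sum_(i < n) ((I i).2 - (I i).1) < d ->
      \sum_(i < n) `|y (I i).2 - y (I i).1| < e.

(* Solutions, in the sense of Caratheodory, of y' = rhs on [0, +oo[. *)
Definition ode_sol (V : normedModType R) (y rhs : R -> V) : Prop :=
  (forall T : R, abs_continuous 0 T y) /\
  ae_time (fun t => is_derive t (1 : R) y (rhs t)).

Definition euclidean_norm (n : nat) (v : 'rV[R]_n) : R :=
  Num.sqrt (\sum_(i < n) v ord0 i ^+ 2).

Definition grad (n : nat) (h : 'rV[R]_n -> R) (x : 'rV[R]_n) : 'rV[R]_n :=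
  \row_(i < n) 'D_(delta_mx ord0 i) h x.

End Time.

Section ControlSystem.
Context {R : realType} {m k : nat}.
Notation mu := (@lebesgue_measure R).
Notation X := 'rV[R]_m.
Notation Uc := 'rV[R]_k.

Section Regularity.
Context {V : normedModType R}.
Implicit Type a : R -> X -> Uc -> V.

Definition caratheodory_fun a : Prop :=
  (forall x u, borel_in_time (fun t => a t x u)) /\
  ae_time (fun t => continuous (fun z : X * Uc => a t z.1 z.2)).

Definition loc_lipschitz a : Prop :=
  forall K : set (X * Uc), compact K -> exists L : R -> R,
    [/\ loc_integrable L, forall t, 0 <= t -> 0 <= L t &
        forall (t : R) (x y : X) (u : Uc), 0 <= t -> K (x, u) -> K (y, u) ->
          `|a t x u - a t y u| <= L t * `|x - y|].

Definition loc_bounded a : Prop :=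
  forall K : set (X * Uc), compact K -> exists M : R -> R,
    [/\ loc_integrable M, forall t, 0 <= t -> 0 <= M t &
        forall (t : R) (x : X) (u : Uc), 0 <= t -> K (x, u) ->
          `|a t x u| <= M t].

Definition regular a : Prop :=
  [/\ caratheodory_fun a, loc_lipschitz a & loc_bounded a].

Definition differentiable_in_state a : Prop :=
  forall (t : R) (x : X) (u : Uc), 0 <= t ->
    differentiable (fun y => a t y u) x.

End Regularity.

Variables (f : R -> X -> Uc -> X) (g : R -> X -> Uc -> R).

Definition sublinear_growth : Prop :=
  forall C : set Uc, compact C -> exists2 l : R -> R, loc_integrable l &
    forall (t : R) (x : X) (u : Uc), 0 <= t -> C u ->
      `|f t x u| <= l t * (1 + `|x|).

Definition regularity_conditions : Prop :=
  [/\ regular f /\ regular g,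
      differentiable_in_state f /\ differentiable_in_state g,
      regular (fun t x u => 'J (fun y => f t y u) x),
      regular (fun t x u => grad (fun y => g t y u) x) &
      sublinear_growth].

Variable U : R -> set Uc.

Definition closed_valued : Prop := forall t : R, 0 <= t -> closed (U t).

Definition borel_graph : Prop :=
  <<s (@open (R * Uc)%type) >> [set z : R * Uc | 0 <= z.1 /\ U z.1 z.2].

Definition admissible_control (u : R -> Uc) : Prop :=
  [/\ borel_in_time u,
      forall T : R, exists M : R, forall t, 0 <= t <= T -> `|u t| <= M &
      forall t, 0 <= t -> U t (u t)].

Definition trajectory (x_init : X) (u : R -> Uc) (x : R -> X) : Prop :=
  x 0 = x_init /\ ode_sol x (fun t => f t (x t) (u t)).

Definition payoff (x : R -> X) (u : R -> Uc) (T : R) : R :=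
  (\int[mu]_(t in `[0%R, T]) g t (x t) (u t))%R.

(* Under the regularity conditions each admissible control u has exactly one
   trajectory, so the supremum over pairs (u, x) is the supremum over u.  It
   may be +oo, whence the extended reals. *)
Definition weakly_unif_overtaking_optimal (x_init : X)
    (u0 : R -> Uc) (x0 : R -> X) : Prop :=
  limf_einf (fun T : R =>
    ereal_sup [set e : \bar R | exists u x,
      [/\ admissible_control u, trajectory x_init u x &
          e = (payoff x u T - payoff x0 u0 T)%:E]])
    (pinfty_nbhs R) = 0%E.

Definition hamiltonian (x : X) (t : R) (u : Uc) (lam : R) (psi : X) : R :=
  (psi *m (f t x u)^T) ord0 ord0 + lam * g t x u.

Definition dhamiltonian (x : X) (t : R) (u : Uc) (lam : R) (psi : X) : X :=
  grad (fun y => hamiltonian y t u lam psi) x.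

Definition lagrange_multiplier (u0 : R -> Uc) (x0 : R -> X)
    (lam : R) (psi : R -> X) : Prop :=
  [/\ 0 <= lam <= 1 /\ {within `[0, +oo[%classic, continuous psi},
      ~ (lam = 0 /\ forall t, 0 <= t -> psi t = 0),
      ode_sol psi (fun t => - dhamiltonian (x0 t) t (u0 t) lam (psi t)) &
      ae_time (fun t =>
        ereal_sup [set (hamiltonian (x0 t) t p lam (psi t))%:E | p in U t] =
        (hamiltonian (x0 t) t (u0 t) lam (psi t))%:E)].

Definition Lambda (u0 : R -> Uc) (x0 : R -> X)
    (lam : R) (psi : R -> X) : Prop :=
  lagrange_multiplier u0 x0 lam psi /\
  (lam = 1 \/ (lam = 0 /\ euclidean_norm (psi 0) = 1)).

Definition adjoint_system_sol (u0 : R -> Uc)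
    (psi x : R -> X) (lam : R -> R) : Prop :=
  [/\ forall t, 0 <= t -> 0 <= lam t,
      ode_sol psi (fun t => - dhamiltonian (x t) t (u0 t) (lam t) (psi t)),
      ode_sol x (fun t => f t (x t) (u0 t)) &
      ode_sol lam (fun=> 0)].

Definition vanishing_multiplier (tau : nat -> R) (u0 : R -> Uc) (x0 : R -> X)
    (lam0 : R) (psi0 : R -> X) : Prop :=
  lagrange_multiplier u0 x0 lam0 psi0 /\
  exists (phi : nat -> nat) (psi x : nat -> R -> X) (lam : nat -> R -> R),
    [/\ {homo phi : i j / (i < j)%N},
        {homo tau \o phi : i j / (i < j)%N >-> i < j} /\
          tau (phi n) @[n --> \oo] --> +oo,
        forall n, adjoint_system_sol u0 (psi n) (x n) (lam n),
        forall t, 0 <= t ->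
          [/\ psi n t @[n --> \oo] --> psi0 t,
              x n t @[n --> \oo] --> x0 t &
              lam n t @[n --> \oo] --> lam0] &
        forall n, psi n (tau (phi n)) = 0].

End ControlSystem.

(* Main.v *)
(** Optimality of u0 provides arbitrarily late horizons T at which u0 is optimal
    up to any prescribed error.  Fix S <= T.  Among the controls that equal u0
    outside [0, S] and stay in a fixed ball on [0, S], the measure of the set
    where two controls differ is a complete metric, so Ekeland's principle gives
    a control v close to u0 that is optimal at T up to a small multiple of the
    distance to v.  Needle variations turn this into a maximum condition on
    [0, S], up to a small error, for the costate that vanishes at T.

    Since v = u0 after S, running the state and the costate backwards from S
    with u0 in place of v produces an exact solution of (S) whose costate still
    vanishes at T; by Gronwall's inequality it is close on [0, S] to the pair
    belonging to v.  After normalisation of (lambda, psi 0) a subsequence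
    converges as S tends to infinity, and the maximum condition passes to the
    limit.

    The needles require a selection of U, Borel on some set of positive measure,
    inside a Borel set with non-negligible projection.  It is obtained from a
    compact subset with projection of positive measure (capacitability), thinned
    to a graph by minimising one coordinate after the other. *)

Require Import Defs.
From HB Require Import structures.
From mathcomp Require Import all_boot all_order all_algebra.
From mathcomp Require Import all_classical all_reals all_analysis.
From mathcomp Require Import measurable_realfun ring lra.

Set Implicit Arguments.
Unset Strict Implicit.
Unset Printing Implicit Defensive.

Import Order.TTheory GRing.Theory Num.Theory.
Import numFieldNormedType.Exports.

Local Open Scope classical_set_scope.
Local Open Scope ring_scope.


(** * Absolutely continuous functions *)

(** The order of the choices shapes the estimates: optimality holds up to an error, at horizons [T]
    that are known only after that error has been fixed, so no constant that determines the error
    may involve [T]. The closeness estimates are therefore confined to [[0, S]], where they depend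
    on [S] and on the control bound alone; constants involving [T] occur only in the needle
    variations, where shrinking the needle beats them. What stays uncontrolled is the size of the
    costate at time 0. As the adjoint equation is affine, the deviation of the costates is
    proportional to [1 + |psi 0|], and the normalisation cancels exactly this factor.

    Ekeland's principle gives a control within [gamma] whose slack is [gamma] per unit of distance,
    at the price of optimality up to [gamma ^+ 2]. The bound on the controls grows along the
    sequence, so that every value in [U t] is eventually tested even if [U t] is unbounded.
    Beforehand the data are set to 0 at negative times and on a null set of times: regularity then
    holds at every real time, and all equations become integral equations on the whole line. *)

Section AbsCont.
Context {R : realType}.
Notation mu := (@lebesgue_measure R).
Implicit Types (a b t s e d : R) (y : R -> R).

(** The supremum of the points of [[a, b]] where [P] holds cannot lie before [b]: a step across it,
    from less than [d / 2] below to [d / 3] above, would lead beyond it. *)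
Lemma real_induction (P : R -> Prop) a b : a <= b -> P a ->
  (forall t, a <= t <= b -> exists2 d, 0 < d &
     forall s s', a <= s -> s <= t -> t <= s' -> s' <= b -> s' - s < d ->
       P s -> P s') -> P b.
Proof.
move=> ab Pa step.
pose A := [set c | a <= c <= b /\ P c].
have A0 : A !=set0 by exists a; split => //; rewrite lexx ab.
have Aub : ubound A b by move=> c [/andP[]].
have supA : has_sup A by split => //; exists b.
have at_ : a <= sup A by apply: ub_le_sup; [exists b|split => //; rewrite lexx ab].
have tb : sup A <= b by apply: ge_sup.
have [|d d0 hd] := step (sup A); first by rewrite at_ tb.
have d20 : 0 < d / 2 by rewrite divr_gt0.
have [c [/andP[ac cb] Pc] hc] := sup_adherent d20 supA.
have ct : c <= sup A by apply: ub_le_sup; [exists b|split => //; rewrite ac cb].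
pose s' := Num.min b (sup A + d / 3).
have ts' : sup A <= s' by rewrite le_min tb lerDl divr_ge0// ltW.
have s'b : s' <= b by rewrite ge_min lexx.
have s'd : s' <= sup A + d / 3 by rewrite ge_min lexx orbT.
have Ps' : P s' by apply: (hd c) => //; lra.
have s't : s' <= sup A.
  by apply: ub_le_sup; [exists b|split => //; rewrite (le_trans at_)].
move: Ps'; rewrite /s' /Num.min; case: ifPn => // h.
by move: s't; rewrite /s' /Num.min (negbTE h); lra.
Qed.

(* The exceptional null set is covered by an open set so small that the
   variation of y over it is below e; real induction then moves from a to b
   using either the derivative bound or one of these intervals. *)
Lemma ac_nonincreasing y a b : a <= b -> abs_continuous a b y ->
  {ae mu, forall t, a <= t <= b -> forall e, 0 < e -> exists2 d, 0 < d &
    forall s s', a <= s -> s <= t -> t <= s' -> s' <= b -> s' - s < d ->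
      y s' - y s <= e * (s' - s)} ->
  y b <= y a.
Proof.
move=> ab acy [N [mN N0 NP]].
suff key e : 0 < e -> y b - y a <= e * (b - a) + e.
  rewrite -subr_le0; apply/ler_addgt0Pl => e e0; rewrite addr0.
  have b1 : 0 < b - a + 1 by rewrite ltr_wpDl// subr_ge0.
  apply: le_trans (key (e / (b - a + 1)) (divr_gt0 e0 b1)) _.
  by rewrite le_eqVlt; apply/orP; left; apply/eqP; field; rewrite gt_eqF.
move=> e0; have [d d0 acd] := acy _ e0.
have [|O [oO NO OD]] := @lebesgue_regularity_outer R N d mN _ d0.
  by rewrite [X in (X < _)%E]N0.
have mO : measurable O by exact: open_measurable.
have {}OD : (mu O < d%:E)%E.
  have OE : O = (O `\` N) `|` N by rewrite setUC setDUK.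
  rewrite OE; apply: le_lt_trans (measureU2 _ _ _) _ => //.
    exact: measurableD.
  by rewrite [X in (_ + X)%E]N0 adde0.
pose fam c (v : R) := exists n (I : 'I_n -> R * R),
  [/\ forall i, a <= (I i).1 /\ (I i).1 <= (I i).2 /\ (I i).2 <= c,
      forall i, `](I i).1, (I i).2[%classic `<=` O,
      trivIset setT (fun i => `](I i).1, (I i).2[%classic) &
      v = \sum_(i < n) `|y (I i).2 - y (I i).1|].
have famb v : fam b v -> v < e.
  move=> [n [I [Iab IO tI ->]]]; apply: acd => //.
  rewrite -lte_fin; apply: le_lt_trans OD.
  rewrite -sumEFin.
  rewrite (eq_bigr (fun i => mu `](I i).1, (I i).2[%classic)); last first.
    move=> i _; rewrite lebesgue_measure_itv/= lte_fin.
    case: ltP => // h; have [_ [h2 _]] := Iab i.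
    by rewrite (_ : (I i).2 = (I i).1) ?subrr//; apply/eqP; rewrite eq_le h.
  rewrite -measure_bigsetU_ord//=.
  apply: le_measure; rewrite ?inE//.
    by apply: bigsetU_measurable => i _.
  by apply: (big_ind (fun A => A `<=` O)) => // A B AO BO z [/AO|/BO].
(* The excess [v] is recorded as the variation over an actual family of intervals, so that one more
   interval can be appended; absolute continuity bounds it by [e] only once, at [b]. *)
pose P c := exists2 v, fam c v & y c - y a <= e * (c - a) + v.
have Pa : P a.
  exists 0; last by rewrite !subrr mulr0 addr0.
  exists 0, (fun _ => (0, 0)); split; rewrite ?big_ord0//; by case.
suff [v /famb vb h] : P b by apply: le_trans h _; rewrite lerD2l ltW.
apply: (real_induction ab Pa) => t tab.
have [tO|tO] := pselect (O t); last first.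
  have /= Gt := contrapT (contra_not (NP t) (contra_not (NO t) tO)).
  have [d1 d10 h] := Gt tab _ e0; exists d1 => // s s' as_ st ts' s'b ss' [v [n [I [h1 h2 h3 h4]]] hv].
  exists v; last by have := h _ _ as_ st ts' s'b ss'; nra.
  exists n, I; split => // i; have [? []] := h1 i; split => //; split => //; lra.
have /nbhs_ballP[d1 /= d10 hd1] : nbhs t O by exact: open_nbhs_nbhs.
exists d1 => // s s' as_ st ts' s'b ss' [v [n [I [h1 h2 h3 h4]]] hv].
exists (v + `|y s' - y s|); last first.
  have := ler_norm (y s' - y s); nra.
pose J (i : 'I_n.+1) := if unlift ord_max i is Some j then I j else (s, s').
exists n.+1, J; split.
- move=> i; rewrite /J; case: unliftP => [j|] _ /=; last by lra.
  by have [? []] := h1 j; split => //; split => //; lra.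
- move=> i; rewrite /J; case: unliftP => [j|] _ //=.
  move=> z /=; rewrite in_itv/= => /andP[z1 z2]; apply: hd1.
  by rewrite /ball/= ltr_distl; lra.
- move=> i j _ _ [z]; rewrite /J.
  case: unliftP => [i'|] -> /=; case: unliftP => [j'|] -> //=.
  + by move=> h; congr lift; apply: h3 => //; exists z.
  + rewrite !in_itv/= => -[/andP[_ z1] /andP[z2 _]].
    by exfalso; have [_ [_ ?]] := h1 i'; lra.
  + rewrite !in_itv/= => -[/andP[z2 _] /andP[_ z1]].
    by exfalso; have [_ [_ ?]] := h1 j'; lra.
- rewrite big_ord_recr/= h4 /J unlift_none/=; congr (_ + _).
  apply: eq_bigr => i _; rewrite (_ : widen_ord _ i = lift ord_max i) ?liftK//.
  by apply: val_inj; rewrite /= /bump leqNgt ltn_ord.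
Qed.

End AbsCont.

(** * Primitives of locally integrable functions *)

Section Prim.
Context {R : realType}.
Notation mu := (@lebesgue_measure R).
Implicit Types (a b t s e d : R) (h g y : R -> R).

Definition li h := measurable_fun setT h /\
  forall a b, mu.-integrable `[a, b] (EFin \o h).

(** For negative [t] the interval is empty and the value is 0; primitives, and with them all
    solutions built below, are constant before time 0. *)
Definition prim h t : R := (\int[mu]_(s in `[0%R, t]) h s)%R.

Lemma ae_imp2 (P Q S : R -> Prop) : {ae mu, forall t, P t} ->
  {ae mu, forall t, Q t} -> (forall t, P t -> Q t -> S t) ->
  {ae mu, forall t, S t}.
Proof.
move=> hP hQ PQ; apply: (@filterS2 _ _ (ae_filter_ringOfSetsType mu) _ _ _ PQ) => //.
Qed.

Lemma ae_imp (P S : R -> Prop) : {ae mu, forall t, P t} ->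
  (forall t, P t -> S t) -> {ae mu, forall t, S t}.
Proof. by move=> hP PQ; apply: (ae_imp2 hP hP) => t /PQ. Qed.

Lemma li_dom h g : measurable_fun setT h -> li g ->
  (forall a b, exists C, forall t, a <= t <= b -> `|h t| <= C * g t) -> li h.
Proof.
move=> mh [mg ig] hg; split => // a b; have [C hC] := hg a b.
apply: (@le_integrable _ _ _ mu _ _ _ (fun t => C%:E * (g t)%:E)%E) => //.
- by apply/measurable_EFinP; exact: measurable_funTS.
- move=> t; rewrite /= in_itv/= => /hC ht; rewrite lee_fin.
  by rewrite (le_trans ht)// ler_norm.
- exact: integrableZl.
Qed.

Lemma li_le h g : measurable_fun setT h -> li g ->
  (forall t, `|h t| <= g t) -> li h.
Proof.
by move=> mh lg hg; apply: (li_dom mh lg) => a b; exists 1 => t _; rewrite mul1r.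
Qed.

Lemma li_cst c : li (cst c : R -> R).
Proof.
split; first exact: measurable_cst.
move=> a b; apply: measurable_bounded_integrable => //.
  by rewrite [X in (X < _)%E]lebesgue_measure_itv/=; case: ifP => // _; rewrite -EFinB ltry.
by exists `|c|; split => //= x cx t _ /=; rewrite ltW.
Qed.

Lemma liD h g : li h -> li g -> li (fun t => h t + g t).
Proof.
move=> [mh ih] [mg ig]; split; first exact: measurable_funD.
by move=> a b; apply: (@integrableD _ _ _ mu _ _ (EFin \o h) (EFin \o g)).
Qed.

Lemma liZ c h : li h -> li (fun t => c * h t).
Proof.
move=> lh; have [mh ih] := lh; split.
  exact: measurable_funM.
by move=> a b; apply: (@integrableZl _ _ _ mu _ _ _ (EFin \o h)).
Qed.

Lemma liN h : li h -> li (fun t => - h t).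
Proof.
by move=> /(liZ (-1)); congr li; apply/funext => t; rewrite mulN1r.
Qed.

Lemma liB h g : li h -> li g -> li (fun t => h t - g t).
Proof. by move=> lh /liN; exact: liD. Qed.

Lemma li_norm h : li h -> li (fun t => `|h t|).
Proof.
move=> [mh ih]; split; first exact: measurableT_comp.
by move=> a b; exact: integrable_norm.
Qed.

Lemma li_sum (I : Type) (r : seq I) (h : I -> R -> R) :
  (forall i, li (h i)) -> li (fun t => \sum_(i <- r) h i t).
Proof.
move=> lh; elim: r => [|i r ih].
  by under eq_fun do rewrite big_nil; exact: li_cst.
have -> : (fun t => \sum_(j <- i :: r) h j t) =
    (fun t => h i t + \sum_(j <- r) h j t).
  by apply/funext => t; rewrite big_cons.
exact: liD.
Qed.

Lemma prim_sub h s t : li h -> 0 <= s -> s <= t ->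
  prim h t - prim h s = (\int[mu]_(u in `]s, t]) h u)%R.
Proof.
move=> [mh ih] s0 st; rewrite /prim Rintegral_itvB//; by rewrite bnd_simp.
Qed.

Lemma prim0 h : prim h 0 = 0.
Proof.
by rewrite /prim set_itv1 Rintegral_set1.
Qed.

Lemma primD h g t : li h -> li g ->
  prim (fun s => h s + g s) t = prim h t + prim g t.
Proof. by move=> [mh ih] [mg ig]; rewrite /prim RintegralD. Qed.

Lemma primB h g t : li h -> li g ->
  prim (fun s => h s - g s) t = prim h t - prim g t.
Proof. by move=> [mh ih] [mg ig]; rewrite /prim RintegralB. Qed.

Lemma primZ c h t : li h -> prim (fun s => c * h s) t = c * prim h t.
Proof. by move=> [mh ih]; rewrite /prim RintegralZl. Qed.

Lemma prim_le h g s t : li h -> li g -> 0 <= s -> s <= t ->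
  (forall u, s < u <= t -> h u <= g u) ->
  prim h t - prim h s <= prim g t - prim g s.
Proof.
move=> lh lg s0 st hg; rewrite !prim_sub//; have [mh ih] := lh; have [mg ig] := lg.
have sub : `]s, t]%classic `<=` `[s, t]%classic.
  by move=> u /=; rewrite !in_itv/= => /andP[/ltW -> ->].
by apply: le_Rintegral => //; [exact: integrableS (ih s t)|exact: integrableS (ig s t)].
Qed.

Lemma prim_dist h g s t : li h -> li g -> 0 <= s -> s <= t ->
  (forall u, s < u <= t -> `|h u| <= g u) ->
  `|prim h t - prim h s| <= prim g t - prim g s.
Proof.
move=> lh lg s0 st hg; rewrite ler_norml; apply/andP; split.
  have := prim_le (liN lg) lh s0 st.
  have E u : prim (fun s => - g s) u = - prim g u.
    by rewrite -[RHS]mulN1r -primZ//; congr prim; apply/funext => v; rewrite mulN1r.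
  rewrite !E => /(_ _) h1; rewrite opprB; apply: le_trans (h1 _); first by lra.
  by move=> u /hg; rewrite ler_norml => /andP[].
by apply: prim_le => // u /hg; exact: le_trans (ler_norm _).
Qed.

(** Absolute continuity of the integral for the restriction of [h] to [[0, S]]. *)
Lemma prim_small h S e : li h -> 0 < e -> exists2 d, 0 < d &
  forall D : set R, measurable D -> (mu D < d%:E)%E ->
    prim (fun t => `|h t| * \1_D t) S < e.
Proof.
move=> [mh ih] e0.
have iS : mu.-integrable setT (EFin \o (h \_ `[0, S])).
  by rewrite -restrict_EFin -integrable_mkcond.
have [d [d0 hd]] := integral_normr_continuous iS e0.
exists d => // D mD /(hd D mD); apply: le_lt_trans.
rewrite /prim Rintegral_mkcond [leRHS]Rintegral_mkcond.
rewrite le_eqVlt; apply/orP; left; apply/eqP; apply: eq_Rintegral => t _.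
rewrite !patchE indicE; case: (t \in D) => /=; case: ifPn => //=; rewrite ?mulr1 ?mulr0 ?normr0//.
Qed.

Lemma prim_ac h a b : li h -> 0 <= a -> abs_continuous a b (prim h).
Proof.
move=> lh a0 e e0; have [mh ih] := lh.
have iS : mu.-integrable setT (EFin \o (h \_ `[0, b])).
  by rewrite -restrict_EFin -integrable_mkcond.
have [d [d0 hd]] := integral_normr_continuous iS e0.
exists d => // n I Iab tI sI.
pose J i := `](I i).1, (I i).2[%classic.
pose D := \big[setU/set0]_(i < n) J i.
have mD : measurable D by apply: bigsetU_measurable => i _; exact: measurable_itv.
have JS i : J i `<=` `[0, b].
  move=> z; rewrite /J/= !in_itv/= => /andP[z1 z2].
  by have [h1 [h2 h3]] := Iab i; apply/andP; split; lra.
have DS : D `<=` `[0, b].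
  by apply: (big_ind (fun A => A `<=` `[0, b])) => // A B AO BO z [/AO|/BO].
have iD : mu.-integrable D (EFin \o (fun t => `|h t|)).
  by apply: integrable_norm; exact: integrableS (ih 0 b).
have io i : mu.-integrable (J i) (EFin \o h).
  by apply: integrableS (ih 0 b) => //; exact: measurable_itv.
have muD : (mu D < d%:E)%E.
  have -> : mu D = (\sum_(i < n) mu (J i))%E.
    by apply: measure_bigsetU_ord => // i; exact: measurable_itv.
  apply: (@le_lt_trans _ _ (\sum_(i < n) ((I i).2 - (I i).1))%:E); last first.
    by rewrite lte_fin.
  rewrite -sumEFin; apply: lee_sum => i _.
  rewrite [X in (X <= _)%E]lebesgue_measure_itv/=; have [h1 [h2 h3]] := Iab i.
  by case: ifPn => // _; rewrite lee_fin subr_ge0.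
apply: le_lt_trans (hd D mD muD).
have -> : (\int[mu]_(x in D) `|(h \_ `[0%R, b]) x|)%R = (\int[mu]_(x in D) `|h x|)%R.
  apply: eq_Rintegral => x xD; rewrite patchE mem_set//.
  exact/DS/set_mem.
have -> : (\int[mu]_(x in D) `|h x|)%R = \sum_(i < n) (\int[mu]_(x in J i) `|h x|)%R.
  rewrite /Rintegral integral_bigsetU_EFin//=.
  - rewrite sum_fine// => i _; apply: integrable_fin_num => //.
      exact: measurable_itv.
    exact: (integrable_norm (io i)).
  - by move=> i; exact: measurable_itv.
  - exact: index_enum_uniq.
  - exact: sub_trivIset tI.
  - case: (li_norm lh) => mn _; apply/measurable_EFinP.
    exact: measurable_funTS.
apply: ler_sum => i _; have [h1 [h2 h3]] := Iab i.
rewrite prim_sub// ?(le_trans a0)//.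
rewrite -Rintegral_itv_bndo_bndc//; last exact: io.
by apply: le_normr_Rintegral => //; exact: io.
Qed.

Lemma prim_derive h : li h ->
  ae_time (fun t => is_derive t (1 : R) (prim h) (h t)).
Proof.
move=> [mh ih].
have loc : locally_integrable setT h.
  split => //; first exact: openT.
  move=> K _ cK; have [M [_ hM]] := compact_bounded cK.
  have KM : K `<=` `[- (M + 1), M + 1].
    move=> t /(hM (M + 1)); rewrite ltrDl ltr01 => /(_ isT).
    by rewrite /= in_itv/= ler_norml.
  have /integrableP[_] := ih (- (M + 1)) (M + 1).
  apply: le_lt_trans; apply: ge0_subset_integral => //=.
    exact: compact_measurable.
  by apply/measurable_EFinP/measurableT_comp => //; exact: measurable_funTS.
(* The primitive is constant before 0 and may have a corner there, so 0 joins the null set. *)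
have n0 : {ae mu, forall t : R, t != 0}.
  exists [set 0]; split => //; first by rewrite lebesgue_measure_set1.
  by move=> t /=; case: eqP => // ->.
apply: (ae_imp2 n0 (lebesgue_differentiation loc)) => t t0 ht t1.
have tt : 0 < t by rewrite lt_neqAle eq_sym t0.
have [||/= d1 d2] := @FTC1_lebesgue_pt R h (BLeft 0) t (t + 1) _ (ih 0 (t + 1)) _ ht.
- by rewrite ltrDl.
- by rewrite lte_fin.
- by apply: DeriveDef; [exact: d1|rewrite -derive1E; exact: d2].
Qed.

Lemma ac_dom (V : normedModType R) a b (y1 y2 : R -> R) (z : R -> V) C :
  0 <= C -> abs_continuous a b y1 -> abs_continuous a b y2 ->
  (forall s t, a <= s -> s <= t -> t <= b ->
     `|z t - z s| <= C * (`|y1 t - y1 s| + `|y2 t - y2 s|)) ->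
  abs_continuous a b z.
Proof.
move=> C0 a1 a2 hz e e0.
have C1 : 0 < C + 1 by lra.
have e2 : 0 < e / (C + 1) / 2 by rewrite !divr_gt0.
have [d1 d10 h1] := a1 _ e2; have [d2 d20 h2] := a2 _ e2.
exists (Num.min d1 d2); first by rewrite lt_min d10.
move=> n I Iab tI; rewrite lt_min => /andP[/(h1 _ _ Iab tI) s1 /(h2 _ _ Iab tI) s2].
apply: (@le_lt_trans _ _ (\sum_(i < n) C * (`|y1 (I i).2 - y1 (I i).1| +
   `|y2 (I i).2 - y2 (I i).1|))).
  by apply: ler_sum => i _; have [? [? ?]] := Iab i; exact: hz.
rewrite -mulr_sumr big_split/=.
set u := \sum_(i < n) _ in s1 *; set v := \sum_(i < n) _ in s2 *.
have uv : u + v < e / (C + 1) by lra.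
have : 0 <= u + v by rewrite addr_ge0 ?sumr_ge0.
have -> : e = e / (C + 1) * (C + 1) by field; rewrite gt_eqF.
nra.
Qed.

Lemma is_derive1_cvg (V : normedModType R) (y : R -> V) t v :
  is_derive t (1 : R) y v <-> h^-1 *: (y (h + t) - y t) @[h --> (0 : R)^'] --> v.
Proof.
have E : (fun h : R => h^-1 *: (y (h + t) - y t)) =
    (fun h : R => h^-1 *: ((y \o shift t) (h *: (1 : R)) - y t)).
  by apply/funext => h /=; rewrite [h *: 1]mulr1.
rewrite E; split.
  by move=> [d <-]; exact: d.
move=> h; apply: DeriveDef; first by apply/cvg_ex; exists v.
by apply/cvg_lim => //; exact: norm_hausdorff.
Qed.

(** An interval straddling [t] is split at [t]; the difference quotients on the two sides then add
    up to the straddled estimate of [ac_nonincreasing]. *)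
Lemma ac_nonincr_derive y a b : 0 <= a -> a <= b -> abs_continuous a b y ->
  ae_time (fun t => a <= t <= b -> exists2 v, is_derive t (1 : R) y v & v <= 0) ->
  y b <= y a.
Proof.
move=> a0 ab acy hy; apply: (ac_nonincreasing ab acy).
apply: (ae_imp hy) => t ht tab e e0.
have t0 : 0 <= t by lra.
have [v /is_derive1_cvg /cvgrPdist_lt/(_ e e0) + v0] := ht t0 tab.
rewrite near_withinE => /nbhs_ballP[d /= d0 hd].
have one s : `|s - t| < d -> s != t -> `|v - (s - t)^-1 * (y s - y t)| < e.
  move=> st sn; have := hd (s - t); rewrite /ball/= sub0r normrN => /(_ st).
  by rewrite subr_eq0 => /(_ sn); rewrite subrK.
have right s : t <= s -> s - t < d -> y s - y t <= e * (s - t).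
  rewrite le_eqVlt => /predU1P[<-|ts sd]; first by rewrite !subrr mulr0.
  have := one s; rewrite gtr0_norm ?subr_gt0// => /(_ sd); rewrite gt_eqF// => /(_ isT).
  have st : 0 < s - t by rewrite subr_gt0.
  rewrite ltr_norml => /andP[h _].
  have E : y s - y t = (s - t)^-1 * (y s - y t) * (s - t) by field; rewrite gt_eqF.
  by rewrite E ler_pM2r//; lra.
have left s : s <= t -> t - s < d -> y t - y s <= e * (t - s).
  rewrite le_eqVlt => /predU1P[->|ts sd]; first by rewrite !subrr mulr0.
  have := one s; rewrite ltr0_norm ?subr_lt0// opprB => /(_ sd); rewrite lt_eqF// => /(_ isT).
  have st : 0 < t - s by rewrite subr_gt0.
  rewrite ltr_norml => /andP[h _].
  have E : y t - y s = (s - t)^-1 * (y s - y t) * (t - s).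
    by field; rewrite lt_eqF// subr_lt0.
  by rewrite E ler_pM2r//; lra.
exists d => // s s' as_ st ts' s'b ss'.
have := right _ ts'; have := left _ st.
move=> /(_ _)/wrap[]; first lra.
by move=> ? /(_ _)/wrap[]; lra.
Qed.

(** Both [y - prim h] and its negative have derivative 0 almost everywhere, hence both are
    nonincreasing. *)
Lemma ac_fun_eq_prim h y : li h -> (forall T, abs_continuous 0 T y) ->
  ae_time (fun t => is_derive t (1 : R) y (h t)) ->
  forall t, 0 <= t -> y t = y 0 + prim h t.
Proof.
move=> lh acy dy t t0.
have dp := prim_derive lh.
have acp T := prim_ac T lh (lexx 0).
have acz c T : abs_continuous 0 T (fun t => c * (y t - prim h t)).
  apply: (@ac_dom _ 0 T _ _ _ `|c|) (acy T) (acp T) _ => // s u _ _ _.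
  rewrite -mulrBr normrM ler_wpM2l//.
  by rewrite (_ : y u - _ - _ = (y u - y s) - (prim h u - prim h s)) ?ler_normB//; ring.
have dz c : ae_time (fun s => 0 <= s <= t ->
    exists2 v, is_derive s (1 : R) (fun t => c * (y t - prim h t)) v & v <= 0).
  apply: (ae_imp2 dy dp) => s h1 h2 s0 _; exists 0 => //.
  have := is_deriveZ c (is_deriveB (h1 s0) (h2 s0)).
  by rewrite subrr scaler0; exact.
have := ac_nonincr_derive (lexx 0) t0 (acz 1 t) (dz 1).
have := ac_nonincr_derive (lexx 0) t0 (acz (-1) t) (dz (-1)).
rewrite prim0 => h1 h2; lra.
Qed.

End Prim.

(** * Gronwall's inequality *)

Section RowVectors.
Context {R : realType}.

Lemma rV_norm_le n (x : 'rV[R]_n) c : 0 <= c ->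
  (forall i, `|x ord0 i| <= c) -> `|x| <= c.
Proof.
move=> c0 hx; rewrite /Num.norm/= mx_normrE.
by apply: bigmax_le => // -[i j] _ /=; rewrite (ord1 i).
Qed.

Lemma rV_coord_le n (x : 'rV[R]_n) i : `|x ord0 i| <= `|x|.
Proof.
rewrite [leRHS]/Num.norm/= mx_normrE.
exact: (le_bigmax _ (fun ij : 'I_1 * 'I_n => `|x ij.1 ij.2|) (ord0, i)).
Qed.

Lemma rV_coord_cvg n T (F : set_system T) (y : T -> 'rV[R]_n) (v : 'rV[R]_n) i :
  y @ F --> v -> y s ord0 i @[s --> F] --> v ord0 i.
Proof.
move=> h; apply: (@cvg_comp _ _ _ y (fun M : 'rV[R]_n => M ord0 i) F (nbhs v)) => //.
exact: coord_continuous.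
Qed.

Lemma rV_cvg n T (F : set_system T) (FF : Filter F) (y : T -> 'rV[R]_n) (v : 'rV[R]_n) :
  (forall i, y s ord0 i @[s --> F] --> v ord0 i) -> y @ F --> v.
Proof.
move=> h; apply/cvgrPdist_le => e e0.
have /filter_forall : forall i, \forall s \near F, `|v ord0 i - y s ord0 i| <= e.
  by move=> i; have /cvgrPdist_le/(_ e e0) := h i.
apply: filterS => s hs; apply: rV_norm_le => [|i]; first exact: ltW.
by rewrite !mxE; exact: hs.
Qed.

Lemma rV_norm_le_sum n (x : 'rV[R]_n) : `|x| <= \sum_i `|x ord0 i|.
Proof.
apply: rV_norm_le => [|i]; first by rewrite sumr_ge0.
by rewrite (bigD1 i)//= lerDl sumr_ge0.
Qed.

Lemma compact_norm_ball n (r : R) : compact [set x : 'rV[R]_n | `|x| <= r].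
Proof.
apply: bounded_closed_compact.
  exists r; split=> [|y ry v /= vr]; first exact: num_real.
  by rewrite (le_trans vr)// ltW.
apply: (@closed_comp _ _ (fun v : 'rV[R]_n => `|v|) [set x | x <= r]); last exact: closed_le.
by move=> v _; exact: norm_continuous.
Qed.

End RowVectors.

Section ExpAC.
Context {R : realType}.
Implicit Types (a b t s e d : R) (h g y : R -> R).

Lemma expR_lipschitz (C u v : R) : u <= C -> v <= C ->
  `|expR u - expR v| <= expR C * `|u - v|.
Proof.
wlog uv : u v / v <= u => [H|uC vC].
  have [vu|/ltW uv] := leP v u; first exact: H.
  by move=> uC vC; rewrite distrC (distrC u); exact: H.
have h : expR v <= expR u by rewrite ler_expR.
rewrite !ger0_norm ?subr_ge0//.
have E : expR v = expR u * expR (v - u) by rewrite -expRD addrC subrK.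
have h1 := expR_ge1Dx (v - u).
have h2 : expR u <= expR C by rewrite ler_expR.
have h3 := expR_gt0 u.
rewrite E; apply: (@le_trans _ _ (expR u * (u - v))); last first.
  by rewrite ler_wpM2r// subr_ge0.
rewrite -[X in X - _]mulr1 -mulrBr ler_pM2l//; lra.
Qed.

Lemma ac_expR y a b C : abs_continuous a b y ->
  (forall t, a <= t <= b -> y t <= C) -> abs_continuous a b (fun t => expR (y t)).
Proof.
move=> acy yC; apply: (@ac_dom _ _ _ _ y y _ (expR C)) => //.
move=> s t as_ st tb; apply: le_trans (expR_lipschitz (C := C) _ _) _.
- by apply: yC; lra.
- by apply: yC; lra.
- by rewrite ler_wpM2l ?lerDl// ltW// expR_gt0.
Qed.

Lemma ac_mul y1 y2 a b C : 0 <= C -> abs_continuous a b y1 -> abs_continuous a b y2 ->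
  (forall t, a <= t <= b -> `|y1 t| <= C /\ `|y2 t| <= C) ->
  abs_continuous a b (fun t => y1 t * y2 t).
Proof.
move=> C0 ac1 ac2 yC; apply: (ac_dom C0 ac1 ac2) => s t as_ st tb.
have -> : y1 t * y2 t - y1 s * y2 s = y2 t * (y1 t - y1 s) + y1 s * (y2 t - y2 s).
  by ring.
rewrite [leRHS]mulrDr (le_trans (ler_normD _ _))// !normrM lerD// ler_wpM2r//.
  by apply: (yC t _).2; lra.
by apply: (yC s _).1; lra.
Qed.

Lemma ac_affine c k y a b : abs_continuous a b y ->
  abs_continuous a b (fun t => c + k * y t).
Proof.
move=> acy; apply: (@ac_dom _ _ _ _ y y _ `|k|) => // s t _ _ _.
have -> : c + k * y t - (c + k * y s) = k * (y t - y s) by ring.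
by rewrite normrM ler_wpM2l// lerDl.
Qed.

Lemma prim_bound h b : li h -> exists2 C, 0 <= C &
  forall t, 0 <= t <= b -> `|prim h t| <= C.
Proof.
move=> lh; have lnh := li_norm lh; exists `|prim (fun t => `|h t|) b| => // t /andP[t0 tb].
have := @prim_dist _ h (fun t => `|h t|) 0 t lh lnh (lexx 0) t0 (fun _ _ => lexx _).
have := @prim_dist _ h (fun t => `|h t|) t b lh lnh t0 tb (fun _ _ => lexx _).
rewrite !prim0 !subr0 => h1 h2; apply: le_trans h2 _.
have := ler_norm (prim (fun t => `|h t|) b); have := normr_ge0 (prim h b - prim h t); lra.
Qed.

Lemma prim_nondecreasing h s t : li h -> (forall t, 0 <= h t) -> 0 <= s -> s <= t ->
  prim h s <= prim h t.
Proof.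
move=> lh h0 s0 st; rewrite -subr_ge0.
have := @prim_le _ (fun u => 0 * h u) h s t (liZ 0 lh) lh s0 st.
by rewrite !primZ// !mul0r subr0; apply => u _; rewrite mul0r.
Qed.

Lemma prim_ge0 h t : li h -> (forall t, 0 <= h t) -> 0 <= t -> 0 <= prim h t.
Proof. by move=> lh h0 t0; rewrite -(prim0 h); exact: prim_nondecreasing. Qed.

Section Gronwall.
Variables (L phi : R -> R).
Hypotheses (lL : li L) (L0 : forall t, 0 <= L t) (lLp : li (fun t => L t * phi t)).
Let Lp t := L t * phi t.

Let ac_weighted c k s T : 0 <= s ->
  abs_continuous s T (fun t => (c + prim Lp t) * expR (k * prim L t)).
Proof.
move=> s0; have [C1 C10 h1] := prim_bound T lLp; have [C2 C20 h2] := prim_bound T lL.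
apply: (@ac_mul _ _ _ _ (`|c| + C1 + expR (`|k| * C2))).
- by rewrite !addr_ge0 ?mulr_ge0 ?expR_ge0.
- have -> : (fun t => c + prim Lp t) = (fun t => c + 1 * prim Lp t).
    by apply/funext => t; rewrite mul1r.
  exact/ac_affine/prim_ac.
- apply: (@ac_expR (fun t => k * prim L t) _ _ (`|k| * C2)).
    have -> : (fun t => k * prim L t) = (fun t => 0 + k * prim L t).
      by apply/funext => t; rewrite add0r.
    exact/ac_affine/prim_ac.
  move=> t /andP[st tT]; apply: le_trans (ler_norm _) _.
  by rewrite normrM ler_wpM2l// h2// tT andbT (le_trans s0).
- move=> t /andP[st tT].
  have tt : 0 <= t <= T by rewrite tT andbT (le_trans s0).
  split.
    apply: le_trans (ler_normD _ _) _; rewrite -addrA lerD2l ler_wpDr ?expR_ge0//.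
    exact: h1.
  rewrite ger0_norm ?expR_ge0// ler_wpDl ?addr_ge0// ler_expR.
  apply: le_trans (ler_norm _) _.
  by rewrite normrM ler_wpM2l// h2.
Qed.

Let weighted_derive c k : ae_time (fun t =>
  is_derive t (1 : R) (fun t => (c + prim Lp t) * expR (k * prim L t))
    (L t * (phi t + k * (c + prim Lp t)) * expR (k * prim L t))).
Proof.
apply: (ae_imp2 (prim_derive lL) (prim_derive lLp)) => t h1 h2 t0.
have d1 := is_deriveD (is_derive_cst c t (1 : R)) (h2 t0).
have d2 := @is_derive1_comp _ _ (fun t => k * prim L t) _ _ _
  (is_derive_expR (k * prim L t)) (is_deriveZ k (h1 t0)).
refine (@is_derive_eq _ _ _ _ _ _ _ _ (is_deriveM d1 d2) _).
rewrite /GRing.scale/= /Lp.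
rewrite [(cst c + _) t](_ : _ = c + prim (fun t => L t * phi t) t)//; ring.
Qed.

(** The integrating-factor argument with a sign parameter: [k = -1] yields the forward inequality,
    [k = 1] the backward one. *)
Let weighted_decr c k s T : 0 <= s -> s <= T ->
  (forall t, s <= t <= T -> phi t + k * (c + prim Lp t) <= 0) ->
  (c + prim Lp T) * expR (k * prim L T) <= (c + prim Lp s) * expR (k * prim L s).
Proof.
move=> s0 sT hphi; apply: (ac_nonincr_derive s0 sT (ac_weighted c k T s0)).
apply: (ae_imp (weighted_derive c k)) => t h t0 st.
eexists; first exact: h.
by rewrite pmulr_lle0 ?expR_gt0// mulr_ge0_le0// hphi.
Qed.

Lemma gronwall_forward a s T : 0 <= s -> s <= T ->
  (forall t, s <= t <= T -> phi t <= a + (prim Lp t - prim Lp s)) ->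
  phi T <= a * expR (prim L T - prim L s).
Proof.
move=> s0 sT hphi; pose c := a - prim Lp s.
have := @weighted_decr c (-1) _ _ s0 sT.
move=> /(_ _)/wrap[]; first by move=> t /hphi; rewrite /c; lra.
rewrite !mulN1r => h.
have -> : expR (prim L T - prim L s) = expR (prim L T) * expR (- prim L s).
  by rewrite expRD.
have eT := expR_gt0 (prim L T).
have : (c + prim Lp T) <= (c + prim Lp s) * expR (- prim L s) * expR (prim L T).
  have -> : c + prim Lp T = (c + prim Lp T) * expR (- prim L T) * expR (prim L T).
    by rewrite -mulrA -expRD addNr expR0 mulr1.
  by rewrite ler_pM2r.
rewrite /c subrK -mulrA (mulrC (expR (- _))); apply: le_trans.
have := hphi T; rewrite lexx sT => /(_ isT) h1.
by apply: le_trans h1 _; rewrite addrA [leRHS]addrAC.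
Qed.

Lemma gronwall_backward a s T : 0 <= s -> s <= T ->
  (forall t, s <= t <= T -> phi t <= a + (prim Lp T - prim Lp t)) ->
  phi s <= a * expR (prim L T - prim L s).
Proof.
move=> s0 sT hphi; pose c := - (a + prim Lp T).
have := @weighted_decr c 1 _ _ s0 sT.
move=> /(_ _)/wrap[]; first by move=> t /hphi; rewrite /c; lra.
rewrite !mul1r => h.
have -> : expR (prim L T - prim L s) = expR (prim L T) * expR (- prim L s).
  by rewrite expRD.
have es := expR_gt0 (- prim L s).
have : (c + prim Lp T) * expR (prim L T) * expR (- prim L s) <= (c + prim Lp s).
  have -> : c + prim Lp s = (c + prim Lp s) * expR (prim L s) * expR (- prim L s).
    by rewrite -mulrA -expRD subrr expR0 mulr1.
  by rewrite ler_pM2r.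
rewrite /c opprD subrK -mulrA mulNr.
have := hphi s; rewrite lexx sT => /(_ isT) h1 h2.
by clear -h1 h2; lra.
Qed.
End Gronwall.

End ExpAC.

(** * Vector-valued primitives and perturbation of integral equations *)

Section VectorPrim.
Context {R : realType}.
Implicit Types (a b t s e d : R) (h g : R -> R).

Lemma prim_neg h t : t < 0 -> prim h t = 0.
Proof.
by move=> t0; rewrite /prim set_itv_ge ?bnd_simp ?Rintegral_set0// -ltNge.
Qed.

Lemma prim_maxr h t : prim h (Num.max 0 t) = prim h t.
Proof. by have [//|t0] := leP 0 t; rewrite prim0 prim_neg. Qed.

Lemma eq_prim h g t : (forall s, 0 <= s <= t -> h s = g s) -> prim h t = prim g t.
Proof.
by move=> hg; apply: eq_Rintegral => s /set_mem /=; rewrite in_itv/= => /hg.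
Qed.

Lemma prim_norm_dist h g s t : li h -> li g -> 0 <= s -> 0 <= t ->
  (forall u, 0 <= u <= Num.max s t -> `|h u| <= g u) ->
  `|prim h t - prim h s| <= `|prim g t - prim g s|.
Proof.
move=> lh lg s0 t0 hg.
have [st|/ltW ts] := leP s t; last rewrite distrC (distrC (prim g t)).
  apply: le_trans (ler_norm _); apply: prim_dist => // u /andP[su ut].
  by apply: hg; rewrite le_max ut orbT andbT; lra.
apply: le_trans (ler_norm _); apply: prim_dist => // u /andP[su ut].
by apply: hg; rewrite le_max ut andbT; lra.
Qed.

Lemma measurable_prim h : li h -> measurable_fun setT (prim h).
Proof.
move=> lh.
have mono g : li g -> (forall t, 0 <= g t) -> measurable_fun setT (prim g).
  move=> lg g0; apply: nondecreasing_measurable => // s t st.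
  rewrite -(prim_maxr _ s) -(prim_maxr _ t); apply: prim_nondecreasing => //.
    by rewrite le_max lexx.
  by rewrite ge_max le_max lexx/= le_max st orbT.
have lp : li (fun t => `|h t| + h t) by apply: liD => //; exact: li_norm.
have -> : prim h = (fun t => prim (fun t => `|h t| + h t) t - prim (fun t => `|h t|) t).
  apply/funext => t; rewrite primD//; [ring|exact: li_norm].
apply: measurable_funB; apply: mono => //; [|exact: li_norm].
by move=> t; have := ler_norm (- h t); rewrite normrN; lra.
Qed.

Definition vmeas n (y : R -> 'rV[R]_n) := forall i, measurable_fun setT (fun t => y t ord0 i).
Definition vli n (F : R -> 'rV[R]_n) := forall i, li (fun t => F t ord0 i).
Definition vprim n (F : R -> 'rV[R]_n) t : 'rV[R]_n :=
  \row_i prim (fun s => F s ord0 i) t.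

Lemma vmeas_norm n (y : R -> 'rV[R]_n) : vmeas y -> measurable_fun setT (fun t => `|y t|).
Proof.
move=> my; rewrite [X in measurable_fun _ X](_ : _ =
    (fun t => \big[Num.max/0]_(ij : 'I_1 * 'I_n) `|y t ij.1 ij.2|)); last first.
  by apply/funext => t; rewrite [LHS]/Num.norm/= mx_normrE.
elim: (index_enum _) => [|[i j] r ih].
  by under eq_fun do rewrite big_nil; exact: measurable_cst.
under eq_fun do rewrite big_cons; apply: measurable_maxr => //=.
by apply: measurableT_comp => //; rewrite (ord1 i); exact: my.
Qed.

Lemma vmeasD n (y z : R -> 'rV[R]_n) : vmeas y -> vmeas z -> vmeas (fun t => y t + z t).
Proof.
by move=> my mz i; under eq_fun do rewrite mxE; apply: measurable_funD.
Qed.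

Lemma vmeasN n (y : R -> 'rV[R]_n) : vmeas y -> vmeas (fun t => - y t).
Proof.
by move=> my i; under eq_fun do rewrite mxE; apply: measurableT_comp => //; exact: my.
Qed.

Lemma vmeas_cst n (c : 'rV[R]_n) : vmeas (fun=> c).
Proof. by move=> i; exact: measurable_cst. Qed.

Lemma vmeas_vprim n (F : R -> 'rV[R]_n) : vli F -> vmeas (vprim F).
Proof.
move=> lF i; under eq_fun do rewrite mxE; exact: measurable_prim.
Qed.

Lemma vli_le n (F : R -> 'rV[R]_n) g : vmeas F -> li g ->
  (forall t, `|F t| <= g t) -> vli F.
Proof.
by move=> mF lg Fg i; apply: (li_le _ lg) => // t; apply: le_trans (Fg t); exact: rV_coord_le.
Qed.

Lemma vli_dom n (F : R -> 'rV[R]_n) g : vmeas F -> li g ->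
  (forall a b, exists C, forall t, a <= t <= b -> `|F t| <= C * g t) -> vli F.
Proof.
move=> mF lg Fg i; apply: (li_dom _ lg) => // a b.
have [C hC] := Fg a b; exists C => t /hC; apply: le_trans; exact: rV_coord_le.
Qed.

Lemma vliB n (F G : R -> 'rV[R]_n) : vli F -> vli G -> vli (fun t => F t - G t).
Proof.
by move=> lF lG i; under eq_fun do rewrite !mxE; exact: liB.
Qed.

Lemma vprimB n (F G : R -> 'rV[R]_n) t : vli F -> vli G ->
  vprim (fun t => F t - G t) t = vprim F t - vprim G t.
Proof.
move=> lF lG; apply/rowP => i; rewrite !mxE -primB//; congr prim.
by apply/funext => s; rewrite !mxE.
Qed.

Lemma vprim0 n (F : R -> 'rV[R]_n) : vprim F 0 = 0.
Proof. by apply/rowP => i; rewrite !mxE prim0. Qed.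

Lemma vprim_maxr n (F : R -> 'rV[R]_n) t : vprim F (Num.max 0 t) = vprim F t.
Proof. by apply/rowP => i; rewrite !mxE prim_maxr. Qed.

Lemma eq_vprim n (F G : R -> 'rV[R]_n) t : (forall s, 0 <= s <= t -> F s = G s) ->
  vprim F t = vprim G t.
Proof.
by move=> FG; apply/rowP => i; rewrite !mxE; apply: eq_prim => s /FG ->.
Qed.

Lemma vprim_dist n (F : R -> 'rV[R]_n) g s t : vli F -> li g -> 0 <= s -> 0 <= t ->
  (forall u, 0 <= u <= Num.max s t -> `|F u| <= g u) ->
  `|vprim F t - vprim F s| <= `|prim g t - prim g s|.
Proof.
move=> lF lg s0 t0 Fg; apply: rV_norm_le => // i; rewrite !mxE.
by apply: prim_norm_dist => // u /Fg; apply: le_trans; exact: rV_coord_le.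
Qed.

Lemma vprim_ode_sol n (y F : R -> 'rV[R]_n) c : vli F ->
  (forall t, 0 <= t -> y t = c + vprim F t) -> ode_sol y F.
Proof.
move=> lF yE; split.
  move=> T; pose g t := \sum_i `|F t ord0 i|.
  have lg : li g by apply: li_sum => i; exact: li_norm.
  have ag := @prim_ac _ g 0 T lg (lexx 0).
  apply: (@ac_dom _ _ 0 T (prim g) (prim g) y 1) => // s t s0 st tT.
  have t0 : 0 <= t by lra.
  rewrite !yE// opprD addrACA subrr add0r mul1r ler_wpDr//.
  by apply: vprim_dist => // u _; exact: rV_norm_le_sum.
have : forall i, ae_time (fun t => is_derive t (1 : R) (prim (fun s => F s ord0 i)) (F t ord0 i)).
  by move=> i; exact: prim_derive.
move=> /(@filter_forall _ _ _ _ (ae_filter_ringOfSetsType _)) hd.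
have n0 : {ae (@lebesgue_measure R), forall t : R, t != 0}.
  exists [set 0]; split => //; first by rewrite lebesgue_measure_set1.
  by move=> t /=; case: eqP => // ->.
apply: (ae_imp2 n0 hd) => t tn0 h t0.
have {tn0} tp : 0 < t by rewrite lt_neqAle eq_sym tn0.
apply/is_derive1_cvg; apply: rV_cvg => i.
have /is_derive1_cvg := h i t0.
apply: cvg_trans; apply: near_eq_cvg.
rewrite near_withinE; near=> u => _.
have tu : 0 <= u + t.
  have : `|u| < t by near: u; apply/nbhs_ballP; exists t => // v; rewrite /ball/= sub0r normrN.
  by rewrite ltr_norml; lra.
by rewrite !yE// !mxE /GRing.scale/=; congr (_ * _); ring.
Unshelve. all: by end_near. Qed.

Lemma ode_sol_vprim n (y F : R -> 'rV[R]_n) : vli F -> ode_sol y F ->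
  forall t, 0 <= t -> y t = y 0 + vprim F t.
Proof.
move=> lF [acy dy] t t0; apply/rowP => i; rewrite !mxE.
apply: (@ac_fun_eq_prim _ (fun s => F s ord0 i) (fun s => y s ord0 i)) => //.
  move=> T e e0; have [d d0 hd] := acy T e e0; exists d => // k I Iab tI sI.
  apply: le_lt_trans (hd k I Iab tI sI); apply: ler_sum => j _.
  by have := rV_coord_le (y (I j).2 - y (I j).1) i; rewrite !mxE.
apply: (ae_imp dy) => s h s0.
have /is_derive1_cvg/(@rV_coord_cvg _ _ _ _ _ _ i) hi := h s0.
apply/is_derive1_cvg; apply: cvg_trans hi; apply: near_eq_cvg.
by apply: nearW => u; rewrite !mxE.
Qed.

(** The base time [s] may lie on either side of [t]: some solutions are compared from their common
    value at 0, others backwards from their common value at [S]. *)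
Lemma ode_gronwall n (y1 y2 F1 F2 : R -> 'rV[R]_n) (L eta : R -> R) S :
  vli F1 -> vli F2 -> (forall t, 0 <= t -> y1 t = y1 0 + vprim F1 t) ->
  (forall t, 0 <= t -> y2 t = y2 0 + vprim F2 t) ->
  li L -> (forall t, 0 <= L t) -> li eta -> (forall t, 0 <= eta t) ->
  (forall t, 0 <= t <= S -> `|F1 t - F2 t| <= L t * `|y1 t - y2 t| + eta t) ->
  forall s t, 0 <= s <= S -> 0 <= t <= S ->
    `|y1 t - y2 t| <= (`|y1 s - y2 s| + prim eta S) * expR (prim L S).
Proof.
move=> lF1 lF2 y1E y2E lL L0 le eta0 hF s t /andP[s0 sS] /andP[t0 tS].
have S0 : 0 <= S by lra.
pose e u := y1 0 - y2 0 + vprim (fun u => F1 u - F2 u) u.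
have lF := vliB lF1 lF2.
have eE u : 0 <= u -> y1 u - y2 u = e u.
  by move=> u0; rewrite y1E// y2E// /e vprimB// opprD addrACA.
pose phi u := `|e u|.
have mphi : measurable_fun setT phi.
  by apply: vmeas_norm; apply: vmeasD; [exact: vmeas_cst|exact: vmeas_vprim].
have [C C0 hC] : exists2 C, 0 <= C & forall u, u <= S -> phi u <= C.
  pose g t := \sum_i `|(F1 t - F2 t) ord0 i|.
  have lg : li g by apply: li_sum => i; exact: li_norm.
  have [C C0 hC] := prim_bound S lg.
  exists (`|y1 0 - y2 0| + C) => [|u uS]; first by rewrite addr_ge0.
  apply: le_trans (ler_normD _ _) _; rewrite lerD2l.
  rewrite -vprim_maxr -[X in `|X|]subr0 -(vprim0 (fun u => F1 u - F2 u)).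
  have u0 : 0 <= Num.max 0 u by rewrite le_max lexx.
  apply: (@le_trans _ _ `|prim g (Num.max 0 u) - prim g 0|).
    by apply: vprim_dist => // v _; exact: rV_norm_le_sum.
  by rewrite prim0 subr0; apply: hC; rewrite u0 ge_max S0 uS.
(* With the rate set to 0 after [S], the single bound [C] of [phi] before [S] makes [L' * phi]
   locally integrable on the whole line. *)
pose L' u := L u * \1_(`]-oo, S]) u.
have L'E u : u <= S -> L' u = L u.
  by move=> uS; rewrite /L' indicE mem_set ?mulr1//= in_itv.
have L'0 u : 0 <= L' u by rewrite mulr_ge0.
have lL' : li L'.
  apply: (li_le _ lL) => [|u].
    by apply: measurable_funM; [case: lL|exact: measurable_indic].
  rewrite normrM (ger0_norm (L0 u)) ler_piMr//.
  by rewrite indicE; case: (_ \in _); rewrite ?normr1 ?normr0.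
have lLp : li (fun u => L' u * phi u).
  apply: (li_dom _ lL) => [|a b].
    by apply: measurable_funM => //; case: lL'.
  exists C => u _; have [uS|uS] := leP u S.
    by rewrite L'E// normrM (ger0_norm (L0 u)) mulrC ler_wpM2r// ger0_norm ?hC// /phi.
  rewrite /L' indicE memNset; last by rewrite /= in_itv/= => h; lra.
  by rewrite mulr0 mul0r normr0 mulr_ge0.
have key u v : 0 <= u -> u <= v -> v <= S ->
    `|e v - e u| <= prim eta S + (prim (fun u => L' u * phi u) v - prim (fun u => L' u * phi u) u).
  move=> u0 uv vS; have v0 : 0 <= v by lra.
  have lsum := liD lLp le.
  apply: (@le_trans _ _ (prim (fun u => L' u * phi u + eta u) v - prim (fun u => L' u * phi u + eta u) u)).
    rewrite /e opprD addrACA subrr add0r; apply: rV_norm_le => [|i].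
      rewrite subr_ge0; apply: prim_nondecreasing => // w.
      by rewrite addr_ge0// mulr_ge0// /phi.
    rewrite !mxE; apply: prim_dist => // w /andP[uw wv].
    apply: le_trans (rV_coord_le _ _) _.
    rewrite L'E; last lra.
    by rewrite /phi -eE; [apply: hF; lra|lra].
  rewrite !primD//.
  have h1 : prim eta v <= prim eta S by exact: prim_nondecreasing.
  have h2 : 0 <= prim eta u by exact: prim_ge0.
  lra.
have primL' u : u <= S -> prim L' u = prim L u.
  by move=> uS; apply: eq_prim => w /andP[_ wu]; apply: L'E; lra.
have a0 : 0 <= `|y1 s - y2 s| + prim eta S by rewrite addr_ge0// prim_ge0.
have phiE u : phi u = `|e u| by [].
clearbody phi e.
suff [c cS h] : exists2 c, c <= prim L S & phi t <= (`|y1 s - y2 s| + prim eta S) * expR c.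
  by rewrite eE// -phiE; apply: le_trans h _; rewrite ler_wpM2l// ler_expR.
have nd u v : 0 <= u -> u <= v -> prim L u <= prim L v by move=> ? ?; exact: prim_nondecreasing.
have L00 u : 0 <= u -> 0 <= prim L u by exact: prim_ge0.
have [st|/ltW ts] := leP s t.
  exists (prim L' t - prim L' s).
    by rewrite !primL'//; have := nd t S t0 tS; have := L00 s s0; lra.
  apply: gronwall_forward => // u /andP[su ut]; rewrite eE//.
  have := key s u s0 su; move=> /(_ _)/wrap[]; first lra.
  have := ler_normD (e s) (e u - e s); rewrite addrC subrK phiE.
  by lra.
exists (prim L' s - prim L' t).
  by rewrite !primL'//; have := nd s S s0 sS; have := L00 t t0; lra.
apply: gronwall_backward => // u /andP[tu us]; rewrite eE//.
have := key u s; move=> /(_ _)/wrap[]; first lra.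
move=> /(_ us sS).
have := ler_normD (e s) (e u - e s); rewrite addrC subrK phiE distrC.
by lra.
Qed.

End VectorPrim.

(** * Existence of solutions *)

Section Picard.
Context {R : realType}.

Lemma half_exp_cvg C : C * 2^-1 ^+ k @[k --> \oo] --> (0 : R).
Proof.
rewrite -[X in _ --> X](mulr0 C); apply: cvgMr; apply: cvg_expr.
by rewrite ger0_norm ?invr_ge0// invf_lt1 ?ltr1n.
Qed.

Lemma half_exp_le (x D : R) : (forall k, x <= D * 2^-1 ^+ k) -> x <= 0.
Proof.
by move=> h; apply: (cvgr_to_ge (half_exp_cvg D)); exact: nearW.
Qed.

(** The intervals centred at [u k] with radius [2 * C * r], where [r] is the k-th power of 1/2, are
    nested because [C * r + 2 * C * (r / 2) = 2 * C * r]; the limit is the supremum of their left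
    ends. *)
Lemma geometric_limit (u : nat -> R) C :
  (forall k, `|u k.+1 - u k| <= C * 2^-1 ^+ k) ->
  exists l, forall k, `|u k - l| <= 2 * C * 2^-1 ^+ k.
Proof.
move=> hu; pose r k : R := 2^-1 ^+ k.
have r0 k : 0 <= r k by rewrite exprn_ge0.
have rS k : r k.+1 = r k / 2 by rewrite /r exprS mulrC.
have C0 : 0 <= C.
  by have := le_trans (normr_ge0 _) (hu 0%N); rewrite expr0 mulr1.
pose a k := u k - 2 * C * r k; pose b k := u k + 2 * C * r k.
have aS k : a k <= a k.+1.
  by have := hu k; rewrite -/(r k) ler_norml /a rS => /andP[h1 h2]; lra.
have bS k : b k.+1 <= b k.
  by have := hu k; rewrite -/(r k) ler_norml /b rS => /andP[h1 h2]; lra.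
have mono k j : a k <= a (k + j)%N /\ b (k + j)%N <= b k.
  elim: j => [|j [ha hb]]; first by rewrite addn0.
  by rewrite addnS; split; [exact: le_trans (aS _)|exact: le_trans (bS _) _].
have ab k : a k <= b k by rewrite /a /b; have := r0 k; nra.
have aub k j : a j <= b k.
  have [h1 _] := mono j k; have [_ h2] := mono k j.
  by rewrite addnC in h2; apply: le_trans h1 (le_trans (ab _) h2).
exists (sup (range a)) => k.
have hs : has_sup (range a).
  by split; [exists (a 0%N), 0%N|exists (b 0%N) => _ [j _ <-]].
have h1 : a k <= sup (range a) by apply: ub_le_sup; [case: hs|exists k].
have h2 : sup (range a) <= b k.
  by apply: ge_sup; [case: hs|move=> _ [j _ <-]].
by rewrite ler_norml -/(r k); move: h1 h2; rewrite /a /b; lra.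
Qed.

Variables (n : nat) (F : R -> 'rV[R]_n -> 'rV[R]_n) (L : R -> R) (t0 : R) (c : 'rV[R]_n).
Hypotheses (mF : forall y, vmeas y -> vmeas (fun t => F t (y t)))
  (lL : li L) (L0 : forall t, 0 <= L t)
  (FL : forall t x y, `|F t x - F t y| <= L t * `|x - y|)
  (F0 : forall t, `|F t 0| <= L t) (t00 : 0 <= t0).

Let Lam t := prim L t - prim L t0.
(* In the norm weighted by 1 / w the Picard operator is a 1/2-contraction on
   both sides of t0. *)
Let w t := expR (2 * Lam t) + expR (- 2 * Lam t).

Let mLam : measurable_fun setT Lam.
Proof. by apply: measurable_funB; [exact: measurable_prim|exact: measurable_cst]. Qed.

Let mw : measurable_fun setT w.
Proof.
have mE k : measurable_fun setT (fun t => expR (k * Lam t)).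
  apply: (@measurableT_comp _ _ _ _ _ _ expR _ (fun t => k * Lam t)) => //.
  exact: measurable_funM.
by rewrite /w; apply: measurable_funD.
Qed.

Let w_ge1 t : 1 <= w t.
Proof.
have h1 := expR_gt0 (2 * Lam t); have h2 := expR_gt0 (- 2 * Lam t).
have h3 := expR_ge1Dx (2 * Lam t); have h4 := expR_ge1Dx (- 2 * Lam t).
by rewrite /w; lra.
Qed.

Let w_maxr t : w (Num.max 0 t) = w t.
Proof. by rewrite /w /Lam prim_maxr. Qed.

Let lLw : li (fun t => L t * w t).
Proof.
have [mL _] := lL.
apply: (li_dom _ lL) => [|a b]; first exact: measurable_funM.
have [C C0 hC] := prim_bound (Num.max 0 b) lL.
pose D := C + `|prim L t0|.
exists (2 * expR (2 * D)) => t /andP[_ tb].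
rewrite ger0_norm; last by rewrite mulr_ge0// (le_trans ler01)// w_ge1.
rewrite mulrC ler_wpM2r//.
have LD : `|Lam t| <= D.
  apply: le_trans (ler_normB _ _) _; rewrite lerD2r -prim_maxr; apply: hC.
  by rewrite le_max lexx/= ge_max le_max lexx/= le_max tb orbT.
move: LD; rewrite ler_norml => /andP[h1 h2].
have e1 : expR (2 * Lam t) <= expR (2 * D) by rewrite ler_expR; lra.
have e2 : expR (- 2 * Lam t) <= expR (2 * D) by rewrite ler_expR; lra.
rewrite /w; lra.
Qed.

(** Half the difference of the two exponentials whose sum is [w] is a primitive of [L * w] vanishing
    at [t0]; this is the source of the contraction factor 1/2. *)
Let prim_Lw t : 0 <= t ->
  `|prim (fun t => L t * w t) t - prim (fun t => L t * w t) t0| <= w t / 2.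
Proof.
pose y t := 2^-1 * (expR (2 * Lam t) - expR (- 2 * Lam t)).
have acL T k : abs_continuous 0 T (fun t => k * Lam t).
  have -> : (fun t => k * Lam t) = (fun t => (- k * prim L t0) + k * prim L t).
    by apply/funext => s; rewrite /Lam; ring.
  exact/ac_affine/prim_ac.
have acE T k : abs_continuous 0 T (fun t => expR (k * Lam t)).
  have [C C0 hC] := prim_bound T lL.
  apply: (@ac_expR _ (fun t => k * Lam t) 0 T (`|k| * (C + `|prim L t0|)) (acL T k)).
  move=> s hs; apply: le_trans (ler_norm _) _; rewrite normrM ler_wpM2l//.
  by apply: le_trans (ler_normB _ _) _; rewrite lerD2r hC.
have acy T : abs_continuous 0 T y.
  apply: (@ac_dom _ _ 0 T _ _ y 1 _ (acE T 2) (acE T (- 2))) => // s u _ _ _.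
  rewrite mul1r /y -mulrBr normrM ger0_norm ?invr_ge0//.
  have E4 (p q r v : R) : `|p - q - (r - v)| <= `|p - r| + `|q - v|.
    by rewrite (_ : p - q - (r - v) = (p - r) - (q - v)) ?ler_normB//; ring.
  have := E4 (expR (2 * Lam u)) (expR (- 2 * Lam u)) (expR (2 * Lam s)) (expR (- 2 * Lam s)).
  apply: le_trans; rewrite ler_piMl//; lra.
have dy : ae_time (fun t => is_derive t (1 : R) y (L t * w t)).
  apply: (ae_imp (prim_derive lL)) => s h s0.
  have dL : is_derive s (1 : R) Lam (L s).
    refine (@is_derive_eq _ _ _ _ _ _ _ _ (is_deriveB (h s0) (is_derive_cst (prim L t0) s (1 : R))) _).
    by rewrite subr0.
  have dE k : is_derive s (1 : R) (fun t => expR (k * Lam t)) (expR (k * Lam s) * (k * L s)).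
    exact: (@is_derive1_comp _ _ (fun t => k * Lam t) _ _ _
      (is_derive_expR (k * Lam s)) (is_deriveZ k dL)).
  refine (@is_derive_eq _ _ _ _ _ _ _ _ (is_deriveZ (2^-1) (is_deriveB (dE 2) (dE (- 2)))) _).
  rewrite /GRing.scale/= /w; by field.
have yE := ac_fun_eq_prim lLw acy dy.
move=> tt.
have -> : prim (fun t => L t * w t) t - prim (fun t => L t * w t) t0 = y t.
  rewrite [in RHS]yE//; have := yE _ t00.
  have -> : y t0 = 0 by rewrite /y /Lam subrr !mulr0 subrr mulr0.
  lra.
rewrite /y normrM ger0_norm ?invr_ge0// mulrC ler_pM2r ?invr_gt0//.
apply: le_trans (ler_normB _ _) _.
by rewrite !ger0_norm ?expR_ge0.
Qed.

Let op (y : R -> 'rV[R]_n) t :=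
  c + (vprim (fun s => F s (y s)) t - vprim (fun s => F s (y s)) t0).

(** The measurable functions of finite weighted norm, on which the Picard operator acts. *)
Let good (y : R -> 'rV[R]_n) := vmeas y /\ exists C, forall t, `|y t| <= C * w t.

Let Fy_le y C t : (forall t, `|y t| <= C * w t) -> `|F t (y t)| <= (1 + C) * (L t * w t).
Proof.
move=> yC.
have h1 : `|F t (y t)| <= L t * `|y t| + L t.
  rewrite -[F t (y t)](subrK (F t 0)); apply: le_trans (ler_normD _ _) _.
  by rewrite lerD ?F0// -[X in _ * `|X|]subr0.
apply: le_trans h1 _.
have := w_ge1 t; have := yC t; have := L0 t; nra.
Qed.

Let good_vli y : good y -> vli (fun t => F t (y t)).
Proof.
move=> [my [C hC]]; apply: (vli_dom (mF my) lLw) => a b.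
by exists (1 + C) => t _; exact: Fy_le.
Qed.

Let op_dist y z C : good y -> good z -> (forall t, `|y t - z t| <= C * w t) ->
  forall t, `|op y t - op z t| <= C / 2 * w t.
Proof.
move=> gy gz hC t; rewrite /op.
rewrite -(vprim_maxr (fun s => F s (y s)) t) -(vprim_maxr (fun s => F s (z s)) t) -w_maxr.
set s := Num.max 0 t; have s0 : 0 <= s by rewrite le_max lexx.
have lFy := good_vli gy; have lFz := good_vli gz.
set d := (X in `|X| <= _).
have -> : d = vprim (fun s => F s (y s) - F s (z s)) s - vprim (fun s => F s (y s) - F s (z s)) t0.
  by rewrite !vprimB// /d; apply/rowP => i; rewrite !mxE; ring.
have C0 : 0 <= C by have := hC 0; have := w_ge1 0; have := normr_ge0 (y 0 - z 0); nra.
apply: (@le_trans _ _ `|prim (fun u => C * (L u * w u)) s - prim (fun u => C * (L u * w u)) t0|).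
  apply: vprim_dist => //; [exact: vliB|exact: liZ|move=> u _].
  by apply: le_trans (FL _ _ _) _; have := hC u; have := L0 u; nra.
rewrite !primZ// -mulrBr normrM ger0_norm//.
by have := prim_Lw s0; nra.
Qed.

Let op_good y : good y -> good (op y).
Proof.
move=> gy; have lFy := good_vli gy; split.
  apply: vmeasD; first exact: vmeas_cst.
  apply: vmeasD; first exact: vmeas_vprim.
  exact: vmeas_cst.
have [my [C hC]] := gy; exists (`|c| + (1 + C) / 2) => t.
rewrite /op -(vprim_maxr (fun s => F s (y s)) t) -w_maxr.
set s := Num.max 0 t; have s0 : 0 <= s by rewrite le_max lexx.
have C0 : 0 <= C by have := hC 0; have := w_ge1 0; have := normr_ge0 (y 0); nra.
apply: le_trans (ler_normD _ _) _.
have : `|vprim (fun s => F s (y s)) s - vprim (fun s => F s (y s)) t0| <= (1 + C) / 2 * w s.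
  apply: (@le_trans _ _ `|prim (fun u => (1 + C) * (L u * w u)) s - prim (fun u => (1 + C) * (L u * w u)) t0|).
    apply: vprim_dist => //; [exact: liZ|move=> u _; exact: Fy_le].
  rewrite !primZ// -mulrBr normrM ger0_norm; last by rewrite addr_ge0.
  by have := prim_Lw s0; nra.
have := normr_ge0 c; have := w_ge1 s; nra.
Qed.

(** The iterates of the constant [c] converge geometrically in the weighted norm, hence at every
    time with an explicit rate; measurability and growth pass to the limit. *)
Lemma picard : exists y, [/\ vmeas y, vli (fun t => F t (y t)), y t0 = c &
  forall t, y t = y 0 + vprim (fun s => F s (y s)) t].
Proof.
pose Y k := iter k op (cst c).
have gc : good (cst c).
  split; first exact: vmeas_cst.
  by exists `|c| => t; rewrite ler_peMr//.
have gY k : good (Y k) by elim: k => //= k; exact: op_good.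
have [C hC] : exists C, forall t, `|Y 1%N t - Y 0%N t| <= C * w t.
  have [_ [C1 h1]] := gY 1%N; have [_ [C2 h2]] := gY 0%N.
  exists (C1 + C2) => t; apply: le_trans (ler_normB _ _) _.
  by rewrite mulrDl lerD.
have YS k t : `|Y k.+1 t - Y k t| <= C * 2^-1 ^+ k * w t.
  elim: k t => [|k ih] t; first by rewrite expr0 mulr1.
  rewrite exprSr mulrA.
  exact: (op_dist (gY k.+1) (gY k) ih).
have : forall t, exists v : 'rV[R]_n, forall k, `|Y k t - v| <= 2 * C * 2^-1 ^+ k * w t.
  move=> t.
  have : forall i, exists l, forall k, `|Y k t ord0 i - l| <= 2 * (C * w t) * 2^-1 ^+ k.
    move=> i; apply: geometric_limit => k; rewrite mulrAC; apply: le_trans (YS k t).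
    by have := rV_coord_le (Y k.+1 t - Y k t) i; rewrite !mxE.
  move=> /choice[l hl]; exists (\row_i l i) => k; apply: rV_norm_le.
    have := YS 0%N t; rewrite expr0 mulr1 => h.
    have h0 : 0 <= C * w t by exact: le_trans h.
    by rewrite mulrAC -(mulrA 2) mulr_ge0 ?exprn_ge0// mulr_ge0.
  by move=> i; rewrite !mxE mulrAC -(mulrA 2); exact: hl.
move=> /choice[y hy].
have my : vmeas y.
  move=> i; apply: (measurable_fun_cvg (fun k => (gY k).1 i)) => t _.
  apply: rV_coord_cvg; apply/cvgrPdist_le => e e0.
  have /cvgrPdist_le/(_ e e0) := half_exp_cvg (2 * C * w t); apply: filterS => k.
  rewrite sub0r normrN distrC => /(le_trans (ler_norm _)); apply: le_trans.
  by rewrite mulrAC; exact: hy.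
have gy : good y.
  split => //; have [_ [C1 h1]] := gY 0%N; exists (2 * C + C1) => t.
  have := hy t 0%N; rewrite expr0 mulr1 distrC => h.
  rewrite -[y t](subrK (Y 0%N t)); apply: le_trans (ler_normD _ _) _.
  by rewrite mulrDl lerD.
have yop t : y t = op y t.
  apply/eqP; rewrite -subr_eq0 -normr_le0.
  apply: (@half_exp_le _ (3 * C * w t)) => k.
  rewrite -[y t](subrK (Y k.+1 t)) -addrA; apply: le_trans (ler_normD _ _) _.
  have h1 := hy t k.+1; rewrite distrC in h1.
  have h2 := op_dist (gY k) gy (fun t => hy t k) t.
  rewrite exprSr in h1.
  apply: (le_trans (lerD h1 h2)).
  have := YS 0%N t; rewrite expr0 mulr1 => h.
  have h0 : 0 <= C * w t by exact: le_trans h.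
  have r0 : (0 : R) <= 2^-1 ^+ k by rewrite exprn_ge0.
  set r := 2^-1 ^+ k in r0 *.
  have r1 : 0 <= C * w t * r by rewrite mulr_ge0.
  have -> : 2 * C * (r / 2) * w t + 2 * C * r / 2 * w t = 2 * (C * w t * r) by field.
  have -> : 3 * C * w t * r = 3 * (C * w t * r) by ring.
  by apply: (ler_wpM2r r1); rewrite ler_nat.
exists y; split => //.
- exact: good_vli.
- by rewrite yop /op subrr addr0.
- move=> t; rewrite yop [in RHS]yop /op vprim0 -addrA; congr (_ + _).
  by rewrite sub0r addrC.
Qed.

End Picard.

(** * Measurability of superpositions *)

Section Caratheodory.
Context {R : realType} {m k : nat}.

Let grid p n (x : 'rV[R]_p) : 'rV[int]_p := \row_i Num.floor (x ord0 i * n.+1%:R).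
Let grid_pt p n (v : 'rV[int]_p) : 'rV[R]_p := \row_i ((v ord0 i)%:~R / n.+1%:R).

Let grid_cvg p (x : 'rV[R]_p) : grid_pt n (grid n x) @[n --> \oo] --> x.
Proof.
apply: rV_cvg => i; apply/cvgrPdist_le => e e0.
have := @cvg_harmonic R => /cvgrPdist_le/(_ e e0); apply: filterS => n.
rewrite sub0r normrN ger0_norm ?invr_ge0// => ne; apply: le_trans ne; rewrite !mxE.
set y := x ord0 i; have n0 : 0 < n.+1%:R :> R by [].
have h1 := floor_le (y * n.+1%:R); have h2 := floorD1_gt (y * n.+1%:R).
rewrite intrD in h2.
have -> : y = y * n.+1%:R / n.+1%:R by rewrite mulfK// gt_eqF.
rewrite -mulrBl normrM [X in _ * X]ger0_norm ?invr_ge0// ler_piMl ?invr_ge0//.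
rewrite mulfK ?gt_eqF// ger0_norm; lra.
Qed.

Let grid_meas d (T : measurableType d) p n (x : T -> 'rV[R]_p) (v : 'rV[int]_p) :
  (forall i, measurable_fun setT (fun w => x w ord0 i)) ->
  measurable [set w | grid n (x w) = v].
Proof.
move=> mx; rewrite (_ : mkset _ = \bigcap_(i in [set: 'I_p])
    ((fun w => x w ord0 i * n.+1%:R) @^-1` `[(v ord0 i)%:~R, (v ord0 i + 1)%:~R[%classic)); last first.
  apply/seteqP; split => [w /= <- i _|w /= hw].
    by rewrite /= in_itv/= mxE floor_itv.
  apply/rowP => i; rewrite mxE; apply/eqP; rewrite floor_eq.
  by have := hw i I; rewrite /= in_itv.
apply: fin_bigcap_measurable => // i _.
rewrite -[X in measurable X]setTI.
have : measurable_fun setT (fun w => x w ord0 i * n.+1%:R) by exact: measurable_funM.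
by apply => //; exact: measurable_itv.
Qed.

(** Rounding state and control down to a grid of mesh [1 / (n + 1)] cuts the domain into countably
    many measurable pieces on which only the time varies; by continuity the rounded compositions
    converge pointwise. Time enters through [tau] so that the domain can be the line or the product
    of times and controls. *)
Lemma measurable_caratheodory_comp d (T : measurableType d)
    (a : R -> 'rV[R]_m -> 'rV[R]_k -> R) (tau : T -> R)
    (x : T -> 'rV[R]_m) (u : T -> 'rV[R]_k) :
  (forall x u, measurable_fun setT (fun t => a t x u)) ->
  (forall t, continuous (fun z : 'rV[R]_m * 'rV[R]_k => a t z.1 z.2)) ->
  measurable_fun setT tau ->
  (forall i, measurable_fun setT (fun w => x w ord0 i)) ->
  (forall i, measurable_fun setT (fun w => u w ord0 i)) ->
  measurable_fun setT (fun w => a (tau w) (x w) (u w)).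
Proof.
move=> ma ca mtau mx mu.
pose h n w := a (tau w) (grid_pt n (grid n (x w))) (grid_pt n (grid n (u w))).
apply: (@measurable_fun_cvg _ _ _ _ h) => [n|w _]; last first.
  apply: (@cvg_comp _ _ _ (fun n => (grid_pt n (grid n (x w)), grid_pt n (grid n (u w))))
    (fun z => a (tau w) z.1 z.2) \oo (nbhs (x w, u w))); last exact: (ca (tau w) (x w, u w)).
  rewrite -[nbhs (x w, u w)]/(filter_prod (nbhs (x w)) (nbhs (u w))).
  exact: (cvg_pair (@grid_cvg _ (x w)) (@grid_cvg _ (u w))).
move=> _ Y mY; rewrite setTI.
rewrite (_ : _ @^-1` _ = \bigcup_(v in [set: ('rV[int]_m * 'rV[int]_k)%type])
   ([set w | grid n (x w) = v.1] `&` [set w | grid n (u w) = v.2] `&`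
    [set w | Y (a (tau w) (grid_pt n v.1) (grid_pt n v.2))])); last first.
  apply/seteqP; split => [w /= Yw|w [v _ /= [[<- <-]]]//].
  by exists (grid n (x w), grid n (u w)).
apply: countable_bigcupT_measurable; first exact: countableP.
move=> v; apply: measurableI.
  by apply: measurableI; exact: grid_meas.
have : measurable_fun setT ((fun t => a t (grid_pt n v.1) (grid_pt n v.2)) \o tau).
  exact: measurableT_comp.
by move=> /(_ measurableT _ mY); rewrite setTI.
Qed.

End Caratheodory.

(** * Measurable selection from Borel graphs *)

Section Capacity.
Context {R : realType}.
Notation mu := (@lebesgue_measure R).
Implicit Types (A H : set R).

(* Outer measure at least c; this, unlike measurability, survives projections. *)
Let outer_ge (c : R) A := forall H, measurable H -> A `<=` H -> (c%:E <= mu H)%E.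

(** Continuity of the outer measure from below. If every [F n] had a measurable hull [H n] of
    measure below [c'], the tail intersections of these hulls would increase and still cover the
    [F n], so their union would cover [A] with measure at most [c']. *)
Let outer_ge_bigcup (c c' : R) A (F : nat -> set R) : c' < c -> outer_ge c A ->
  nondecreasing_seq F -> A `<=` \bigcup_n F n -> exists n, outer_ge c' (F n).
Proof.
move=> cc Ac ndF AF; apply: contrapT => hn.
have : forall n, exists H, [/\ measurable H, F n `<=` H & (mu H < c'%:E)%E].
  move=> n; apply: contrapT => hH; apply: hn; exists n => H mH FH.
  by rewrite leNgt; apply/negP => h; apply: hH; exists H.
move=> /choice[H hH].
pose G n := \bigcap_(j in [set j | (n <= j)%N]) H j.
have mG n : measurable (G n).
  by apply: bigcap_measurable => [|j _]; [exists n => /=|case: (hH j)].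
have FG n : F n `<=` G n.
  move=> t Fnt j /= nj; have [_ + _] := hH j; apply.
  by have /subsetPset := ndF _ _ nj; exact.
have ndG : nondecreasing_seq G.
  move=> i j ij; apply/subsetPset => t Gt l /= jl; apply: Gt => /=.
  exact: leq_trans jl.
have mUG : measurable (\bigcup_n G n) by exact: bigcupT_measurable.
have cv := @nondecreasing_cvg_mu _ _ _ mu G mG mUG ndG.
have le : (mu (\bigcup_n G n) <= c'%:E)%E.
  rewrite -(cvg_lim _ cv)//; apply: lime_le; first by apply/cvg_ex; eexists; exact: cv.
  apply: nearW => n /=; have [mH _ /ltW] := hH n; apply: le_trans.
  apply: le_measure; [by rewrite inE; exact: mG|by rewrite inE|].
  by move=> t; apply => /=.
have := Ac _ mUG (subset_trans AF (subset_bigcup (fun i _ => FG i))).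
by move=> /le_trans/(_ le); rewrite lee_fin leNgt cc.
Qed.

Let outer_ge_nonnegligible A : ~ mu.-negligible A -> exists2 c, 0 < c & outer_ge c A.
Proof.
move=> nA; apply: contrapT => hc.
have : forall n, exists H, [/\ measurable H, A `<=` H & (mu H < (n.+1%:R^-1)%:E)%E].
  move=> n; apply: contrapT => hH; apply: hc; exists n.+1%:R^-1 => // H mH AH.
  by rewrite leNgt; apply/negP => h; apply: hH; exists H.
move=> /choice[H hH]; apply: nA.
have mI : measurable (\bigcap_n H n).
  by apply: bigcapT_measurable => n; case: (hH n).
exists (\bigcap_n H n); split => //; last by move=> t At n _; case: (hH n) => _ + _; apply.
apply/eqP; rewrite eq_le measure_ge0 andbT; apply/lee_addgt0Pr => e e0; rewrite add0e.
have /cvgrPdist_lt/(_ e e0)[n _ /(_ n (leqnn n))] := @cvg_harmonic R.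
rewrite /= sub0r normrN ger0_norm ?invr_ge0// => /ltW ne.
have [mH _ /ltW h] := hH n; apply: (@le_trans _ _ (mu (H n))).
  apply: le_measure; [by rewrite inE|by rewrite inE|].
  by move=> t; exact.
by rewrite (le_trans h)// lee_fin.
Qed.

Variables (Z : pseudoMetricType R) (pr : Z -> R).
Hypothesis cpr : continuous pr.

(* Borel sets as well-founded trees over closed sets.  Bounding the index at
   every union node cuts such a set down to a closed one. *)
Inductive borel_code :=
  | code_closed of set Z
  | code_bigcup of (nat -> borel_code)
  | code_bigcap of (nat -> borel_code).

(** A node of the tree is named by the path of indices leading to it, last index first; [None] marks
    a union node that is not yet bounded. *)
Let bound := seq nat -> option nat.

Fixpoint cut (c : borel_code) (p : seq nat) (b : seq nat -> option nat) : set Z :=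
  match c with
  | code_closed K => K
  | code_bigcup f => \bigcup_(i in [set i | if b p is Some N then (i <= N)%N else True])
      cut (f i) (i :: p) b
  | code_bigcap f => \bigcap_i cut (f i) (i :: p) b
  end.

(** A closed set containing the cut: a union node without bound, whose cut may fail to be closed, is
    replaced by the whole space. Once every node is bounded the two sets agree. *)
Fixpoint envelope (c : borel_code) (p : seq nat) (b : seq nat -> option nat) : set Z :=
  match c with
  | code_closed K => K
  | code_bigcup f => if b p is Some N then
      \bigcup_(i in [set i | (i <= N)%N]) envelope (f i) (i :: p) b else setT
  | code_bigcap f => \bigcap_i envelope (f i) (i :: p) b
  end.

Fixpoint well_coded (c : borel_code) : Prop :=
  match c with
  | code_closed K => closed K
  | code_bigcup f => forall i, well_coded (f i)
  | code_bigcap f => forall i, well_coded (f i)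
  end.

Let unbounded : bound := fun=> None.

Let cut_envelope c p b : cut c p b `<=` envelope c p b.
Proof.
elim: c p => [K|f ih|f ih] p //=; last by move=> z h i _; exact/ih/h.
by case: (b p) => [N|] //; move=> z [i hi /ih]; exists i.
Qed.

Let closed_envelope c p b : well_coded c -> closed (envelope c p b).
Proof.
elim: c p => [K|f ih|f ih] p //= wf.
- case: (b p) => [N|]; last exact: closedT.
  apply: closed_bigcup => [|i _]; last exact: ih.
  by apply: (sub_finite_set _ (finite_II N.+1)) => i.
- by apply: closed_bigI => i _; exact: ih.
Qed.

Let eq_cut c p b b' : (forall s, b (s ++ p) = b' (s ++ p)) -> cut c p b = cut c p b'.
Proof.
elim: c p => [K|f ih|f ih] p //= bb.
  rewrite (bb [::]) /=; apply: eq_bigcupr => i _; apply: ih => s.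
  by rewrite -cat_rcons bb.
by apply: eq_bigcapr => i _; apply: ih => s; rewrite -cat_rcons bb.
Qed.

Let upd (b : bound) q N : bound := fun p => if p == q then Some N else b p.

Let le_bound (b b' : bound) := forall p N, b p = Some N -> exists2 N', b' p = Some N' & (N' <= N)%N.

Let cut_le c p b b' : le_bound b b' -> cut c p b' `<=` cut c p b.
Proof.
move=> bb; elim: c p => [K|f ih|f ih] p //=; last by move=> z h i _; exact/ih/h.
move=> z [i /= hi /ih h]; exists i => //=.
case E : (b p) => [N|] //; have [N' E' NN] := bb _ _ E.
by move: hi; rewrite E' => /leq_trans; apply.
Qed.

Let envelope_le c p b b' : le_bound b b' -> envelope c p b' `<=` envelope c p b.
Proof.
move=> bb; elim: c p => [K|f ih|f ih] p //=; last by move=> z h i _; exact/ih/h.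
case E : (b p) => [N|] //; have [N' E' NN] := bb _ _ E; rewrite E'.
by move=> z [i /= hi /ih h]; exists i => //=; exact: leq_trans NN.
Qed.

(** The index by which a point belongs to the union at node [q] serves as the new bound. At an
    intersection node at most one child leads to [q], so one bound works for all children. *)
Let cut_upd c p b q : b q = None -> cut c p b `<=` \bigcup_N cut c p (upd b q N).
Proof.
move=> bq; elim: c p => [K|f ih|f ih] p /=.
- by move=> z Kz; exists 0%N.
- move=> z [i hi h]; have [qp|qp] := eqVneq p q.
    exists i => //; exists i; first by rewrite /= /upd qp eqxx.
    rewrite (@eq_cut _ _ _ b)// => s; rewrite /upd qp; case: eqP => // E.
    by have /(congr1 size)/eqP := E; rewrite size_cat /= -[eqbRHS]add0n addnS -addSn eqn_add2r.
  have [N _ hN] := ih i _ _ h; exists N => //; exists i => //=.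
  by rewrite /upd (negbTE qp).
- move=> z h.
  have [[i0 [s0 q0]]|nq] := pselect (exists i s, q = s ++ i :: p).
    have [N _ hN] := ih i0 _ _ (h i0 I); exists N => // i _.
    have [->|ii0] := eqVneq i i0; first exact: hN.
    rewrite (@eq_cut _ _ _ b); first exact: h.
    move=> s; rewrite /upd q0; case: eqP => // E; move: ii0.
    have ss : size s = size s0.
      by have /(congr1 size)/eqP := E; rewrite !size_cat /= eqn_add2r => /eqP.
    by move: E => /eqP; rewrite eqseq_cat// => /andP[_ /eqP[->]]; rewrite eqxx.
  exists 0%N => // i _; rewrite (@eq_cut _ _ _ b); first exact: h.
  by move=> s; rewrite /upd; case: eqP => // E; case: nq; exists i, s.
Qed.

Let cut_limit c p (b : nat -> bound) (b' : bound) :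
  (forall n, le_bound (b n) (b n.+1)) ->
  (forall q, exists n, b n q = b' q /\ b' q <> None) ->
  \bigcap_n envelope c p (b n) `<=` cut c p b'.
Proof.
move=> bS bb'.
have mono i j : (i <= j)%N -> le_bound (b i) (b j).
  elim: j => [|j ihj]; first by rewrite leqn0 => /eqP-> q N ->; exists N.
  rewrite leq_eqVlt => /predU1P[->|]; first by move=> q N ->; exists N.
  rewrite ltnS => /ihj h q N /h[N1 /bS[N2 -> h2] h1]; exists N2 => //.
  exact: leq_trans h1.
elim: c p => [K|f ih|f ih] p /=.
- by move=> z /(_ 0%N I).
- move=> z h; have [n0 [E0]] := bb' p; case E' : (b' p) => [N|] // _.
  rewrite E' in E0.
  apply: contrapT => hz.
  have : forall i, exists n, (i <= N)%N -> ~ envelope (f i) (i :: p) (b n) z.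
    move=> i; apply: contrapT => hi; apply: hz.
    have iN : (i <= N)%N.
      by apply/negPn/negP => iN; apply: hi; exists 0%N; rewrite (negbTE iN).
    exists i => //; apply: ih => n _; apply: contrapT => hn; apply: hi.
    by exists n.
  move=> /choice[nn hnn].
  pose n1 := maxn n0 (\max_(i < N.+1) nn i).
  have [N' E1 NN] := mono _ _ (leq_maxl n0 (\max_(i < N.+1) nn i)) _ _ E0.
  have := h n1 I; rewrite E1 => -[i /= iN' hi].
  have iN : (i <= N)%N by exact: leq_trans NN.
  apply: (hnn i iN); apply: envelope_le hi; apply: mono.
  rewrite leq_max; apply/orP; right.
  by rewrite -ltnS in iN; exact: (leq_bigmax (Ordinal iN)).
- by move=> z h i _; apply: ih => n _; exact: h.
Qed.

Let coded B := exists2 c, well_coded c & cut c [::] unbounded = B.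

Let cut_unbounded c p : cut c p unbounded = cut c [::] unbounded.
Proof.
have H q q' : cut c q unbounded = cut c q' unbounded.
  elim: c q q' => [K|f ih|f ih] q q' //=.
    by apply: eq_bigcupr => i _; exact: ih.
  by apply: eq_bigcapr => i _; exact: ih.
exact: H.
Qed.

Let coded_bigcup (F : nat -> set Z) : (forall n, coded (F n)) -> coded (\bigcup_n F n).
Proof.
move=> /(_ _)/cid2-/all_sig[c hc]; exists (code_bigcup c) => /=.
  by move=> i; case: (hc i).
by apply: eq_bigcupr => i _; rewrite cut_unbounded; case: (hc i).
Qed.

Let coded_bigcap (F : nat -> set Z) : (forall n, coded (F n)) -> coded (\bigcap_n F n).
Proof.
move=> /(_ _)/cid2-/all_sig[c hc]; exists (code_bigcap c) => /=.
  by move=> i; case: (hc i).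
by apply: eq_bigcapr => i _; rewrite cut_unbounded; case: (hc i).
Qed.

Let coded_closed (K : set Z) : closed K -> coded K.
Proof. by exists (code_closed K). Qed.

Let coded_open (O : set Z) : open O -> coded O.
Proof.
move=> oO.
(* An open set is the union of the closed sets of points that keep a distance of about [1 / (n + 1)]
   from its complement; interiors are taken because a ball of a pseudometric space need not be
   open. *)
pose F n := \bigcap_(y in ~` O) ~` (interior (ball y (n.+1%:R^-1 : R))).
rewrite (_ : O = \bigcup_n F n).
  apply: coded_bigcup => n; apply: coded_closed; apply: closed_bigI => y _.
  by apply: open_closedC; exact: open_interior.
apply/seteqP; split => [z Oz|z [n _ Fz]].
  have /nbhs_ballP[e /= e0 he] : nbhs z O by exact: open_nbhs_nbhs.
  have /cvgrPdist_lt/(_ e e0)[n _ /(_ n (leqnn n))] := @cvg_harmonic R.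
  rewrite /= sub0r normrN ger0_norm ?invr_ge0// => ne.
  exists n => // y nOy /interior_subset yz; apply: nOy; apply: he.
  by apply: ball_sym; apply: le_ball yz; exact: ltW.
apply: contrapT => nOz; apply: (Fz z nOz).
by apply/nbhs_ballP; exists n.+1%:R^-1 => //=.
Qed.

Let coded_borel B : <<s @open Z >> B -> coded B.
Proof.
(* Codes have no complement node, so the induction carries a set together with its complement. *)
move=> hB; suff [] : coded B /\ coded (~` B) by [].
move: B hB; apply: smallest_sub => [|O oO]; last first.
  by split; [exact: coded_open|apply: coded_closed; exact: open_closedC].
split.
- by split; apply: coded_closed; [exact: closed0|rewrite setC0; exact: closedT].
- by move=> A [h1 h2]; rewrite setTD; split => //; rewrite setCK.
- move=> F hF; split; first by apply: coded_bigcup => n; case: (hF n).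
  by rewrite setC_bigcup; apply: coded_bigcap => n; case: (hF n).
Qed.

(** Choquet's capacitability argument: the union nodes of a code of [B] are bounded one after the
    other, keeping the outer measure of the projection above [e / 2]. The compact envelopes obtained
    on the way decrease to a subset of [B], and projection commutes with decreasing intersections of
    compact sets, so the bound survives in the limit. *)
Lemma borel_projection_compact (K0 B : set Z) : compact K0 -> closed K0 ->
  <<s @open Z >> B -> B `<=` K0 -> ~ mu.-negligible (pr @` B) ->
  exists K, [/\ compact K, closed K, K `<=` B & (0 < mu (pr @` K))%E].
Proof.
move=> cK0 clK0 /coded_borel[c wc cB] BK0 nB.
have [e e0 he] := outer_ge_nonnegligible nB.
pose e2 := e / 2.
have e20 : 0 < e2 by rewrite divr_gt0.
(* The margin over [e2] is strict; each step gives up half of it and so never exhausts it. *)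
pose large b := exists2 e', e2 < e' & outer_ge e' (pr @` (K0 `&` cut c [::] b)).
have large0 : large unbounded.
  exists e; first by rewrite /e2; lra.
  by rewrite cB setIidr.
have step b q : large b -> b q = None -> exists N, large (upd b q N).
  move=> [e' e2e' hb] bq; pose e3 := (e2 + e') / 2.
  have [|||N hN] := @outer_ge_bigcup e' e3 _
      (fun N => pr @` (K0 `&` cut c [::] (upd b q N))) _ hb.
  - by rewrite /e3; lra.
  - move=> i j ij; apply/subsetPset; apply: image_subset; apply: setIS.
    apply: cut_le => p N; rewrite /upd; case: eqP => _; last by move=> ->; exists N.
    by move=> [<-]; exists i.
  - move=> t [z [K0z /(cut_upd bq)[N _ hN]] <-]; exists N => //.
    by exists z.
  by exists N, e3 => //; rewrite /e3; lra.
(* All paths are enumerated by [unpickle]. A node receives its bound at the stage of its own number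
   and keeps it for ever, so the final bound [b' q] can be read off right after that stage. *)
pose next (b : bound) (n : nat) : bound :=
  if unpickle n is Some q then
    if pselect (large b /\ b q = None) is left h then upd b q (projT1 (cid (step b q h.1 h.2)))
    else b
  else b.
pose fix bs n : bound := if n is n'.+1 then next (bs n') n' else unbounded.
have largeS b n : large b -> large (next b n).
  rewrite /next; case: (unpickle n) => // q lb; case: pselect => // h; exact: (projT2 (cid (step b q h.1 h.2))).
have large_bs n : large (bs n) by elim: n => //= n; exact: largeS.
have leS n : le_bound (bs n) (bs n.+1).
  move=> p N E /=; rewrite /next; case: (unpickle n) => [q|]; last by exists N.
  case: pselect => h; last by exists N.
  exists N => //; rewrite /upd; case: eqP => // pq.
  by rewrite pq h.2 in E.
have keepS n q N : bs n q = Some N -> bs n.+1 q = Some N.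
  move=> E /=; rewrite /next; case: (unpickle n) => [q'|] //.
  case: pselect => // h.
  by rewrite /upd; case: eqP => // qq; rewrite qq h.2 in E.
have set_bs q : exists N, bs (pickle q).+1 q = Some N.
  case bq : (bs (pickle q) q) => [N|]; first by exists N; exact: keepS.
  rewrite /= /next pickleK; case: pselect => h.
    by rewrite /upd eqxx; eexists.
  by exfalso; apply: h; split.
pose b' q := bs (pickle q).+1 q.
pose E n := K0 `&` envelope c [::] (bs n).
have clE n : closed (E n) by apply: closedI => //; exact: closed_envelope.
have cE n : compact (E n) by apply: compact_closedI => //; exact: closed_envelope.
have mpr (K : set Z) : compact K -> measurable (pr @` K).
  move=> cK; apply: compact_measurable; apply: continuous_compact => //.
  exact: continuous_subspaceT.
have EK : \bigcap_n E n `<=` B.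
  move=> z hz; rewrite -cB; apply: (@cut_le _ _ _ b'); first by [].
  apply: (cut_limit leS) => [q|n _]; last by case: (hz n I).
  have [N hN] := set_bs q; exists (pickle q).+1; split => //.
  by rewrite /b' hN.
have decE i j : (i <= j)%N -> E j `<=` E i.
  elim: j => [|j ih]; first by rewrite leqn0 => /eqP->.
  rewrite leq_eqVlt => /predU1P[->//|]; rewrite ltnS => /ih h.
  by apply: subset_trans h => z [K0z hz]; split => //; exact: envelope_le hz.
have prE : pr @` (\bigcap_n E n) = \bigcap_n (pr @` E n).
  apply/seteqP; split => [_ [z hz <-] n _|t ht].
    by exists z => //; exact: hz.
  have /choice[z hz] : forall n, exists z, E n z /\ pr z = t.
    by move=> n; have [z] := ht n I; exists z.
  have inE j : (z @ \oo) (E j).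
    by exists j => // n /= jn; apply: (decE _ _ jn); case: (hz n).
  have [x [_ clx]] := cE 0%N (z @ \oo) _ (inE 0%N).
  exists x.
    move=> n _; apply: clE => V Vx.
    by have [y [? ?]] := clx _ _ (inE n) Vx; exists y.
  apply: contrapT => /eqP nt.
  have d0 : 0 < `|pr x - t| by rewrite normr_gt0 subr_eq0.
  have /cvgrPdist_lt/(_ _ d0) hx := @cpr x.
  have zt : (z @ \oo) [set y | pr y = t] by exists 0%N => // n _ /=; case: (hz n).
  by have [y [/= -> ]] := clx _ _ zt hx; rewrite ltxx.
have muE n : (e2%:E <= mu (pr @` E n))%E.
  have [e' e2e' h] := large_bs n.
  apply: (@le_trans _ _ e'%:E); first by rewrite lee_fin ltW.
  by apply: h; [exact: mpr|apply: image_subset; apply: setIS; exact: cut_envelope].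
have cEI : compact (\bigcap_n E n).
  apply: subclosed_compact (cE 0%N) _; last by move=> z; apply.
  by apply: closed_bigI => i _; exact: clE.
exists (\bigcap_n E n); split => //.
  by apply: closed_bigI => i _; exact: clE.
apply: (@lt_le_trans _ _ e2%:E); first by rewrite lte_fin.
rewrite prE.
have mI : measurable (\bigcap_n (pr @` E n)).
  by apply: bigcapT_measurable => n; exact: mpr.
have mE0 : (mu (pr @` E 0%N) < +oo)%E.
  apply: compact_finite_measure; apply: continuous_compact => //.
  exact: continuous_subspaceT.
have cv := @nonincreasing_cvg_mu _ _ _ mu (fun n => pr @` E n) mE0 (fun n => mpr _ (cE n)) mI.
rewrite -(cvg_lim _ (cv _))//; last first.
  by move=> i j ij; apply/subsetPset; apply: image_subset; exact: decE.
apply: lime_ge; last by apply: nearW => n; exact: muE.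
apply/cvg_ex; eexists; apply: cv.
by move=> i j ij; apply/subsetPset; apply: image_subset; exact: decE.
Qed.

End Capacity.

(** * Selections defined on a set of positive measure *)

Section Selection.
Context {R : realType} {k : nat}.
Notation mu := (@lebesgue_measure R).
Notation Z := (R * 'rV[R]_k)%type.

Let pr (z : Z) : R := z.1.

Let cpr : continuous pr. Proof. by move=> z; exact: cvg_fst. Qed.

Let ccoord i : continuous (fun z : Z => z.2 ord0 i).
Proof.
move=> z; apply: (@cvg_comp _ _ _ snd (fun v : 'rV[R]_k => v ord0 i) (nbhs z) (nbhs z.2)).
  exact: cvg_snd.
exact: coord_continuous.
Qed.

Let compact_pr K : compact K -> compact (pr @` K).
Proof. by move=> cK; apply: continuous_compact => //; exact: continuous_subspaceT. Qed.

Let Z_closed (K : set Z) : compact K -> closed K.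
Proof. by apply: compact_closed; exact: norm_hausdorff. Qed.

Let borelZ := g_sigma_algebraType (@open Z).

Let open_borel (O : set Z) : open O -> measurable (O : set borelZ).
Proof. exact: sub_sigma_algebra. Qed.

Let closed_borel (O : set Z) : closed O -> measurable (O : set borelZ).
Proof.
by move=> cO; rewrite -(setCK O); apply: measurableC; apply: open_borel; exact: closed_openC.
Qed.

(* Keep the points with least i-th coordinate in each fibre: a Borel set with the
   same projection, so it contains a compact set with large projection.  Doing
   this for every coordinate makes the compact set a graph. *)
Let fix_coordinate i (K : set Z) : compact K -> (0 < mu (pr @` K))%E ->
  exists K', [/\ compact K', K' `<=` K, (0 < mu (pr @` K'))%E &
    forall z z', K' z -> K' z' -> z.1 = z'.1 -> z.2 ord0 i = z'.2 ord0 i].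
Proof.
move=> cK K0; have clK := Z_closed cK.
pose M := [set z | K z /\ forall z', K z' -> z'.1 = z.1 -> z.2 ord0 i <= z'.2 ord0 i].
pose le c := [set z : Z | z.2 ord0 i <= c].
have cle c : closed (le c).
  apply: (@closed_comp _ _ _ [set x | x <= c]); last exact: closed_le.
  by move=> z _; exact: ccoord.
(* A point is not minimal in its fibre when some rational [q] lies below its coordinate but not
   below that of another point of the fibre. For fixed [q] the fibres with a point at level at most
   [q] form the projection of a compact set, which is closed. *)
have ME : M = K `\` \bigcup_(q : rat)
   ((K `\` le (ratr q)) `&` pr @^-1` (pr @` (K `&` le (ratr q)))).
  apply/seteqP; split => [z [Kz hz]|z [Kz hz]]; split => //.
    move=> [q _ [[_ nle] [z' [Kz' lz'] /= zz']]]; apply: nle.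
    by apply: le_trans lz'; exact: hz.
  move=> z' Kz' zz'; rewrite leNgt; apply/negP => lt; apply: hz.
  have [q] := rat_in_itvoo lt; rewrite in_itv/= => /andP[q1 q2].
  exists q => //; split; last by exists z' => //; split => //; exact: ltW.
  by split => //; rewrite /le/=; apply/negP; rewrite -ltNge.
have bM : <<s @open Z >> M.
  rewrite ME; apply: (@measurableD _ borelZ); first exact: closed_borel.
  apply: (@bigcupT_measurable_rat _ borelZ) => q; apply: measurableI.
    by apply: measurableD; exact: closed_borel.
  apply: closed_borel; apply: closed_comp; first by move=> z _; exact: cpr.
  apply: compact_closed; first exact: Rhausdorff.
  by apply: compact_pr; exact: compact_closedI.
have prM : pr @` M = pr @` K.
  apply/seteqP; split => [_ [z [Kz _] <-]|_ [z Kz <-]]; first by exists z.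
  have cF : compact (K `&` pr @^-1` [set pr z]).
    apply: compact_closedI => //; apply: closed_comp; first by move=> ? _; exact: cpr.
    by apply: compact_closed; [exact: Rhausdorff|exact: compact_set1].
  have [||z0 + hz0] := @compact_EVT_min _ _ (fun z : Z => z.2 ord0 i) _ _ cF.
  - by exists z.
  - by apply: continuous_subspaceT => ?; exact: ccoord.
  rewrite inE => -[Kz0 /= e0]; exists z0 => //; split => // z' Kz' e'.
  by apply: hz0; rewrite inE; split => //=; rewrite /pr e'.
have nM : ~ mu.-negligible (pr @` M).
  rewrite prM => /negligibleP h; move: K0; rewrite h ?ltxx//.
  by apply: compact_measurable; exact: compact_pr.
have [|K' [cK' _ K'M K'0]] := borel_projection_compact cpr cK clK bM _ nM.
  by move=> z [].
exists K'; split => //; first by move=> z /K'M [].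
move=> z z' /K'M[Kz hz] /K'M[Kz' hz'] e.
by apply/eqP; rewrite eq_le hz// hz'.
Qed.

Lemma measurable_selection (B : set Z) M : <<s @open Z >> B ->
  (forall z, B z -> `|z.1| <= M /\ `|z.2| <= M) -> ~ mu.-negligible (fst @` B) ->
  exists D (w : R -> 'rV[R]_k), [/\ measurable D, (0 < mu D)%E,
    forall t, D t -> B (t, w t) &
    forall O : set 'rV[R]_k, open O -> measurable (D `&` w @^-1` O)].
Proof.
move=> bB BM nB.
pose K0 := `[- M, M]%classic `*` [set v : 'rV[R]_k | `|v| <= M].
have cK0 : compact K0.
  by apply: compact_setX; [exact: segment_compact|exact: compact_norm_ball].
have BK0 : B `<=` K0.
  by move=> z /BM[z1 z2]; split => //=; rewrite in_itv/= -ler_norml.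
have [K1 [cK1 _ K1B K10]] := borel_projection_compact cpr cK0 (Z_closed cK0) bB BK0 nB.
have [K [cK KB K_0 hK]] : exists K, [/\ compact K, K `<=` B, (0 < mu (pr @` K))%E &
    forall i, i \in enum 'I_k -> forall z z', K z -> K z' -> z.1 = z'.1 -> z.2 ord0 i = z'.2 ord0 i].
  elim: (enum 'I_k) => [|i s [K [cK KB K_0 hK]]]; first by exists K1; split.
  have [K' [cK' K'K K'0 hK']] := fix_coordinate i cK K_0.
  exists K'; split => //; first exact: subset_trans KB.
  move=> j; rewrite inE => /predU1P[->//|js] z z' /K'K Kz /K'K Kz'; exact: hK.
have uK z z' : K z -> K z' -> z.1 = z'.1 -> z.2 = z'.2.
  by move=> Kz Kz' e; apply/rowP => i; apply: hK => //; rewrite mem_enum.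
have : forall t, exists v, (pr @` K) t -> K (t, v).
  move=> t; have [[[t' v] Kz /= <-]|nt] := pselect ((pr @` K) t); first by exists v.
  by exists 0.
move=> /choice[w hw]; exists (pr @` K), w; split => //.
- by apply: compact_measurable; exact: compact_pr.
- by move=> t /hw /KB.
move=> O oO.
(* As [K] is a graph over its projection, the times with [w t] outside [O] are the projection of a
   compact part of [K]. *)
have -> : pr @` K `&` w @^-1` O = pr @` K `\` pr @` (K `&` snd @^-1` (~` O)).
  apply/seteqP; split => t [Kt h]; split => //.
    move=> [z [Kz /= nO] zt]; apply: nO.
    have := hw _ Kt => Kw; rewrite -zt in Kw.
    by rewrite (uK _ _ Kz Kw erefl)/= zt.
  apply: contrapT => nO; apply: h; exists (t, w t) => //.
  by split => //; exact: hw.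
apply: measurableD; first by apply: compact_measurable; exact: compact_pr.
apply: compact_measurable; apply: compact_pr; apply: compact_closedI => //.
by apply: closed_comp; [move=> z _; exact: cvg_snd|exact: open_closedC].
Qed.

End Selection.

(** * Regular data *)

Section LocalRates.
Context {R : realType}.

(** A compact interval meets only finitely many values of [Num.truncn], so a finite sum of the
    functions dominates there. *)
Lemma li_diag (h : nat -> R -> R) : (forall n, li (h n)) ->
  li (fun t => h (Num.truncn t) t).
Proof.
move=> lh; have mh n := (lh n).1.
have mn n : measurable [set t : R | Num.truncn t = n].
  rewrite (_ : mkset _ = if n is 0 then `]-oo, 1[%classic else `[n%:R, n.+1%:R[%classic).
    by case: n => *; exact: measurable_itv.
  apply/seteqP; split => [t /= <-|].
    case E : (Num.truncn t) => [|n']; rewrite /= in_itv/=.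
      by have := truncnS_gt t; rewrite E.
    have t0 : 0 <= t by apply: (le_trans ler01); rewrite -truncn_gt0 E.
    by rewrite -E truncn_itv.
  case: n => [|n] t /=; rewrite in_itv/= => ht.
    by apply/eqP; rewrite -leqn0 leqNgt truncn_gt0 -ltNge.
  exact: truncn_def.
have mdiag : measurable_fun setT (fun t : R => h (Num.truncn t) t).
  move=> _ Y mY; rewrite setTI (_ : _ @^-1` _ =
    \bigcup_n ([set t | Num.truncn t = n] `&` (h n @^-1` Y))); last first.
    by apply/seteqP; split => [t Yt|t [n _ [/= <-]]]//; exists (Num.truncn t).
  apply: bigcupT_measurable => n; apply: measurableI => //.
  by have := mh n measurableT _ mY; rewrite setTI.
split => //.
move=> a b; pose N := (Num.truncn b).+1.
have lg : li (fun t => \sum_(i <- iota 0 N) `|h i t|).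
  by apply: li_sum => i; exact: li_norm.
have [_ ig] := lg.
apply: (@le_integrable _ _ _ lebesgue_measure _ _ _ (EFin \o (fun t => \sum_(i <- iota 0 N) `|h i t|))) => //.
- by apply/measurable_EFinP; exact: measurable_funTS.
- move=> t; rewrite /= in_itv/= => /andP[_ tb]; rewrite lee_fin [leRHS]ger0_norm; last first.
    by rewrite sumr_ge0.
  have tN : Num.truncn t \in iota 0 N.
    rewrite mem_iota leq0n add0n ltnS leqNgt truncn_gt_nat -ltNge.
    by apply: le_lt_trans tb _; exact: truncnS_gt.
  rewrite (bigD1_seq _ tN (iota_uniq _ _)) /=.
  by rewrite lerDl sumr_ge0.
Qed.

Definition locally_bounded n (y : R -> 'rV[R]_n) :=
  forall T, exists N : nat, forall t, t <= T -> `|y t| <= N%:R.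

(** The hypotheses on the data give one rate per ball. Letting the radius [q t] depend on the
    integer part of [t] merges them into one locally integrable rate along a given state and
    control. *)
Lemma locally_bounded_rate n p (x : R -> 'rV[R]_n) (u : R -> 'rV[R]_p) (h : nat -> R -> R) :
  locally_bounded x -> locally_bounded u -> (forall n, li (h n)) ->
  exists q : R -> nat, (forall t, `|x t| <= (q t)%:R /\ `|u t| <= (q t)%:R) /\
    li (fun t => h (q t) t).
Proof.
move=> bx bu lh.
have : forall j : nat, exists N : nat, forall t, t <= j.+1%:R ->
    `|x t| <= N%:R /\ `|u t| <= N%:R.
  move=> j; have [N1 h1] := bx j.+1%:R; have [N2 h2] := bu j.+1%:R.
  exists (maxn N1 N2) => t tj; split.
    by rewrite (le_trans (h1 t tj))// ler_nat leq_maxl.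
  by rewrite (le_trans (h2 t tj))// ler_nat leq_maxr.
move=> /choice[N hN]; exists (fun t => N (Num.truncn t)); split.
  by move=> t; apply: hN; exact/ltW/truncnS_gt.
exact: (li_diag (fun j => lh (N j))).
Qed.

End LocalRates.

Section Clean.
Context {R : realType} {m k : nat}.
Notation X := 'rV[R]_m.
Notation Uc := 'rV[R]_k.

(* The regularity conditions with the exceptional null sets removed and a single
   rate beta n for the ball of radius n, measurable on the whole line. *)
Record regular_data (f : R -> X -> Uc -> X) (g : R -> X -> Uc -> R) (beta : nat -> R -> R) : Prop := {
  meas_f : forall x u i, measurable_fun setT (fun t => f t x u ord0 i);
  meas_g : forall x u, measurable_fun setT (fun t => g t x u);
  meas_fx : forall x u i j, measurable_fun setT (fun t => 'J (fun y => f t y u) x i j);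
  meas_gx : forall x u i, measurable_fun setT (fun t => grad (fun y => g t y u) x ord0 i);
  cont_f : forall t, continuous (fun z : X * Uc => f t z.1 z.2);
  cont_g : forall t, continuous (fun z : X * Uc => g t z.1 z.2);
  cont_fx : forall t, continuous (fun z : X * Uc => 'J (fun y => f t y z.2) z.1);
  cont_gx : forall t, continuous (fun z : X * Uc => grad (fun y => g t y z.2) z.1);
  li_beta : forall n, li (beta n);
  beta_ge0 : forall n t, 0 <= beta n t;
  beta_le : forall n p t, (n <= p)%N -> beta n t <= beta p t;
  bound_f : forall n t (x : X) (u : Uc), `|x| <= n%:R -> `|u| <= n%:R -> `|f t x u| <= beta n t;
  bound_g : forall n t (x : X) (u : Uc), `|x| <= n%:R -> `|u| <= n%:R -> `|g t x u| <= beta n t;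
  bound_fx : forall n t (x : X) (u : Uc), `|x| <= n%:R -> `|u| <= n%:R ->
    `|'J (fun y => f t y u) x| <= beta n t;
  bound_gx : forall n t (x : X) (u : Uc), `|x| <= n%:R -> `|u| <= n%:R ->
    `|grad (fun y => g t y u) x| <= beta n t;
  lip_f : forall n t (x y : X) (u : Uc), `|x| <= n%:R -> `|y| <= n%:R -> `|u| <= n%:R ->
    `|f t x u - f t y u| <= beta n t * `|x - y|;
  lip_g : forall n t (x y : X) (u : Uc), `|x| <= n%:R -> `|y| <= n%:R -> `|u| <= n%:R ->
    `|g t x u - g t y u| <= beta n t * `|x - y|;
  lip_fx : forall n t (x y : X) (u : Uc), `|x| <= n%:R -> `|y| <= n%:R -> `|u| <= n%:R ->
    `|'J (fun z => f t z u) x - 'J (fun z => f t z u) y| <= beta n t * `|x - y|;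
  lip_gx : forall n t (x y : X) (u : Uc), `|x| <= n%:R -> `|y| <= n%:R -> `|u| <= n%:R ->
    `|grad (fun z => g t z u) x - grad (fun z => g t z u) y| <= beta n t * `|x - y|;
  growth_f : forall n t x (u : Uc), `|u| <= n%:R -> `|f t x u| <= beta n t * (1 + `|x|);
  diff_f : forall t x u, differentiable (fun y => f t y u) x;
  diff_g : forall t x u, differentiable (fun y => g t y u) x
}.

(** The integral equation is imposed at all real times; since [vprim] vanishes before 0, solutions
    are constant there. *)
Definition sol n (F : R -> 'rV[R]_n -> 'rV[R]_n) (y : R -> 'rV[R]_n) :=
  [/\ vmeas y, vli (fun t => F t (y t)) &
      forall t, y t = y 0 + vprim (fun s => F s (y s)) t].

Lemma sol_ode n (F : R -> 'rV[R]_n -> 'rV[R]_n) y : sol F y -> ode_sol y (fun t => F t (y t)).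
Proof. by case=> _ lF yE; apply: (vprim_ode_sol lF) => t _; exact: yE. Qed.

Lemma vprim_bounded n (F : R -> 'rV[R]_n) : vli F -> locally_bounded (vprim F).
Proof.
move=> lF T; pose h t := \sum_i `|F t ord0 i|.
have lh : li h by apply: li_sum => i; exact: li_norm.
have [C C0 hC] := prim_bound (Num.max 0 T) lh.
exists (Num.truncn C).+1 => t tT; rewrite -vprim_maxr.
apply: (@le_trans _ _ C); last exact/ltW/truncnS_gt.
have s0 : 0 <= Num.max 0 t by rewrite le_max lexx.
apply: le_trans (hC (Num.max 0 t) _); last first.
  by rewrite s0 ge_max le_max lexx/= le_max tT orbT.
have := @vprim_dist _ _ F h 0 (Num.max 0 t) lF lh (lexx 0) s0.
by rewrite vprim0 prim0 !subr0; apply => u _; exact: rV_norm_le_sum.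
Qed.

Lemma sol_bounded n (F : R -> 'rV[R]_n -> 'rV[R]_n) y : sol F y -> locally_bounded y.
Proof.
case=> _ lF yE T; have [N hN] := vprim_bounded lF T.
exists (addn (Num.truncn `|y 0|).+1 N) => t tT; rewrite yE natrD.
by apply: le_trans (ler_normD _ _) _; rewrite lerD ?hN//; exact/ltW/truncnS_gt.
Qed.

(** Gronwall's inequality against the constant function [y s], which solves the equation with
    right-hand side 0; sublinear growth leaves the error term [(1 + |y s|) * l]. *)
Lemma sol_growth n (F : R -> 'rV[R]_n -> 'rV[R]_n) y (l : R -> R) S : sol F y ->
  li l -> (forall t, 0 <= l t) ->
  (forall t, 0 <= t <= S -> `|F t (y t)| <= l t * (1 + `|y t|)) ->
  forall s t, 0 <= s <= S -> 0 <= t <= S ->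
    `|y t| <= `|y s| + (1 + `|y s|) * prim l S * expR (prim l S).
Proof.
move=> [my lF yE] ll l0 hF s t hs ht.
have lC : vli (fun=> 0 : 'rV[R]_n).
  by move=> i; under eq_fun do rewrite mxE; exact: li_cst.
have C0 : forall t, 0 <= t -> y s = y s + vprim (fun=> 0 : 'rV[R]_n) t.
  move=> v _; have -> : vprim (fun=> 0 : 'rV[R]_n) v = 0; last by rewrite addr0.
  apply/rowP => i; rewrite !mxE.
  rewrite [X in prim X](_ : _ = fun t : R => 0 * cst 0 t); last first.
    by apply/funext => v'; rewrite /= ?mxE mul0r.
  by rewrite primZ ?mul0r//; exact: li_cst.
have le : li (fun t => (1 + `|y s|) * l t) by exact: liZ.
have := @ode_gronwall _ _ y (fun=> y s) _ _ l _ S lF lC (fun t _ => yE t) C0 ll l0 le.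
move=> /(_ _ _ s t hs ht); rewrite subrr normr0 add0r primZ// => H.
rewrite -[y t](subrK (y s)) addrC; apply: le_trans (ler_normD _ _) _; rewrite lerD2l.
apply: H => [v|v hv]; first by rewrite mulr_ge0// addr_ge0.
rewrite subr0; apply: le_trans (hF v hv) _.
have := ler_normD (y v - y s) (y s); rewrite subrK.
by have := l0 v; nra.
Qed.

Definition clamp n (B : R) (x : 'rV[R]_n) : 'rV[R]_n :=
  \row_i Num.max (- B) (Num.min B (x ord0 i)).

Lemma clampP (B a : R) : 0 <= B -> [\/ a <= - B /\ Num.max (- B) (Num.min B a) = - B,
  - B <= a <= B /\ Num.max (- B) (Num.min B a) = a |
  B <= a /\ Num.max (- B) (Num.min B a) = B].
Proof.
move=> B0; have [aB|Ba] := leP a B; last first.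
  by apply: Or33; split; [exact: ltW|rewrite (max_idPr _)//; lra].
have [aB'|Ba] := leP a (- B); first by apply: Or31.
by apply: Or32; split; [apply/andP; split => //; exact: ltW|].
Qed.

Lemma clamp_le n B (x : 'rV[R]_n) : 0 <= B -> `|clamp B x| <= B.
Proof.
move=> B0; apply: rV_norm_le => // i; rewrite mxE ler_norml.
rewrite le_max lexx/= ge_max ge_min lexx/= andbT; lra.
Qed.

Lemma clamp_id n B (x : 'rV[R]_n) : `|x| <= B -> clamp B x = x.
Proof.
move=> xB; apply/rowP => i; rewrite mxE.
have := le_trans (rV_coord_le x i) xB; rewrite ler_norml => /andP[h1 h2].
by rewrite (min_idPr h2) (max_idPr h1).
Qed.

Lemma clamp_norm n B (x : 'rV[R]_n) : 0 <= B -> `|clamp B x| <= `|x|.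
Proof.
move=> B0; apply: rV_norm_le => // i; apply: le_trans (rV_coord_le x i).
rewrite mxE; set a := x ord0 i; have h0 := ler_norm a; have h1 := ler_norm (- a).
rewrite normrN in h1; rewrite ler_norml.
by have [] := clampP a B0 => -[? ->]; apply/andP; split; lra.
Qed.

Lemma clamp_lip n B (x y : 'rV[R]_n) : 0 <= B -> `|clamp B x - clamp B y| <= `|x - y|.
Proof.
move=> B0; apply: rV_norm_le => // i.
have := rV_coord_le (x - y) i; apply: le_trans; rewrite !mxE.
wlog xy : x y / y ord0 i <= x ord0 i => [H|].
  have [/ltW|] := ltP (x ord0 i) (y ord0 i); last exact: H.
  by move=> /H; rewrite distrC (distrC (y _ _)).
rewrite [leRHS]ger0_norm ?subr_ge0//.
move: xy; set a := x ord0 i; set b := y ord0 i => ab.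
rewrite ler_norml.
by have [] := clampP a B0 => -[? ->]; have [] := clampP b B0 => -[? ->];
  apply/andP; split; lra.
Qed.

Definition borel_control (u : R -> Uc) := forall O, open O -> measurable (u @^-1` O).

Lemma borel_control_vmeas u : borel_control u -> vmeas u.
Proof.
move=> bu i; apply: (measurability _ (RGenOpens.measurableE R)).
move=> _ [_ [a [b ->] <-]]; rewrite setTI.
rewrite -[X in measurable X]/(u @^-1` ((fun v : Uc => v ord0 i) @^-1` `]a, b[%classic)).
apply: bu; apply: open_comp; last exact: interval_open.
by move=> v _; exact: coord_continuous.
Qed.

Variables (f : R -> X -> Uc -> X) (g : R -> X -> Uc -> R) (beta : nat -> R -> R).
Hypothesis rd : regular_data f g beta.

Lemma vmeas_f (x : R -> X) (u : R -> Uc) : vmeas x -> vmeas u -> vmeas (fun t => f t (x t) (u t)).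
Proof.
move=> mx mu i.
apply: (@measurable_caratheodory_comp _ _ _ _ _ (fun t x u => f t x u ord0 i) id) => //.
  by move=> y v; exact: (meas_f rd).
move=> t z; apply: (@rV_coord_cvg _ _ _ _ (fun z => f t z.1 z.2)); exact: (cont_f rd).
Qed.

Lemma measurable_g (x : R -> X) (u : R -> Uc) : vmeas x -> vmeas u ->
  measurable_fun setT (fun t => g t (x t) (u t)).
Proof.
move=> mx mu; apply: (@measurable_caratheodory_comp _ _ _ _ _ g id) => //.
  exact: (meas_g rd).
exact: (cont_g rd).
Qed.

(** The dynamics are Lipschitz only on balls. Clamping the state to the radius [B t] makes them
    globally Lipschitz, and [B] is the a priori bound from sublinear growth, which the clamped
    solution obeys as well; hence the clamp is never active. *)
Lemma trajectory_exists (u : R -> Uc) t0 c : vmeas u -> locally_bounded u -> 0 <= t0 ->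
  exists x, sol (fun t y => f t y (u t)) x /\ x t0 = c.
Proof.
move=> mu bu t00.
have [q [hq lq]] := locally_bounded_rate bu bu (li_beta rd).
pose l t := beta (q t) t; have l0 t : 0 <= l t by exact: (beta_ge0 rd).
(* The maximum makes the bound valid on both sides of [t0]: before [t0] the growth estimate runs
   backwards over [[0, t0]]. *)
pose Lam t := prim l (Num.max t t0).
have Lam0 t : 0 <= Lam t by rewrite /Lam prim_ge0// le_max t00 orbT.
pose B t := `|c| + (1 + `|c|) * Lam t * expR (Lam t).
have B0 t : 0 <= B t by rewrite /B addr_ge0// !mulr_ge0 ?addr_ge0 ?expR_ge0.
have mmax : measurable_fun setT (fun t : R => Num.max t t0).
  by apply: measurable_maxr; [exact: measurable_id|exact: measurable_cst].
have mLam : measurable_fun setT (prim l \o (fun t => Num.max t t0)).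
  by apply: measurableT_comp => //; exact: measurable_prim.
have mB : measurable_fun setT B.
  apply: measurable_funD => //; apply: measurable_funM; first exact: measurable_funM.
  exact: (@measurableT_comp _ _ _ _ _ _ expR).
(* The scalar bound is packed as a one-dimensional vector so that [locally_bounded_rate] applies to
   it. *)
have bB : locally_bounded (fun t => B t *: const_mx 1 : 'rV[R]_1).
  move=> T; exists (Num.truncn (B (Num.max T t0))).+1 => t tT.
  apply: (@le_trans _ _ (B (Num.max T t0))); last exact/ltW/truncnS_gt.
  apply: rV_norm_le; [exact: B0|move=> i; rewrite !mxE mulr1 ger0_norm; last exact: B0].
  have LL : Lam t <= Lam (Num.max T t0).
    apply: prim_nondecreasing => //; first by rewrite le_max t00 orbT.
    by rewrite ge_max !le_max tT lexx/= orbT.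
  rewrite /B lerD2l; apply: ler_pM; rewrite ?expR_ge0 ?mulr_ge0 ?addr_ge0 ?ler_expR//.
  by rewrite ler_wpM2l// addr_ge0.
have [q2 [hq2 lq2]] := locally_bounded_rate bB bu (li_beta rd).
have Bq t : B t <= (q2 t)%:R.
  have [h _] := hq2 t; apply: le_trans h.
  by have := rV_coord_le (B t *: const_mx 1 : 'rV[R]_1) ord0; rewrite !mxE mulr1 ger0_norm.
pose F t y := f t (clamp (B t) y) (u t).
have cq t (y : X) : `|clamp (B t) y| <= (q2 t)%:R by apply: le_trans (Bq t); exact: clamp_le.
have uq t : `|u t| <= (q2 t)%:R by case: (hq2 t).
have [||||y [my lF yc yE]] := @picard _ _ F (fun t => beta (q2 t) t) t0 c _ lq2 _ _ _ t00.
- move=> y my; apply: vmeas_f => // i; under eq_fun do rewrite mxE.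
  apply: measurable_maxr; first exact: measurableT_comp.
  exact: measurable_minr.
- by move=> t; exact: (beta_ge0 rd).
- move=> t y z; apply: le_trans (lip_f rd _ (cq t y) (cq t z) (uq t)) _.
  by rewrite ler_wpM2l ?(beta_ge0 rd)// clamp_lip.
- move=> t; exact: (bound_f rd).
have solF : sol F y by [].
have yB t : `|y t| <= B t.
  have yt : y t = y (Num.max 0 t) by rewrite yE [RHS]yE vprim_maxr.
  have Bt : B t = B (Num.max 0 t).
    rewrite /B /Lam; suff -> : Num.max (Num.max 0 t) t0 = Num.max t t0 by [].
    by rewrite -maxA maxCA (max_idPr t00).
  rewrite yt Bt; set s := Num.max 0 t; have s0 : 0 <= s by rewrite le_max lexx.
  rewrite /B -yc; apply: (@sol_growth _ F y l (Num.max s t0) solF lq l0).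
  - move=> v _; apply: le_trans (growth_f rd _ _ (hq v).2) _.
    by apply: ler_wpM2l; [exact: l0|rewrite lerD2l; exact: clamp_norm].
  - by rewrite t00 le_max lexx orbT.
  - by rewrite s0 le_max lexx.
exists y; split => //.
have FE t : F t (y t) = f t (y t) (u t) by rewrite /F clamp_id.
split => //.
  by move=> i; have := lF i; under eq_fun do rewrite FE.
by move=> t; rewrite [LHS]yE; congr (_ + _); apply: eq_vprim => s _.
Qed.

End Clean.

(** * The Hamiltonian and the adjoint equation *)

Section Dot.
Context {R : realType}.

Definition dot n (p q : 'rV[R]_n) : R := (p *m q^T) ord0 ord0.

Lemma dotE n (p q : 'rV[R]_n) : dot p q = \sum_i p ord0 i * q ord0 i.
Proof. by rewrite /dot mxE; apply: eq_bigr => i _; rewrite mxE. Qed.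

Lemma dotDl n (p q r : 'rV[R]_n) : dot (p + q) r = dot p r + dot q r.
Proof. by rewrite /dot mulmxDl mxE. Qed.
Lemma dotBl n (p q r : 'rV[R]_n) : dot (p - q) r = dot p r - dot q r.
Proof. by rewrite /dot mulmxBl !mxE. Qed.
Lemma dotZl n c (p r : 'rV[R]_n) : dot (c *: p) r = c * dot p r.
Proof. by rewrite /dot -scalemxAl mxE. Qed.
Lemma dotC n (p q : 'rV[R]_n) : dot p q = dot q p.
Proof. by rewrite !dotE; apply: eq_bigr => i _; rewrite mulrC. Qed.
Lemma dotBr n (p q r : 'rV[R]_n) : dot r (p - q) = dot r p - dot r q.
Proof. by rewrite dotC dotBl !(dotC r). Qed.
Lemma dotNl n (p r : 'rV[R]_n) : dot (- p) r = - dot p r.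
Proof. by rewrite -scaleN1r dotZl mulN1r. Qed.
Lemma dot0r n (p : 'rV[R]_n) : dot p 0 = 0.
Proof. by rewrite -(subrr p) dotBr subrr. Qed.
Lemma dot0l n (p : 'rV[R]_n) : dot 0 p = 0.
Proof. by rewrite dotC dot0r. Qed.

Lemma dot_le n (p q : 'rV[R]_n) : `|dot p q| <= n%:R * (`|p| * `|q|).
Proof.
rewrite dotE (le_trans (ler_norm_sum _ _ _))//.
apply: (@le_trans _ _ (\sum_(i < n) `|p| * `|q|)).
  by apply: ler_sum => i _; rewrite normrM ler_pM// rV_coord_le.
by rewrite sumr_const card_ord mulr_natl.
Qed.

Lemma mulmx_tr_le n p (x : 'rV[R]_n) (A : 'M[R]_(p, n)) :
  `|x *m A^T| <= n%:R * (`|x| * `|A|).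
Proof.
apply: rV_norm_le => [|j]; first by rewrite !mulr_ge0.
rewrite mxE (le_trans (ler_norm_sum _ _ _))//.
apply: (@le_trans _ _ (\sum_(i < n) `|x| * `|A|)).
  apply: ler_sum => i _; rewrite normrM ler_pM// ?rV_coord_le// mxE.
  rewrite [leRHS]/Num.norm/= mx_normrE.
  exact: (le_bigmax _ (fun ij : 'I_p * 'I_n => `|A ij.1 ij.2|) (j, i)).
by rewrite sumr_const card_ord mulr_natl.
Qed.

Definition bounded_left (y : R -> R) := forall T, exists C, forall t, t <= T -> `|y t| <= C.

Lemma li_mul_bounded (h y : R -> R) : li h -> measurable_fun setT y -> bounded_left y ->
  li (fun t => h t * y t).
Proof.
move=> lh my by_; apply: (li_dom _ (li_norm lh)) => [|a b].
  by apply: measurable_funM => //; case: lh.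
have [C hC] := by_ b; exists C => t /andP[_ tb].
by rewrite normrM mulrC ler_wpM2r// hC.
Qed.

Lemma bounded_left_affine c (h : R -> R) : li h -> bounded_left (fun t => c + prim h t).
Proof.
move=> lh T; have [C C0 hC] := prim_bound (Num.max 0 T) lh.
exists (`|c| + C) => t tT; rewrite (le_trans (ler_normD _ _))// lerD2l -prim_maxr.
by apply: hC; rewrite le_max lexx/= ge_max le_max lexx/= le_max tT orbT.
Qed.

Lemma li_product_rule a b (h1 h2 : R -> R) : li h1 -> li h2 ->
  li (fun t => h1 t * (b + prim h2 t) + h2 t * (a + prim h1 t)).
Proof.
move=> l1 l2; apply: liD; apply: li_mul_bounded => //; try exact: bounded_left_affine.
  by apply: measurable_funD => //; exact: measurable_prim.
by apply: measurable_funD => //; exact: measurable_prim.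
Qed.

Lemma prim_product_rule a b (h1 h2 : R -> R) t : li h1 -> li h2 -> 0 <= t ->
  (a + prim h1 t) * (b + prim h2 t) =
  a * b + prim (fun t => h1 t * (b + prim h2 t) + h2 t * (a + prim h1 t)) t.
Proof.
move=> l1 l2 t0.
have ac1 T : abs_continuous 0 T (fun t => a + prim h1 t).
  have -> : (fun t => a + prim h1 t) = (fun t => a + 1 * prim h1 t).
    by apply/funext => s; rewrite mul1r.
  exact/ac_affine/prim_ac.
have ac2 T : abs_continuous 0 T (fun t => b + prim h2 t).
  have -> : (fun t => b + prim h2 t) = (fun t => b + 1 * prim h2 t).
    by apply/funext => s; rewrite mul1r.
  exact/ac_affine/prim_ac.
have ac12 T : abs_continuous 0 T (fun t => (a + prim h1 t) * (b + prim h2 t)).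
  have [C1 hC1] := bounded_left_affine a l1 T; have [C2 hC2] := bounded_left_affine b l2 T.
  apply: (@ac_mul _ _ _ _ _ (`|C1| + `|C2|)) => // s /andP[_ sT]; split.
    apply: le_trans (hC1 s sT) _; apply: le_trans (ler_norm _) _.
    by rewrite lerDl.
  apply: le_trans (hC2 s sT) _; apply: le_trans (ler_norm _) _.
  by rewrite lerDr.
have := @ac_fun_eq_prim _ _ _ (li_product_rule a b l1 l2) ac12 _ t t0.
rewrite !prim0 !addr0; apply.
apply: (ae_imp2 (prim_derive l1) (prim_derive l2)) => s d1 d2 s0.
have e1 := is_deriveD (is_derive_cst a s (1 : R)) (d1 s0).
have e2 := is_deriveD (is_derive_cst b s (1 : R)) (d2 s0).
refine (@is_derive_eq _ _ _ _ _ _ _ _ (is_deriveM e1 e2) _).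
rewrite /GRing.scale/= !add0r [(cst a + _) s](_ : _ = a + prim h1 s)//.
by rewrite [(cst b + _) s](_ : _ = b + prim h2 s)// addrC; congr (_ + _); exact: mulrC.
Qed.

Lemma prim_sum (I : Type) (r : seq I) (h : I -> R -> R) t : (forall i, li (h i)) ->
  prim (fun s => \sum_(i <- r) h i s) t = \sum_(i <- r) prim (h i) t.
Proof.
move=> lh; elim: r => [|i r ih].
  rewrite big_nil [X in prim X](_ : _ = fun t : R => 0 * cst 0 t); last first.
    by apply/funext => v'; rewrite /= ?big_nil mul0r.
  by rewrite primZ ?mul0r//; exact: li_cst.
rewrite big_cons -ih -primD//; last exact: li_sum.
by congr prim; apply/funext => s; rewrite big_cons.
Qed.

Lemma dot_product_rule n (p q F G : R -> 'rV[R]_n) : vli F -> vli G ->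
  (forall t, p t = p 0 + vprim F t) -> (forall t, q t = q 0 + vprim G t) ->
  li (fun t => dot (F t) (q t) + dot (p t) (G t)) /\
  forall t, 0 <= t -> dot (p t) (q t) = dot (p 0) (q 0) +
     prim (fun t => dot (F t) (q t) + dot (p t) (G t)) t.
Proof.
move=> lF lG pE qE.
pose h i t := F t ord0 i * q t ord0 i + G t ord0 i * p t ord0 i.
have lh i : li (h i).
  rewrite /h; under eq_fun => t do rewrite pE qE !mxE.
  exact: li_product_rule.
have E : (fun t => dot (F t) (q t) + dot (p t) (G t)) = (fun t => \sum_i h i t).
  by apply/funext => t; rewrite !dotE -big_split; apply: eq_bigr => i _; rewrite /h [X in _ + X]mulrC.
rewrite E; split; first exact: li_sum.
move=> t t0; rewrite prim_sum// !dotE -big_split/=; apply: eq_bigr => i _.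
rewrite [in LHS]pE [in LHS]qE !mxE prim_product_rule//; congr (_ + prim _ t).
by apply/funext => s; rewrite /h [in RHS]pE [in RHS]qE !mxE.
Qed.

End Dot.

Section Hamiltonian.
Context {R : realType} {m k : nat}.
Notation X := 'rV[R]_m.
Notation Uc := 'rV[R]_k.
Variables (f : R -> X -> Uc -> X) (g : R -> X -> Uc -> R) (beta : nat -> R -> R).
Hypothesis rd : regular_data f g beta.
Notation ham := (hamiltonian f g).
Notation dham := (dhamiltonian f g).
Notation fx t u x := ('J (fun y : X => f t y u) x).
Notation gx t u x := (grad (fun y : X => g t y u) x).

Lemma hamE x t u lam psi : ham x t u lam psi = dot psi (f t x u) + lam * g t x u.
Proof. by []. Qed.

Lemma is_derive_ham x t u lam psi v : is_derive x v (fun y => ham y t u lam psi)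
  (dot (psi *m (fx t u x)^T + lam *: gx t u x) v).
Proof.
have df := diff_f rd t x u; have dg := diff_g rd t x u.
have d1 j : is_derive x v (fun y => f t y u ord0 j) ((v *m fx t u x) ord0 j).
  rewrite -deriveEjacobian//.
  have h1 : derivable (fun y => f t y u) x v by exact: diff_derivable.
  have cv : h^-1 *: (((fun y => f t y u) \o shift x) (h *: v) - f t x u) ord0 j @[h --> (0 : R)^'] -->
      'D_v (fun y => f t y u) x ord0 j.
    have := @rV_coord_cvg _ _ _ _ _ _ j h1.
    by apply: cvg_trans; apply: near_eq_cvg; apply: nearW => h; rewrite !mxE.
  apply: DeriveDef.
    apply/cvg_ex; exists ('D_v (fun y => f t y u) x ord0 j).
    by apply: cvg_trans cv; apply: near_eq_cvg; apply: nearW => h; rewrite /= !mxE.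
  apply/cvg_lim; first exact: norm_hausdorff.
  by apply: cvg_trans cv; apply: near_eq_cvg; apply: nearW => h; rewrite /= !mxE.
have d2 : is_derive x v (fun y => g t y u) (dot (gx t u x) v).
  apply: DeriveDef; first exact: diff_derivable.
  rewrite deriveE// dotC dotE [in LHS](row_sum_delta v) linear_sum/=.
  by apply: eq_bigr => i _; rewrite linearZ/= mxE deriveE.
have := is_deriveD (is_derive_sum (fun j => is_deriveZ (psi ord0 j) (d1 j))) (is_deriveZ lam d2).
have -> : \sum_(i < m) (psi ord0 i \*: (fun y : X => f t y u ord0 i)) + lam \*: (fun y : X => g t y u) =
  (fun y => ham y t u lam psi).
  apply/funext => y; rewrite hamE dotE; congr (_ + _).
  by rewrite fct_sumE.
move=> h; refine (@is_derive_eq _ _ _ _ _ _ _ _ h _).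
rewrite dotDl dotZl; congr (_ + _).
rewrite dotE.
under eq_bigr do rewrite /GRing.scale/= mxE mulr_sumr.
rewrite exchange_big; apply: eq_bigr => i _ /=; rewrite mxE mulr_suml.
by apply: eq_bigr => j _; rewrite [X in _ = _ * X * _]mxE; set J := 'J _ _ _ _; ring.
Qed.

Lemma dhamE x t u lam psi : dham x t u lam psi = psi *m (fx t u x)^T + lam *: gx t u x.
Proof.
apply/rowP => i; rewrite [LHS]mxE.
have [_ ->] := is_derive_ham x t u lam psi (delta_mx ord0 i).
rewrite dotE (bigD1 i)//= big1; first by rewrite addr0 [X in _ * X]mxE !eqxx mulr1.
by move=> j ji; rewrite [X in _ * X]mxE eqxx/= (negbTE ji) mulr0.
Qed.

Lemma dhamB x t u lam lam' psi psi' :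
  dham x t u lam psi - dham x t u lam' psi' = dham x t u (lam - lam') (psi - psi').
Proof.
rewrite !dhamE mulmxBl scalerBl opprD !addrA; congr (_ + _).
by rewrite -!addrA; congr (_ + _); rewrite addrC.
Qed.

Lemma dhamZ c x t u lam psi : dham x t u (c * lam) (c *: psi) = c *: dham x t u lam psi.
Proof. by rewrite !dhamE -scalemxAl scalerDr scalerA. Qed.

Lemma hamZ c x t u lam psi : ham x t u (c * lam) (c *: psi) = c * ham x t u lam psi.
Proof. by rewrite !hamE dotZl mulrDr mulrA. Qed.

Notation weight lam psi := (m%:R * `|psi| + `|lam|).

Lemma dham_le n x t u lam psi : `|x| <= n%:R -> `|u| <= n%:R ->
  `|dham x t u lam psi| <= weight lam psi * beta n t.
Proof.
move=> xn un; rewrite dhamE mulrDl; apply: le_trans (ler_normD _ _) _; apply: lerD.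
  apply: le_trans (mulmx_tr_le _ _) _; rewrite mulrA ler_wpM2l ?mulr_ge0//.
  exact: (bound_fx rd).
by rewrite normrZ ler_wpM2l// (bound_gx rd).
Qed.

Lemma dham_lip n x y t u lam psi : `|x| <= n%:R -> `|y| <= n%:R -> `|u| <= n%:R ->
  `|dham x t u lam psi - dham y t u lam psi| <= weight lam psi * beta n t * `|x - y|.
Proof.
move=> xn yn un; rewrite !dhamE.
have -> : psi *m (fx t u x)^T + lam *: gx t u x - (psi *m (fx t u y)^T + lam *: gx t u y) =
  psi *m (fx t u x - fx t u y)^T + lam *: (gx t u x - gx t u y).
  by rewrite linearB/= mulmxBr scalerBr opprD addrACA.
rewrite -mulrA mulrDl; apply: le_trans (ler_normD _ _) _; apply: lerD.
  apply: le_trans (mulmx_tr_le _ _) _; rewrite mulrA ler_wpM2l ?mulr_ge0//.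
  exact: (lip_fx rd).
by rewrite normrZ ler_wpM2l// (lip_gx rd).
Qed.

Lemma ham_lip n x y t u lam psi : `|x| <= n%:R -> `|y| <= n%:R -> `|u| <= n%:R ->
  `|ham x t u lam psi - ham y t u lam psi| <= weight lam psi * beta n t * `|x - y|.
Proof.
move=> xn yn un; rewrite !hamE opprD addrACA -dotBr -mulrBr.
rewrite -mulrA mulrDl; apply: le_trans (ler_normD _ _) _; apply: lerD.
  apply: le_trans (dot_le _ _) _; rewrite mulrA ler_wpM2l ?mulr_ge0//.
  exact: (lip_f rd).
by rewrite normrM ler_wpM2l// (lip_g rd).
Qed.

(** Mean value theorem along the segment from [x] to [y], which stays in the ball; the Lipschitz
    rate of the gradient makes the remainder quadratic. *)
Lemma ham_taylor n x y t u lam psi : `|x| <= n%:R -> `|y| <= n%:R -> `|u| <= n%:R ->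
  `|ham y t u lam psi - ham x t u lam psi - dot (dham x t u lam psi) (y - x)| <=
  m%:R * (weight lam psi * beta n t) * `|y - x| ^+ 2.
Proof.
move=> xn yn un; set e := y - x.
pose z (s : R) := x + s *: e.
have zn s : 0 <= s <= 1 -> `|z s| <= n%:R.
  move=> /andP[s0 s1]; have -> : z s = (1 - s) *: x + s *: y.
    by rewrite /z /e scalerBr scalerBl scale1r addrA addrAC.
  apply: le_trans (ler_normD _ _) _; rewrite !normrZ (ger0_norm s0) ger0_norm ?subr_ge0//.
  have : (1 - s) * `|x| <= (1 - s) * n%:R by rewrite ler_wpM2l// subr_ge0.
  have : s * `|y| <= s * n%:R by rewrite ler_wpM2l.
  by rewrite mulrBl mul1r; lra.
have dphi (s : R) : is_derive s (1 : R) (fun s => ham (z s) t u lam psi)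
    (dot (dham (z s) t u lam psi) e).
  apply/is_derive1_cvg; have [h1 h2] := is_derive_ham (z s) t u lam psi e.
  rewrite -dhamE in h2; rewrite -h2.
  apply: cvg_trans h1; apply: near_eq_cvg; apply: nearW => h /=.
  by rewrite /z scalerDl; congr (_ *: (hamiltonian f g _ t u lam psi - _)); rewrite addrCA.
have [|s s01] := @MVT_segment _ (fun s => ham (z s) t u lam psi)
   (fun s => dot (dham (z s) t u lam psi) e) 0 1 ler01 (fun s _ => dphi s).
  apply: derivable_within_continuous => s _.
  by have [] := dphi s.
have xe : x + e = y by rewrite /e addrC subrK.
rewrite subr0 mulr1 /z scale1r scale0r addr0 xe => ->.
have {}s01 : 0 <= s <= 1 by move: s01; rewrite in_itv.
rewrite -dotBl; apply: le_trans (dot_le _ _) _.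
rewrite -[leRHS]mulrA ler_wpM2l// expr2 mulrA ler_wpM2r//.
apply: le_trans (dham_lip _ _ _ (zn s s01) xn un) _.
rewrite ler_wpM2l ?mulr_ge0 ?addr_ge0 ?mulr_ge0 ?(beta_ge0 rd)//.
rewrite /z addrC addKr normrZ ler_piMl//.
by case/andP: s01 => s0 s1; rewrite ger0_norm.
Qed.

Lemma vmeas_dham (x : R -> X) (u : R -> Uc) lam (psi : R -> X) : vmeas x -> vmeas u -> vmeas psi ->
  vmeas (fun t => dham (x t) t (u t) lam (psi t)).
Proof.
move=> mx mu mpsi i.
rewrite (_ : (fun t => _) = (fun t => (\sum_j psi t ord0 j * fx t (u t) (x t) i j) +
   lam * gx t (u t) (x t) ord0 i)); last first.
  apply/funext => t; rewrite dhamE !mxE; congr (_ + _ * _).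
  by apply: eq_bigr => j _; rewrite mxE.
apply: measurable_funD; last first.
  apply: measurable_funM => //.
  apply: (@measurable_caratheodory_comp _ _ _ _ _ (fun t x u => gx t u x ord0 i) id) => //.
    by move=> y v; exact: (meas_gx rd).
  by move=> t z; apply: (@rV_coord_cvg _ _ _ _ (fun z => gx t z.2 z.1)); exact: (cont_gx rd).
apply: measurable_sum => j; apply: measurable_funM; first exact: mpsi.
apply: (@measurable_caratheodory_comp _ _ _ _ _ (fun t x u => fx t u x i j) id) => //.
  by move=> y v; exact: (meas_fx rd).
move=> t z.
apply: (@cvg_comp _ _ _ (fun z => fx t z.2 z.1) (fun M : 'M[R]_m => M i j) (nbhs z)
   (nbhs (fx t z.2 z.1))); last exact: coord_continuous.
exact: (cont_fx rd).
Qed.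

(** The equation is affine in the costate, hence globally Lipschitz, and [picard] applies without
    truncation. *)
Lemma adjoint_exists (x : R -> X) (u : R -> Uc) lam t0 c :
  vmeas x -> locally_bounded x -> vmeas u -> locally_bounded u -> 0 <= t0 ->
  exists psi, sol (fun t p => - dham (x t) t (u t) lam p) psi /\ psi t0 = c.
Proof.
move=> mx bx mu bu t00; have [q [hq lq]] := locally_bounded_rate bx bu (li_beta rd).
have lL := liZ (m%:R + `|lam|) lq.
have L0 t : 0 <= (m%:R + `|lam|) * beta (q t) t.
  by rewrite mulr_ge0 ?addr_ge0// (beta_ge0 rd).
have [|||psi [mp lp pc pE]] := @picard _ _ (fun t p => - dham (x t) t (u t) lam p)
   (fun t => (m%:R + `|lam|) * beta (q t) t) t0 c _ lL L0 _ _ t00.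
- by move=> y my; apply: vmeasN; exact: vmeas_dham.
- move=> t y z; rewrite -opprD normrN dhamB subrr.
  apply: le_trans (dham_le _ _ _ (hq t).1 (hq t).2) _.
  rewrite normr0 addr0 mulrAC ler_wpM2r// ler_wpM2r ?(beta_ge0 rd)//.
  by rewrite lerDl.
- move=> t; rewrite normrN; apply: le_trans (dham_le _ _ _ (hq t).1 (hq t).2) _.
  by rewrite normr0 mulr0 add0r ler_wpM2r ?(beta_ge0 rd)// lerDr.
by exists psi; split.
Qed.

End Hamiltonian.

(** * Ekeland's principle for controls *)

Section Ekeland.
Context {R : realType} (P : Type) (J : P -> R) (d : P -> P -> R).
Hypotheses (d0 : forall p, d p p = 0) (d_ge0 : forall p q, 0 <= d p q)
  (d_triangle : forall p q r, d p r <= d p q + d q r).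
Hypothesis complete_d : forall (p_ : nat -> P) C,
  (forall j, d (p_ j) (p_ j.+1) <= C * 2^-1 ^+ j) ->
  exists p, (forall j, d (p_ j) p <= 2 * C * 2^-1 ^+ j) /\
    J (p_ j) @[j --> \oo] --> J p.

(** [S p q] says that [q] improves on [p] by at least [eps * d p q]. If some such [q] realises half
    of the improvement still possible, the sequence moves to it; otherwise that half already bounds
    the possible improvement at [p]. Either way it halves, so the distances are summable, and the
    limit admits no improvement of this kind. *)
Lemma ekeland p0 eps : 0 < eps -> (forall p, J p <= J p0 + eps ^+ 2) ->
  exists p, d p0 p <= eps /\ forall q, J q <= J p + eps * d p q.
Proof.
move=> e0 Jb.
pose S p q := J p + eps * d p q <= J q.
have Strans p q r : S p q -> S q r -> S p r.
  rewrite /S => h1 h2; have := d_triangle p q r; have := d_ge0 p r; nra.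
have SJ p q : S p q -> J p <= J q.
  by rewrite /S; apply: le_trans; rewrite lerDl mulr_ge0// ltW.
pose ok p a := forall q, S p q -> J q <= J p + a.
have step p a : ok p a -> exists q, S p q /\ ok q (a / 2).
  move=> okp; have [[q [Spq hq]]|nq] := pselect (exists q, S p q /\ J p + a / 2 <= J q).
    exists q; split => // r Sqr; have := okp r (Strans _ _ _ Spq Sqr); lra.
  exists p; split; first by rewrite /S d0 mulr0 addr0.
  move=> q Spq; rewrite leNgt; apply/negP => h; apply: nq; exists q; split => //.
  exact: ltW.
have : forall pa : P * R, exists q, ok pa.1 pa.2 -> S pa.1 q /\ ok q (pa.2 / 2).
  move=> [p a]; have [h|nh] := pselect (ok p a); last by exists p.
  by have [q hq] := step _ _ h; exists q.
move=> /choice[nxt hnxt].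
pose a (j : nat) := eps ^+ 2 * 2^-1 ^+ j.
pose fix s j := if j is j'.+1 then nxt (s j', a j') else p0.
have aS j : a j.+1 = a j / 2 by rewrite /a [2^-1 ^+ j.+1]exprSr mulrA.
have oks j : ok (s j) (a j).
  elim: j => [|j ih]; first by move=> q _; rewrite /a expr0 mulr1; exact: Jb.
  by rewrite aS; have [] := hnxt (s j, a j) ih.
have Ss j : S (s j) (s j.+1) by have [] := hnxt (s j, a j) (oks j).
have Smono i j : (i <= j)%N -> S (s i) (s j).
  elim: j => [|j ih]; first by rewrite leqn0 => /eqP->; rewrite /S d0 mulr0 addr0.
  rewrite leq_eqVlt => /predU1P[->|]; first by rewrite /S d0 mulr0 addr0.
  by rewrite ltnS => /ih h; exact: Strans h (Ss j).
have ds j : d (s j) (s j.+1) <= eps * 2^-1 ^+ j.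
  have h1 := Ss j; have h2 := oks j _ (Ss j); rewrite /S in h1.
  have : eps * d (s j) (s j.+1) <= eps * (eps * 2^-1 ^+ j).
    by rewrite mulrA -expr2 -/(a j); lra.
  by rewrite ler_pM2l.
have [p [hp Jp]] := complete_d ds.
have Sp j : S (s j) p.
  rewrite /S; apply/ler_addgt0Pl => e ee.
  have le i : (j <= i)%N -> J (s j) + eps * d (s j) p <= J (s i) + eps * (2 * eps * 2^-1 ^+ i).
    move=> ji; have := Smono _ _ ji; rewrite /S => h.
    have h2 := d_triangle (s j) (s i) p; have h3 := hp i.
    have h4 : eps * d (s j) p <= eps * (d (s j) (s i) + 2 * eps * 2^-1 ^+ i).
      rewrite ler_pM2l//; lra.
    lra.
  have c2 : J (s i) + eps * (2 * eps * 2^-1 ^+ i) @[i --> \oo] --> J p + eps * 0.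
    by apply: cvgD => //; apply: cvgMr; exact: half_exp_cvg.
  rewrite mulr0 addr0 in c2.
  apply: (@le_trans _ _ (J p)); last by rewrite lerDr ltW.
  by apply: (cvgr_to_ge c2); exists j => // i /= ji; exact: le.
exists p; split.
  have := Sp 0%N; rewrite /S /= => h; have := Jb p => h2.
  by rewrite -(ler_pM2l e0); rewrite -expr2; lra.
move=> q; rewrite leNgt; apply/negP => h.
have Spq : S p q by rewrite /S ltW.
have Jq j : J q - J p <= eps ^+ 2 * 2^-1 ^+ j.
  by have := oks j q (Strans _ _ _ (Sp j) Spq); have := SJ _ _ (Sp j); rewrite /a; lra.
have := half_exp_le Jq; have := d_ge0 p q; nra.
Qed.

End Ekeland.

Section ControlMetric.
Context {R : realType} {k : nat}.
Notation mu := (@lebesgue_measure R).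
Notation Uc := 'rV[R]_k.
Implicit Types v w : R -> Uc.

(* mu (differ v w) is Ekeland's metric on controls. *)
Definition differ v w := [set t : R | v t <> w t].

Lemma measurable_differ v w : vmeas v -> vmeas w -> measurable (differ v w).
Proof.
move=> mv mw; rewrite (_ : differ v w =
   \bigcup_(i in [set: 'I_k]) [set t | v t ord0 i != w t ord0 i]); last first.
  apply/seteqP; split => [t h|t [i _ /= h] e]; last by rewrite e eqxx in h.
  apply: contrapT => nh; apply: h; apply/rowP => i; apply/eqP/negPn/negP => hi.
  by apply: nh; exists i.
apply: fin_bigcup_measurable => // i _.
rewrite (_ : mkset _ = ~` [set t | v t ord0 i == w t ord0 i]); last first.
  by apply/seteqP; split => t /=; move/negP.
apply: measurableC.
have := measurable_fun_eqr (mv i) (mw i).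
by move=> /(_ measurableT [set true]); rewrite setTI; apply.
Qed.

Lemma differ_sym v w : differ v w = differ w v.
Proof. by apply/seteqP; split => t /= h e; apply: h. Qed.

Lemma differ_triangle v w z : differ v z `<=` differ v w `|` differ w z.
Proof.
move=> t h; have [e|ne] := pselect (v t = w t); last by left.
by right => e2; apply: h; rewrite e.
Qed.

(** Borel-Cantelli: outside [E n], the set where some two consecutive controls from index [n] on
    differ, the sequence is constant from [n] on. On the null set common to all [E n] the limit is
    defined to be [u0], so that its values stay in [U t]. *)
Lemma control_limit (u0 : R -> Uc) (v_ : nat -> R -> Uc) C :
  borel_control u0 -> (forall j, borel_control (v_ j)) ->
  (forall j, (mu (differ (v_ j) (v_ j.+1)) <= (C * 2^-1 ^+ j)%:E)%E) ->
  exists v, [/\ borel_control v,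
    forall t, v t = u0 t \/ exists j, v t = v_ j t,
    forall j, (mu (differ (v_ j) v) <= (2 * C * 2^-1 ^+ j)%:E)%E &
    {ae mu, forall t, exists n, forall j, (n <= j)%N -> v_ j t = v t}].
Proof.
move=> bu0 bv hC.
have C0 : 0 <= C.
  by have := le_trans (measure_ge0 mu _) (hC 0%N); rewrite expr0 mulr1 lee_fin.
pose D j := differ (v_ j) (v_ j.+1).
have mD j : measurable (D j) by apply: measurable_differ; exact: borel_control_vmeas.
pose F n N := \big[setU/set0]_(i < N) D (n + i)%N.
have mF n N : measurable (F n N) by exact: bigsetU_measurable.
have muF n N : (mu (F n N) <= (2 * C * 2^-1 ^+ n * (1 - 2^-1 ^+ N))%:E)%E.
  elim: N => [|N ih]; first by rewrite /F big_ord0 measure0 expr0 subrr mulr0.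
  rewrite /F big_ord_recr/=; have mU := measureU2 mu (mF n N) (mD (n + N)%N).
  apply: le_trans mU _.
  apply: le_trans (leeD ih (hC (n + N)%N)) _.
  rewrite -EFinD lee_fin exprD exprSr; set r := 2^-1 ^+ n; set q := 2^-1 ^+ N.
  lra.
pose E n := \bigcup_N F n N.
have mE n : measurable (E n) by exact: bigcupT_measurable.
have muE n : (mu (E n) <= (2 * C * 2^-1 ^+ n)%:E)%E.
  have nd : nondecreasing_seq (F n).
    by apply/nondecreasing_seqP => N; rewrite /F big_ord_recr/=; apply/subsetPset => t; left.
  have cv := @nondecreasing_cvg_mu _ _ _ mu (F n) (mF n) (mE n) nd.
  rewrite -(cvg_lim _ cv)//; apply: lime_le; first by apply/cvg_ex; eexists; exact: cv.
  apply: nearW => N; apply: le_trans (muF n N) _; rewrite lee_fin.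
  have q0 : (0 : R) <= 2^-1 ^+ N by rewrite exprn_ge0.
  have r0 : 0 <= 2 * C * 2^-1 ^+ n by rewrite !mulr_ge0// exprn_ge0.
  by apply: ler_piMr => //; lra.
have DE n j : (n <= j)%N -> D j `<=` E n.
  move=> nj t Dt; exists (j - n).+1 => //; rewrite /F big_ord_recr/=; right.
  by rewrite subnKC.
have Econst n j t : ~ E n t -> (n <= j)%N -> v_ j t = v_ n t.
  move=> nE; elim: j => [|j ih]; first by rewrite leqn0 => /eqP->.
  rewrite leq_eqVlt => /predU1P[<-//|]; rewrite ltnS => nj.
  rewrite -ih//; apply: contrapT => h; apply: nE; apply: (DE n j nj) => e.
  exact: h.
have : forall t, exists z, (forall n, ~ E n t -> z = v_ n t) /\ (z = u0 t \/ exists j, z = v_ j t)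
    /\ ((forall n, E n t) -> z = u0 t).
  move=> t; have [h|] := pselect (forall n, E n t).
    by exists (u0 t); split => //; split; [left|].
  move=> /existsNP[n hn]; exists (v_ n t); split.
    move=> n' hn'; have [nn|/ltnW nn] := leqP n n'; first by rewrite (Econst n n').
    by rewrite (Econst n' n).
  by split => [|h]; [right; exists n|exfalso; exact: hn].
move=> /choice[v hv]; exists v; split.
- move=> O oO.
  have -> : v @^-1` O = (\bigcap_n E n `&` u0 @^-1` O) `|` \bigcup_n (~` E n `&` v_ n @^-1` O).
    apply/seteqP; split => t; rewrite /preimage/=.
      have [h1 [_ h3]] := hv t.
      have [h|] := pselect (forall n, E n t).
        by rewrite h3// => ?; left; split => // n _; exact: h.
      by move=> /existsNP[n hn]; rewrite (h1 n)// => ?; right; exists n.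
    have [h1 [_ h3]] := hv t.
    move=> [[h ?]|[n _ [nE ?]]]; last by rewrite (h1 n).
    by rewrite h3// => n; exact: h.
  apply: measurableU.
    by apply: measurableI; [exact: bigcapT_measurable|exact: bu0].
  by apply: bigcupT_measurable => n; apply: measurableI; [exact: measurableC|exact: bv].
- by move=> t; have [_ []] := hv t.
- move=> j; apply: le_trans (muE j).
  have sub : differ (v_ j) v `<=` E j.
    move=> t h; apply: contrapT => nE; apply: h.
    by have [h1 _] := hv t; rewrite (h1 j).
  apply: le_measure; rewrite ?inE//; last exact: mE.
  have -> : differ (v_ j) v = E j `&` differ (v_ j) v by rewrite setIidr.
  suff -> : E j `&` differ (v_ j) v = (\bigcap_n E n `&` differ (v_ j) u0) `|`
      \bigcup_n (E j `&` (~` E n `&` differ (v_ j) (v_ n))).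
    apply: measurableU.
      apply: measurableI; first exact: bigcapT_measurable.
      by apply: measurable_differ; exact: borel_control_vmeas.
    apply: bigcupT_measurable => n; apply: measurableI; first exact: mE.
    apply: measurableI; first by apply: measurableC; exact: mE.
    by apply: measurable_differ; exact: borel_control_vmeas.
  apply/seteqP; split => t; rewrite /differ/=.
    move=> [Ejt vv]; have [h1 [_ h3]] := hv t.
    have [h|] := pselect (forall n, E n t).
      by left; split; [move=> n _; exact: h|rewrite -h3].
    by move=> /existsNP[n hn]; right; exists n => //; split => //; split => //; rewrite /differ/= -(h1 n hn).
  have [h1 [_ h3]] := hv t.
  move=> [[h ?]|[n _ [Ej [nE ?]]]]; last by rewrite (h1 n).
  split; first exact: h.
  by rewrite h3// => n; exact: h.
- exists (\bigcap_n E n); split.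
  + exact: bigcapT_measurable.
  + apply/eqP; rewrite eq_le measure_ge0 andbT.
    have cv : (2 * C * 2^-1 ^+ n)%:E @[n --> \oo] --> 0%:E.
      by apply: cvg_EFin; [exact: nearW|exact: half_exp_cvg].
    rewrite -[leRHS]/(0%:E) -(cvg_lim _ cv)//.
    apply: lime_ge; first by apply/cvg_ex; eexists; exact: cv.
    apply: nearW => n; apply: le_trans (muE n); apply: le_measure; rewrite ?inE.
    * exact: bigcapT_measurable.
    * exact: mE.
    * by move=> t; apply.
  + move=> t /= h n _; apply: contrapT => nE; apply: h.
    have [h1 _] := hv t; exists n => j nj.
    by rewrite (Econst n j)// (h1 n).
Qed.

End ControlMetric.

(** * Dependence of states and costs on the control *)

Section Stability.
Context {R : realType} {m k : nat}.
Notation X := 'rV[R]_m.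
Notation Uc := 'rV[R]_k.
Variables (f : R -> X -> Uc -> X) (g : R -> X -> Uc -> R) (beta : nat -> R -> R).
Hypothesis rd : regular_data f g beta.

Lemma li_indic (h : R -> R) (D : set R) : measurable D -> li h -> li (fun t => h t * \1_D t).
Proof.
move=> mD lh; apply: li_mul_bounded => // T.
by exists 1 => t _; rewrite indicE; case: (_ \in _); rewrite ?normr1 ?normr0.
Qed.

Lemma prim_indic_ge0 (h : R -> R) (D : set R) T : measurable D -> li h -> (forall t, 0 <= h t) ->
  0 <= T -> 0 <= prim (fun t => h t * \1_D t) T.
Proof.
by move=> mD lh h0 T0; apply: prim_ge0 => //; [exact: li_indic|move=> t; rewrite mulr_ge0].
Qed.

(** Where the controls agree the Lipschitz rate applies; on [D] the two velocities are bounded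
    separately, each by [beta n], whence the factor 2. *)
Lemma sol_stability (v w : R -> Uc) (x y : R -> X) n T (D : set R) :
  sol (fun t z => f t z (v t)) x -> sol (fun t z => f t z (w t)) y ->
  measurable D -> (forall t, 0 <= t <= T -> differ v w t -> D t) ->
  (forall t, 0 <= t <= T -> [/\ `|x t| <= n%:R, `|y t| <= n%:R, `|v t| <= n%:R & `|w t| <= n%:R]) ->
  forall s t, 0 <= s <= T -> 0 <= t <= T ->
    `|x t - y t| <= (`|x s - y s| + 2 * prim (fun t => beta n t * \1_D t) T) * expR (prim (beta n) T).
Proof.
move=> [_ lx xE] [_ ly yE] mD hD hn s t hs ht.
have lb := li_beta rd n.
have lbD := li_indic mD lb.
have H := @ode_gronwall _ _ x y _ _ (beta n) (fun t => 2 * (beta n t * \1_D t)) T lx ly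
  (fun t _ => xE t) (fun t _ => yE t) lb (beta_ge0 rd n) (liZ 2 lbD).
rewrite primZ// in H; apply: H => //.
  by move=> r; rewrite mulr_ge0// mulr_ge0// (beta_ge0 rd).
move=> r hr; have [h1 h2 h3 h4] := hn r hr.
have b0 := beta_ge0 rd n r.
have [Dr|nDr] := pselect (D r).
  rewrite indicE mem_set// mulr1.
  have i1 := bound_f rd r h1 h3; have i2 := bound_f rd r h2 h4.
  apply: le_trans (ler_normB _ _) _.
  have : 0 <= beta n r * `|x r - y r| by rewrite mulr_ge0.
  lra.
have -> : w r = v r by apply: contrapT => e; apply: nDr; apply: hD => // e'; apply: e.
rewrite indicE memNset// mulr0 mulr0 addr0; exact: (lip_f rd).
Qed.

Definition cost (v : R -> Uc) (x : R -> X) T := prim (fun t => g t (x t) (v t)) T.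

Lemma li_running_cost (v : R -> Uc) (x : R -> X) : vmeas v -> locally_bounded v ->
  vmeas x -> locally_bounded x -> li (fun t => g t (x t) (v t)).
Proof.
move=> mv bv mx bx; have [q [hq lq]] := locally_bounded_rate bx bv (li_beta rd).
apply: li_le lq _; first exact: measurable_g rd _ _ mx mv.
by move=> t; apply: (bound_g rd); case: (hq t).
Qed.

Lemma cost_stability (v w : R -> Uc) (x y : R -> X) n T (D : set R) K :
  0 <= T -> li (fun t => g t (x t) (v t)) -> li (fun t => g t (y t) (w t)) ->
  measurable D -> (forall t, 0 <= t <= T -> differ v w t -> D t) ->
  (forall t, 0 <= t <= T -> [/\ `|x t| <= n%:R, `|y t| <= n%:R, `|v t| <= n%:R & `|w t| <= n%:R]) ->
  (forall t, 0 <= t <= T -> `|x t - y t| <= K) ->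
  `|cost v x T - cost w y T| <= K * prim (beta n) T + 2 * prim (fun t => beta n t * \1_D t) T.
Proof.
move=> T0 lx ly mD hD hn hK.
have lb := li_beta rd n.
have lbD := li_indic mD lb.
rewrite /cost -primB// -!primZ// -primD; [|exact: liZ|exact: liZ].
have := @prim_dist _ (fun s => g s (x s) (v s) - g s (y s) (w s))
  (fun s => K * beta n s + 2 * (beta n s * \1_D s)) 0 T (liB lx ly)
  (liD (liZ K lb) (liZ 2 lbD)) (lexx 0) T0.
rewrite !prim0 !subr0; apply => r /andP[/ltW r0 rT].
have hr : 0 <= r <= T by rewrite r0.
have [h1 h2 h3 h4] := hn r hr; have b0 := beta_ge0 rd n r.
have hKr := hK r hr; have K0 := le_trans (normr_ge0 _) hKr.
have [Dr|nDr] := pselect (D r).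
  rewrite indicE mem_set// mulr1.
  have i1 := bound_g rd r h1 h3; have i2 := bound_g rd r h2 h4.
  apply: le_trans (ler_normB _ _) _.
  have : 0 <= K * beta n r by rewrite mulr_ge0.
  lra.
have -> : w r = v r by apply: contrapT => e; apply: nDr; apply: hD => // e'; apply: e.
rewrite indicE memNset// mulr0 mulr0 addr0 mulrC.
by apply: le_trans (lip_g rd _ h1 h2 h3) _; rewrite ler_wpM2l.
Qed.

End Stability.

Section Processes.
Context {R : realType} {m k : nat}.
Notation mu := (@lebesgue_measure R).
Notation X := 'rV[R]_m.
Notation Uc := 'rV[R]_k.
Variables (f : R -> X -> Uc -> X) (g : R -> X -> Uc -> R) (beta : nat -> R -> R).
Hypothesis rd : regular_data f g beta.
Variables (U : R -> set Uc) (x_init : X) (u0 : R -> Uc).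
Hypotheses (bu0 : borel_control u0) (lbu0 : locally_bounded u0)
  (Uu0 : forall t, 0 <= t -> U t (u0 t)).
Variables (S : R) (rho : nat).
Hypotheses (S0 : 0 <= S) (u0rho : forall t, 0 <= t <= S -> `|u0 t| <= rho%:R).

Definition admissible_process (v : R -> Uc) (x : R -> X) :=
  [/\ [/\ borel_control v, forall t, 0 <= t -> U t (v t),
      forall t, ~ (0 <= t <= S) -> v t = u0 t & forall t, 0 <= t <= S -> `|v t| <= rho%:R],
      sol (fun t z => f t z (v t)) x & x 0 = x_init].

Lemma process_control_bounded T : exists N : nat, (rho <= N)%N /\
  forall v x, admissible_process v x -> forall t, t <= T -> `|v t| <= N%:R.
Proof.
have [N hN] := lbu0 T; exists (maxn rho N); split; first exact: leq_maxl.
move=> v x [[_ _ v1 v2] _ _] t tT.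
have [h|h] := pselect (0 <= t <= S); last first.
  by rewrite v1// (le_trans (hN t tT))// ler_nat leq_maxr.
by rewrite (le_trans (v2 t h))// ler_nat leq_maxl.
Qed.

Lemma process_locally_bounded v x : admissible_process v x -> locally_bounded v.
Proof.
by move=> pv T; have [N [_ hN]] := process_control_bounded T; exists N => t; exact: hN pv t.
Qed.

(** The common bound on the controls gives a common growth rate, hence one ball containing all
    competing states up to time [T]. *)
Lemma process_bounded T : 0 <= T -> exists N : nat, (rho <= N)%N /\
  forall v x, admissible_process v x -> forall t, 0 <= t <= T ->
    `|x t| <= N%:R /\ `|v t| <= N%:R.
Proof.
move=> T0; have [N [rN hN]] := process_control_bounded T.
pose B := `|x_init| + (1 + `|x_init|) * prim (beta N) T * expR (prim (beta N) T).
exists (maxn N (Num.truncn B).+1); split; first exact: leq_trans (leq_maxl _ _).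
move=> v x pv t ht; have [_ sx x0] := pv; split.
  apply: (@le_trans _ _ B); last first.
    by rewrite (le_trans (ltW (truncnS_gt B)))// ler_nat leq_maxr.
  rewrite /B -x0; apply: (sol_growth sx (li_beta rd N) (beta_ge0 rd N)) => //.
    by move=> s /andP[_ sT]; apply: (growth_f rd); exact: hN pv _ sT.
  by rewrite lexx.
have /andP[_ tT] := ht.
by rewrite (le_trans (hN v x pv t tT))// ler_nat leq_maxl.
Qed.

Lemma differ_process v x w y : admissible_process v x -> admissible_process w y ->
  differ v w `<=` `[0, S]%classic.
Proof.
move=> [[_ _ h1 _] _ _] [[_ _ h2 _] _ _] t; rewrite /differ/= in_itv/= => vw.
by apply: contrapT => h; apply: vw; rewrite h1// h2.
Qed.

Lemma measurable_differ_process v x w y : admissible_process v x -> admissible_process w y ->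
  measurable (differ v w).
Proof.
by move=> [[h1 _ _ _] _ _] [[h2 _ _ _] _ _]; apply: measurable_differ; exact: borel_control_vmeas.
Qed.

Lemma differ_process_fin v x w y : admissible_process v x -> admissible_process w y ->
  mu (differ v w) \is a fin_num.
Proof.
move=> pv pw; rewrite ge0_fin_numE//.
apply: (@le_lt_trans _ _ (mu `[0, S]%classic)).
  apply: le_measure; rewrite ?inE//; first exact: measurable_differ_process pv pw.
  exact: differ_process pv pw.
by rewrite lebesgue_measure_itv/=; case: ifP => _; rewrite ?ltry// -EFinB ltry.
Qed.

Lemma exists_process v : borel_control v -> (forall t, 0 <= t -> U t (v t)) ->
  (forall t, ~ (0 <= t <= S) -> v t = u0 t) -> (forall t, 0 <= t <= S -> `|v t| <= rho%:R) ->
  exists x, admissible_process v x.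
Proof.
move=> bv h1 h2 h3.
have lv : locally_bounded v.
  move=> T; have [N hN] := lbu0 T; exists (maxn rho N) => t tT.
  have [h|h] := pselect (0 <= t <= S); last first.
    by rewrite h2// (le_trans (hN t tT))// ler_nat leq_maxr.
  by rewrite (le_trans (h3 t h))// ler_nat leq_maxl.
have [x [sx x0]] := trajectory_exists rd x_init (borel_control_vmeas bv) lv (lexx 0).
by exists x.
Qed.

Lemma process_li_cost v x : admissible_process v x -> li (fun t => g t (x t) (v t)).
Proof.
move=> pv; have [[bv _ _ _] sx _] := pv.
apply: (li_running_cost rd); first exact: borel_control_vmeas.
- exact: process_locally_bounded pv.
- by case: sx.
- exact: sol_bounded sx.
Qed.

Lemma process_cost_continuous T e : 0 <= T -> 0 < e -> exists2 d, 0 < d &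
  forall v x w y, admissible_process v x -> admissible_process w y ->
    (mu (differ v w) < d%:E)%E -> `|cost g v x T - cost g w y T| < e.
Proof.
move=> T0 e0; have [N [_ hN]] := process_bounded T0.
pose Lam := prim (beta N) T.
have Lam0 : 0 <= Lam by apply: prim_ge0 => //; [exact: (li_beta rd)|exact: (beta_ge0 rd)].
(* With [I] the integral of [beta N] over the set where the controls differ, states deviate by at
   most [2 * I * expR Lam]; this costs [Lam] times as much, and the running costs on that set add
   [2 * I]. *)
pose C := 2 * expR Lam * Lam + 2.
have C0 : 0 < C by rewrite /C; have := expR_ge0 Lam; nra.
have [d d0 hd] := prim_small T (li_beta rd N) (divr_gt0 e0 C0).
exists d => // v x w y pv pw vw.
have mD := measurable_differ_process pv pw.
have := hd _ mD vw.
have -> : (fun t => `|beta N t| * \1_(differ v w) t) = (fun t => beta N t * \1_(differ v w) t).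
  by apply/funext => t; rewrite ger0_norm// (beta_ge0 rd).
set I := prim _ T => hI.
have hn t : 0 <= t <= T -> [/\ `|x t| <= N%:R, `|y t| <= N%:R, `|v t| <= N%:R & `|w t| <= N%:R].
  by move=> ht; have [? ?] := hN _ _ pv t ht; have [? ?] := hN _ _ pw t ht.
have [_ sx x0] := pv; have [_ sy y0] := pw.
have T00 : 0 <= (0 : R) <= T by rewrite lexx.
have hK t : 0 <= t <= T -> `|x t - y t| <= 2 * I * expR Lam.
  move=> ht; have := sol_stability rd sx sy mD (fun _ _ h => h) hn T00 ht.
  by rewrite x0 y0 subrr normr0 add0r.
have := cost_stability rd T0 (process_li_cost pv) (process_li_cost pw) mD (fun _ _ h => h) hn hK.
move=> /le_lt_trans; apply.
rewrite -/Lam -/I.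
have -> : 2 * I * expR Lam * Lam + 2 * I = I * C by rewrite /C; ring.
by rewrite -ltr_pdivlMr.
Qed.

Lemma process_ekeland T x0 gamma : 0 <= T -> 0 < gamma -> admissible_process u0 x0 ->
  (forall v x, admissible_process v x -> cost g v x T <= cost g u0 x0 T + gamma ^+ 2) ->
  exists v x, [/\ admissible_process v x, (mu (differ u0 v) <= gamma%:E)%E &
    forall w y, admissible_process w y ->
      cost g w y T <= cost g v x T + gamma * fine (mu (differ v w))].
Proof.
move=> T0 g0 p0 hJ.
pose P := {vx : (R -> Uc) * (R -> X) | admissible_process vx.1 vx.2}.
pose J (p : P) := cost g (sval p).1 (sval p).2 T.
pose d (p q : P) := fine (mu (differ (sval p).1 (sval q).1)).
have dfin (p q : P) : mu (differ (sval p).1 (sval q).1) \is a fin_num.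
  by apply: differ_process_fin (svalP p) (svalP q).
have d0 p : d p p = 0.
  rewrite /d (_ : differ _ _ = set0) ?measure0//.
  by apply/seteqP; split => t //; apply.
have dge p q : 0 <= d p q by rewrite /d fine_ge0.
have mdf (p q : P) : measurable (differ (sval p).1 (sval q).1).
  exact: measurable_differ_process (svalP p) (svalP q).
have dtri p q r : d p r <= d p q + d q r.
  rewrite /d -fineD// fine_le// ?fin_numD ?dfin//.
  apply: le_trans (measureU2 mu (mdf p q) (mdf q r)).
  apply: le_measure; [by rewrite inE; exact: mdf| |exact: differ_triangle].
  by rewrite inE; apply: measurableU; exact: mdf.
have comp (p_ : nat -> P) C : (forall j, d (p_ j) (p_ j.+1) <= C * 2^-1 ^+ j) ->
    exists p, (forall j, d (p_ j) p <= 2 * C * 2^-1 ^+ j) /\ J (p_ j) @[j --> \oo] --> J p.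
  move=> hC.
  have bp j : borel_control (sval (p_ j)).1 by case: (svalP (p_ j)) => -[].
  have hC' j : (mu (differ (sval (p_ j)).1 (sval (p_ j.+1)).1) <= (C * 2^-1 ^+ j)%:E)%E.
    by rewrite -[leLHS]fineK// lee_fin; exact: hC.
  have [v [bv hv hmu _]] := control_limit bu0 bp hC'.
  have [|||x px] := exists_process bv.
  - move=> t t0; have [->|[j ->]] := hv t; first exact: Uu0.
    by case: (svalP (p_ j)) => -[_ h _ _] _ _; exact: h.
  - move=> t t0; have [->//|[j ->]] := hv t.
    by case: (svalP (p_ j)) => -[_ _ h _] _ _; exact: h.
  - move=> t t0; have [->|[j ->]] := hv t; first exact: u0rho.
    by case: (svalP (p_ j)) => -[_ _ _ h] _ _; exact: h.
  exists (exist _ (v, x) px); split.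
    by move=> j; rewrite -lee_fin /d fineK//; exact: hmu.
  apply/cvgrPdist_lt => e e0.
  have [de de0 hde] := process_cost_continuous T0 e0.
  have /cvgrPdist_lt/(_ de de0) := half_exp_cvg (2 * C).
  apply: filterS => j; rewrite sub0r normrN => /(le_lt_trans (ler_norm _)) hj.
  apply: (hde _ _ _ _ px (svalP (p_ j))); rewrite differ_sym.
  by apply: le_lt_trans (hmu j) _; rewrite lte_fin.
have [p [h1 h2]] := ekeland d0 dge dtri comp g0
  (fun p => hJ _ _ (svalP p)) (p0 := exist _ (u0, x0) p0).
exists (sval p).1, (sval p).2; split; first exact: (svalP p).
  by rewrite -[leLHS]fineK ?lee_fin//; exact: (dfin (exist _ (u0, x0) p0) p).
by move=> w y pw; exact: (h2 (exist _ (w, y) pw)).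
Qed.

End Processes.

(** * Needle variations *)

Section SmallSubset.
Context {R : realType}.
Notation mu := (@lebesgue_measure R).

(** One of the countably many cells of length [d] meets [D] in positive measure. *)
Lemma small_positive_subset (D : set R) (a b d : R) : measurable D -> (0 < mu D)%E ->
  D `<=` `[a, b]%classic -> 0 < d -> exists2 D', D' `<=` D &
  [/\ measurable D', 0 < fine (mu D') & fine (mu D') <= d].
Proof.
move=> mD D0 Dab d0.
pose I i := `[a + i%:R * d, a + i.+1%:R * d[%classic.
have muI i : mu (I i) = d%:E.
  rewrite [LHS]lebesgue_measure_itv/= lte_fin ltrD2l ltr_pM2r// ltr_nat ltnSn -EFinB.
  by congr EFin; rewrite -natr1; ring.
have mI i : measurable (D `&` I i) by apply: measurableI => //; exact: measurable_itv.
have [[i Di0]|n0] := pselect (exists i, (0 < mu (D `&` I i))%E).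
  exists (D `&` I i); first exact: subIsetl.
  have le : (mu (D `&` I i) <= d%:E)%E.
    rewrite -(muI i); apply: le_measure; rewrite ?inE.
    - exact: mI.
    - exact: measurable_itv.
    - exact: subIsetr.
  have fi : mu (D `&` I i) \is a fin_num by rewrite ge0_fin_numE// (le_lt_trans le) ?ltry.
  by split => //; rewrite -?lte_fin -?lee_fin fineK.
exfalso; suff : mu D = 0 by move=> h; rewrite h ltxx in D0.
have DU : D = \bigcup_i (D `&` I i).
  apply/seteqP; split => [t Dt|t [i _ []]]//.
  exists (Num.truncn ((t - a) / d)) => //; split => //; rewrite /I/= in_itv/=.
  have := Dab t Dt; rewrite /= in_itv/= => /andP[at_ tb].
  have := @truncn_itv _ ((t - a) / d); rewrite divr_ge0 ?subr_ge0 ?(ltW d0)// => /(_ isT)/andP[h1 h2].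
  rewrite ler_pdivlMr// in h1; rewrite ltr_pdivrMr// in h2; lra.
apply/negligibleP => //; rewrite DU; apply: negligible_bigcup => i.
have [_] := @negligibleP _ _ _ mu _ (mI i); apply.
apply/eqP; rewrite eq_le measure_ge0 andbT leNgt.
by apply/negP => h; apply: n0; exists i.
Qed.

End SmallSubset.

Section ApproximateMaximumPrinciple.
Context {R : realType} {m k : nat}.
Notation mu := (@lebesgue_measure R).
Notation X := 'rV[R]_m.
Notation Uc := 'rV[R]_k.
Variables (f : R -> X -> Uc -> X) (g : R -> X -> Uc -> R) (beta : nat -> R -> R).
Hypothesis rd : regular_data f g beta.
Notation ham := (hamiltonian f g).
Notation dham := (dhamiltonian f g).
Variables (U : R -> set Uc) (x_init : X) (u0 : R -> Uc).
Hypotheses (bu0 : borel_control u0) (lbu0 : locally_bounded u0)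
  (Uu0 : forall t, 0 <= t -> U t (u0 t)).
Variables (S : R) (rho : nat).
Hypotheses (S0 : 0 <= S) (u0rho : forall t, 0 <= t <= S -> `|u0 t| <= rho%:R).
Notation process := (admissible_process f U x_init u0 S rho).

(** The pairing of [psi] with [y - x] vanishes at both ends, the state difference at 0 and the
    costate at [T]; adding the zero integral of its derivative to the difference of the running
    costs turns them into Hamiltonians. *)
Lemma cost_increment v x w y psi T : process v x -> process w y ->
  sol (fun t p => - dham (x t) t (v t) 1 p) psi -> psi T = 0 -> 0 <= T ->
  li (fun t => ham (y t) t (w t) 1 (psi t) - ham (x t) t (v t) 1 (psi t) -
     dot (dham (x t) t (v t) 1 (psi t)) (y t - x t)) /\
  cost g w y T - cost g v x T =
  prim (fun t => ham (y t) t (w t) 1 (psi t) - ham (x t) t (v t) 1 (psi t) -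
     dot (dham (x t) t (v t) 1 (psi t)) (y t - x t)) T.
Proof.
move=> pv pw spsi psiT T0.
have [[bv _ _ _] [mx lx xE] x0] := pv; have [[bw _ _ _] [my ly yE] y0] := pw.
have [mpsi lpsi psiE] := spsi.
pose F t := f t (y t) (w t) - f t (x t) (v t).
have lF : vli F by exact: vliB.
have eE t : y t - x t = (y 0 - x 0) + vprim F t.
  by rewrite yE xE /F vprimB// opprD addrACA.
have [ld hd] := dot_product_rule lpsi lF psiE (q := fun t => y t - x t) eE.
have lgx := process_li_cost rd lbu0 pv; have lgy := process_li_cost rd lbu0 pw.
have lG := liB lgy lgx.
have E : (fun t => ham (y t) t (w t) 1 (psi t) - ham (x t) t (v t) 1 (psi t) -
     dot (dham (x t) t (v t) 1 (psi t)) (y t - x t)) =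
  (fun t => (dot (- dham (x t) t (v t) 1 (psi t)) (y t - x t) + dot (psi t) (F t)) +
     (g t (y t) (w t) - g t (x t) (v t))).
  by apply/funext => t; rewrite !hamE dotNl /F (@dotBr _ _ _ _ (psi t)) !mul1r; ring.
rewrite E; split; first exact: liD.
rewrite primD// /cost -primB//.
have := hd T T0; rewrite psiT dot0l x0 y0 subrr dot0r add0r => <-.
by rewrite add0r.
Qed.

(** The gain is linear in the measure of the needle and the loss quadratic, with [C] fixed before
    [w] and [D]. Keeping [D] where [beta n] is at most [c] is what makes the integral of [beta n]
    over [D] of the order of its measure. *)
Lemma needle_variation v x psi n T c : process v x -> 0 <= T -> S <= T -> 0 <= c -> (rho <= n)%N ->
  (forall w y, process w y -> forall t, 0 <= t <= T -> `|y t| <= n%:R /\ `|w t| <= n%:R) ->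
  sol (fun t p => - dham (x t) t (v t) 1 p) psi -> psi T = 0 ->
  exists C, 0 <= C /\ forall w y D kap, process w y -> measurable D -> D `<=` `[0, S]%classic ->
    differ v w `<=` D -> (forall t, D t -> beta n t <= c) ->
    (forall t, D t -> kap <= ham (x t) t (w t) 1 (psi t) - ham (x t) t (v t) 1 (psi t)) ->
    kap * fine (mu D) - C * fine (mu D) ^+ 2 <= cost g w y T - cost g v x T.
Proof.
move=> pv T0 ST c0 rn hn spsi psiT.
have [N hN] := sol_bounded spsi T.
pose W := m%:R * N%:R + 1 : R.
have W0 : 0 <= W by rewrite /W addr_ge0// mulr_ge0.
have lb := li_beta rd n; have b0 := beta_ge0 rd n.
pose Lam := prim (beta n) T.
have Lam0 : 0 <= Lam by exact: prim_ge0.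
pose A := 2 * c * expR Lam.
have A0 : 0 <= A by rewrite !mulr_ge0// expR_ge0.
(* For a needle of measure [M] the states deviate by at most [A * M]. Off [D] the Taylor remainder
   is quadratic in this and integrates to the first term. On [D] the error is only linear in it, but
   [beta n] integrates to at most [c * M] there, which gives the second. *)
exists (m%:R * W * A ^+ 2 * Lam + (1 + m%:R) * W * A * c); split.
  by rewrite addr_ge0// !mulr_ge0// ?exprn_ge0// addr_ge0.
move=> w y D kap pw mD DS vwD Dc Dkap.
have [lI ->] := cost_increment pv pw spsi psiT T0.
have muS : (mu (`[0%R, S]%classic : set R) < +oo)%E.
  by rewrite lebesgue_measure_itv/=; case: ifP => _; rewrite ?ltry// -EFinB ltry.
have muD : mu D \is a fin_num.
  rewrite ge0_fin_numE//; apply: le_lt_trans muS.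
  by apply: le_measure; rewrite ?inE//; exact: measurable_itv.
set M := fine (mu D); have M0 : 0 <= M by rewrite fine_ge0.
have DT : D `<=` `[0, T]%classic.
  by move=> t /DS; rewrite /= !in_itv/= => /andP[-> h]; exact: le_trans ST.
have l1 : li (fun t : R => \1_D t : R).
  have := li_indic mD (li_cst (1 : R)); congr li.
  by apply/funext => t; rewrite mul1r.
have primD1 : prim (fun t : R => \1_D t : R) T = M.
  rewrite /prim /Rintegral /M; congr fine.
  by rewrite integral_indic//; congr mu; rewrite setIidl.
have lbD := li_indic mD lb.
have primbD : prim (fun t => beta n t * \1_D t) T <= c * M.
  rewrite -primD1 -primZ//.
  have := @prim_le _ (fun t => beta n t * \1_D t) (fun t => c * \1_D t) 0 T lbD (liZ c l1) (lexx 0) T0.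
  rewrite !prim0 !subr0; apply => t _; rewrite indicE.
  by have [/set_mem/Dc h|_] := boolP (t \in D); rewrite ?mulr1 ?mulr0.
have prbD0 : 0 <= prim (fun t => beta n t * \1_D t) T by exact: prim_indic_ge0.
have hn4 t : 0 <= t <= T -> [/\ `|y t| <= n%:R, `|x t| <= n%:R, `|w t| <= n%:R & `|v t| <= n%:R].
  by move=> ht; have [? ?] := hn _ _ pv t ht; have [? ?] := hn _ _ pw t ht.
have [_ sx x0] := pv; have [_ sy y0] := pw.
have T00 : 0 <= (0 : R) <= T by rewrite lexx.
pose E := A * M.
have E0 : 0 <= E by rewrite mulr_ge0.
have hE t : 0 <= t <= T -> `|y t - x t| <= E.
  move=> ht; have := sol_stability rd sy sx mD _ hn4 T00 ht.
  rewrite x0 y0 subrr normr0 add0r => /(_ _)/wrap[].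
    by move=> r _; rewrite differ_sym; exact: vwD.
  move=> /le_trans; apply; rewrite -/Lam /E /A.
  have := expR_ge0 Lam; set z := expR Lam; set p := prim _ _ in primbD prbD0 *; nra.
have lr : li (fun t => kap * \1_D t - (m%:R * W * E ^+ 2 * beta n t + (1 + m%:R) * W * E * (beta n t * \1_D t))).
  by apply: liB; [exact: liZ|apply: liD; exact: liZ].
have key t : 0 < t <= T ->
  kap * \1_D t - (m%:R * W * E ^+ 2 * beta n t + (1 + m%:R) * W * E * (beta n t * \1_D t)) <=
  ham (y t) t (w t) 1 (psi t) - ham (x t) t (v t) 1 (psi t) -
     dot (dham (x t) t (v t) 1 (psi t)) (y t - x t).
  move=> /andP[/ltW t0 tT]; have ht : 0 <= t <= T by rewrite t0.
  have [hy hx hw hv] := hn4 t ht.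
  have weight_le : m%:R * `|psi t| + `|1| <= W.
    by rewrite normr1 /W lerD2r ler_wpM2l// hN.
  have bt := b0 t; have Et := hE t ht; have e0 := normr_ge0 (y t - x t).
  have Wb : (m%:R * `|psi t| + `|1|) * beta n t <= W * beta n t by rewrite ler_wpM2r.
  have m0 : (0 : R) <= m%:R by [].
  have Wb0 : 0 <= W * beta n t by rewrite mulr_ge0.
  have [Dt|nDt] := pselect (D t).
    rewrite indicE mem_set// !mulr1.
    have h1 := Dkap t Dt.
    have h2 := ham_lip rd t 1 (psi t) hy hx hw.
    have h3 := le_trans (dot_le (dham (x t) t (v t) 1 (psi t)) (y t - x t)) (lexx _).
    have h4 := dham_le rd t 1 (psi t) hx hv.
    have h5 : `|ham (y t) t (w t) 1 (psi t) - ham (x t) t (w t) 1 (psi t)| <= W * beta n t * E.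
      by apply: le_trans h2 _; apply: ler_pM => //; rewrite mulr_ge0// addr_ge0// mulr_ge0.
    have h6 : `|dot (dham (x t) t (v t) 1 (psi t)) (y t - x t)| <= m%:R * (W * beta n t * E).
      apply: le_trans h3 _; rewrite ler_wpM2l//; apply: ler_pM => //.
      exact: le_trans h4 Wb.
    move: h5 h6; rewrite !ler_norml => /andP[h5 _] /andP[_ h6].
    have : 0 <= m%:R * W * E ^+ 2 * beta n t by rewrite !mulr_ge0// exprn_ge0.
    have -> : (1 + m%:R) * W * E * beta n t = W * beta n t * E + m%:R * (W * beta n t * E) by ring.
    lra.
  rewrite indicE memNset// !mulr0 addr0 sub0r.
  have -> : w t = v t by apply: contrapT => h; apply: nDt; apply: vwD => h'; apply: h.
  have := ham_taylor rd t 1 (psi t) hx hy hv; rewrite ler_norml => /andP[h _].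
  apply: le_trans h; rewrite lerN2.
  have : `|y t - x t| ^+ 2 <= E ^+ 2 by rewrite lerXn2r// nnegrE.
  have q0 : 0 <= `|y t - x t| ^+ 2 by rewrite exprn_ge0.
  move=> h; apply: (@le_trans _ _ (m%:R * (W * beta n t) * E ^+ 2)).
    apply: ler_pM => //; last by rewrite ler_wpM2l.
    by rewrite mulr_ge0// mulr_ge0// addr_ge0// mulr_ge0.
  by rewrite le_eqVlt; apply/orP; left; apply/eqP; ring.
have := @prim_le _ _ _ 0 T lr lI (lexx 0) T0 key.
rewrite !prim0 !subr0; apply: le_trans.
rewrite primB; [|exact: liZ|by apply: liD; exact: liZ].
rewrite primD; [|exact: liZ|exact: liZ].
rewrite !primZ// primD1 -/Lam.
have h0 : 0 <= (1 + m%:R) * W * E by rewrite !mulr_ge0// addr_ge0.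
have h1 : (1 + m%:R) * W * E * prim (fun t => beta n t * \1_D t) T <= (1 + m%:R) * W * E * (c * M).
  by rewrite ler_wpM2l.
have -> : (m%:R * W * A ^+ 2 * Lam + (1 + m%:R) * W * A * c) * M ^+ 2 =
  m%:R * W * E ^+ 2 * Lam + (1 + m%:R) * W * E * (c * M) by rewrite /E; ring.
lra.
Qed.

Lemma measurable_ham d (O : measurableType d) (tau : O -> R) (xi psi : O -> X) (w : O -> Uc) lam :
  measurable_fun setT tau -> (forall i, measurable_fun setT (fun z => xi z ord0 i)) ->
  (forall i, measurable_fun setT (fun z => w z ord0 i)) ->
  (forall i, measurable_fun setT (fun z => psi z ord0 i)) ->
  measurable_fun setT (fun z => ham (xi z) (tau z) (w z) lam (psi z)).
Proof.
move=> mt mx mw mp; under eq_fun do rewrite hamE dotE.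
apply: measurable_funD; last first.
  apply: measurable_funM => //.
  by apply: (@measurable_caratheodory_comp _ _ _ _ _ g tau) => //;
    [exact: (meas_g rd)|exact: (cont_g rd)].
apply: measurable_sum => j; apply: measurable_funM; first exact: mp.
apply: (@measurable_caratheodory_comp _ _ _ _ _ (fun t x u => f t x u ord0 j) tau) => //.
  by move=> y z; exact: (meas_f rd).
by move=> t z; apply: (@rV_coord_cvg _ _ _ _ (fun z => f t z.1 z.2)); exact: (cont_f rd).
Qed.

Hypothesis borelU : borel_graph U.

(** If the maximum condition failed, some [bad i] would have a non-negligible projection and a
    needle along a selection of it, of measure [M], would gain at least
    [(gamma + 1 / (i + 1)) * M - C * M ^ 2], whereas Ekeland's principle allows at most
    [gamma * M]. *)
Lemma approximate_maximum_principle T x0 gamma : S <= T -> 0 < gamma -> process u0 x0 ->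
  (forall v x, process v x -> cost g v x T <= cost g u0 x0 T + gamma ^+ 2) ->
  exists v x psi, [/\ process v x, (mu (differ u0 v) <= gamma%:E)%E,
    sol (fun t p => - dham (x t) t (v t) 1 p) psi /\ psi T = 0 &
    {ae mu, forall t, 0 <= t <= S -> forall p, U t p -> `|p| <= rho%:R ->
       ham (x t) t p 1 (psi t) <= ham (x t) t (v t) 1 (psi t) + gamma}].
Proof.
move=> ST g0 p0 hJ; have T0 : 0 <= T by exact: le_trans ST.
have [v [x [pv muv hv]]] := process_ekeland rd bu0 lbu0 Uu0 u0rho T0 g0 p0 hJ.
have [[bv Uv v_off v_rho] sx x0i] := pv.
have mv := borel_control_vmeas bv; have lbv := process_locally_bounded lbu0 pv.
have [mx lx xE] := sx; have lbx := sol_bounded sx.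
have [psi [spsi psiT]] := adjoint_exists rd 1 0 mx lbx mv lbv T0.
exists v, x, psi; split => //.
have [mpsi _ _] := spsi.
have [n [rn hn]] := process_bounded rd U x_init lbu0 S rho T0.
pose Z := (R * 'rV[R]_k)%type.
(* The index serves twice: it bounds the rate, as the needle variation requires, and it makes the
   excess over [gamma] uniform. *)
pose bad (i : nat) := [set z : Z | [/\ 0 <= z.1 /\ U z.1 z.2, z.1 <= S, `|z.2| <= rho%:R,
  beta n z.1 <= i%:R & ham (x z.1) z.1 (v z.1) 1 (psi z.1) + (gamma + i.+1%:R^-1) <=
     ham (x z.1) z.1 z.2 1 (psi z.1)]].
suff nbad i : mu.-negligible (fst @` bad i).
  apply: negligibleS (negligible_bigcup nbad) => t /= ht; apply: contrapT => nt; apply: ht.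
  move=> /andP[t0 tS] p Up pr; rewrite leNgt; apply/negP => h; apply: nt.
  pose e := ham (x t) t p 1 (psi t) - (ham (x t) t (v t) 1 (psi t) + gamma).
  have e0 : 0 < e by rewrite subr_gt0.
  pose i := maxn (Num.truncn (beta n t)).+1 (Num.truncn e^-1).+1.
  exists i => //; exists (t, p) => //; split => //=.
    by rewrite (le_trans (ltW (truncnS_gt _)))// ler_nat leq_maxl.
  have : i.+1%:R^-1 <= e.
    rewrite -[leRHS]invrK lef_pV2 ?posrE ?invr_gt0//.
    by rewrite (le_trans (ltW (truncnS_gt _)))// ler_nat ltnW// ltnS leq_maxr.
  rewrite -[X in _ -> X <= _]/(ham (x t) t (v t) 1 (psi t) + (gamma + i.+1%:R^-1)).
  rewrite -[X in _ -> _ <= X]/(ham (x t) t p 1 (psi t)) /e.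
  by set a := hamiltonian _ _ _ _ _ _ _; set b := hamiltonian _ _ _ _ _ _ _; set c := i.+1%:R^-1; lra.
have bbad : <<s @open Z >> (bad i).
  pose borelZ := g_sigma_algebraType (@open Z).
  have mc (h : Z -> R) : continuous h -> measurable_fun setT (h : borelZ -> R).
    move=> ch; apply: (measurability _ (RGenOpens.measurableE R)).
    move=> _ [_ [a [b ->] <-]]; rewrite setTI; apply: sub_sigma_algebra.
    by apply: open_comp; [move=> z _; exact: ch|exact: interval_open].
  have mfst : measurable_fun setT (fst : borelZ -> R) by apply: mc => z; exact: cvg_fst.
  have msnd j : measurable_fun setT (fun z : borelZ => z.2 ord0 j).
    apply: mc => z.
    apply: (@cvg_comp _ _ _ snd (fun v : 'rV[R]_k => v ord0 j) (nbhs z) (nbhs z.2)).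
      exact: cvg_snd.
    exact: coord_continuous.
  have mcomp p (q : R -> 'rV[R]_p) j : vmeas q -> measurable_fun setT (fun z : borelZ => q z.1 ord0 j).
    by move=> mq; exact: (measurableT_comp (mq j) mfst).
  have mh1 : measurable_fun setT (fun z : borelZ => ham (x z.1) z.1 z.2 1 (psi z.1)).
    by apply: (@measurable_ham _ borelZ fst (fun z => x z.1) (fun z => psi z.1) snd 1) => // j; exact: mcomp.
  have mh2 : measurable_fun setT (fun z : borelZ => ham (x z.1) z.1 (v z.1) 1 (psi z.1) + (gamma + i.+1%:R^-1)).
    have mh : measurable_fun setT (fun z : borelZ => ham (x z.1) z.1 (v z.1) 1 (psi z.1)).
      by apply: (@measurable_ham _ borelZ fst (fun z => x z.1) (fun z => psi z.1) (fun z => v z.1) 1) => // j;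
        exact: mcomp.
    exact: (measurable_funD mh (measurable_cst _)).
  have mnorm : measurable_fun setT (fun z : borelZ => `|z.2|).
    apply: mc => z; apply: (@cvg_comp _ _ _ snd (fun v : 'rV[R]_k => `|v|) (nbhs z) (nbhs z.2)).
      exact: cvg_snd.
    exact: norm_continuous.
  have mle (h1 h2 : borelZ -> R) : measurable_fun setT h1 -> measurable_fun setT h2 ->
      measurable [set z | h1 z <= h2 z].
    move=> m1 m2; have := measurable_fun_ler m1 m2.
    by move=> /(_ measurableT [set true]); rewrite setTI; apply.
  rewrite (_ : bad i = [set z | 0 <= z.1 /\ U z.1 z.2] `&` [set z | z.1 <= S] `&`
     [set z | `|z.2| <= rho%:R] `&` [set z | beta n z.1 <= i%:R] `&`
     [set z | ham (x z.1) z.1 (v z.1) 1 (psi z.1) + (gamma + i.+1%:R^-1) <=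
       ham (x z.1) z.1 z.2 1 (psi z.1)]); last first.
    by apply/seteqP; split => z; rewrite /bad/=; [case|move=> [[[[]]]]].
  apply: (@measurableI _ borelZ); last exact: (mle _ _ mh2 mh1).
  apply: (@measurableI _ borelZ); last first.
    apply: (mle (fun z => beta n z.1) (cst i%:R)) => //.
    by apply: (measurableT_comp _ mfst); case: (li_beta rd n).
  apply: (@measurableI _ borelZ); last exact: (mle _ (cst rho%:R) mnorm).
  apply: (@measurableI _ borelZ); last exact: (mle _ (cst S) mfst).
  exact: borelU.
apply: contrapT => nneg.
have [|D0 [w [mD0 D0pos hw bw]]] := measurable_selection (M := Num.max S rho%:R) bbad _ nneg.
  move=> z [[z0 _] zS zr _ _]; split; first by rewrite ger0_norm// le_max zS.
  by rewrite le_max zr orbT.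
have D0S : D0 `<=` `[0, S]%classic.
  by move=> t /hw [[t0 _] tS _ _ _]; rewrite /= in_itv/= t0.
have [C [C0 hC]] := needle_variation pv T0 ST (ler0n R i) rn hn spsi psiT.
(* For needles this small the quadratic loss takes at most half of the excess [1 / (i + 1)] per unit
   of measure. *)
have d0 : 0 < i.+1%:R^-1 / (C + 1) / 2 by rewrite !divr_gt0// ltr_wpDl.
have [D DD0 [mD Dpos Dd]] := small_positive_subset mD0 D0pos D0S d0.
pose w' t := if t \in D then w t else v t.
have w'D t : D t -> w' t = w t by move=> Dt; rewrite /w' mem_set.
have w'nD t : ~ D t -> w' t = v t by move=> Dt; rewrite /w' memNset.
have bw' : borel_control w'.
  move=> O oO; have -> : w' @^-1` O = (D `&` (D0 `&` w @^-1` O)) `|` (~` D `&` v @^-1` O).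
    apply/seteqP; split => t; rewrite /preimage/=.
      have [Dt|nDt] := pselect (D t); last by rewrite w'nD//; right.
      by rewrite w'D//; left; split => //; split => //; exact: DD0.
    by move=> [[Dt [_ ?]]|[nDt ?]]; [rewrite w'D|rewrite w'nD].
  apply: measurableU; first by apply: measurableI => //; exact: bw.
  by apply: measurableI; [exact: measurableC|exact: bv].
have [|||y py] := @exists_process _ _ _ _ _ _ rd U x_init _ lbu0 S rho w' bw'.
- move=> t t0; have [Dt|nDt] := pselect (D t); last by rewrite w'nD//; exact: Uv.
  by rewrite w'D//; have [[_ ?] _ _ _ _] := hw t (DD0 t Dt).
- move=> t ht; have [Dt|nDt] := pselect (D t); last by rewrite w'nD//; exact: v_off.
  by exfalso; apply: ht; have := D0S t (DD0 t Dt); rewrite /= in_itv.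
- move=> t ht; have [Dt|nDt] := pselect (D t); last by rewrite w'nD//; exact: v_rho.
  by rewrite w'D//; have [_ _ ? _ _] := hw t (DD0 t Dt).
have vwD : differ v w' `<=` D.
  by move=> t h; apply: contrapT => nDt; apply: h; rewrite w'nD.
have := hC w' y D (gamma + i.+1%:R^-1) py mD (subset_trans DD0 D0S) vwD.
move=> /(_ _)/wrap[]; first by move=> t /DD0/hw[].
move=> /(_ _)/wrap[].
  move=> t Dt; rewrite w'D//.
  have : ham (x t) t (v t) 1 (psi t) + (gamma + i.+1%:R^-1) <= ham (x t) t (w t) 1 (psi t).
    by have [] := hw t (DD0 t Dt).
  by rewrite addrC lerBrDr.
have := hv w' y py.
have muDfin : mu D \is a fin_num.
  rewrite ge0_fin_numE//; apply: (@le_lt_trans _ _ (mu (`[0%R, S]%classic : set R))).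
    apply: le_measure; rewrite ?inE; [exact: mD|exact: measurable_itv|exact: subset_trans D0S].
  by rewrite lebesgue_measure_itv/=; case: ifP => _; rewrite ?ltry// -EFinB ltry.
have : fine (mu (differ v w')) <= fine (mu D).
  apply: fine_le => //; first exact: differ_process_fin pv py.
  by apply: le_measure; rewrite ?inE//; exact: measurable_differ_process pv py.
move: Dpos Dd; set M := fine (mu D); set M' := fine (mu (differ _ _)).
set jw := cost _ w' _ _; set jv := cost _ v _ _; set r := i.+1%:R^-1 => M0 Mr MM h1 h2.
have r0 : 0 < r by rewrite invr_gt0.
have h3 : gamma * M' <= gamma * M by rewrite ler_pM2l.
have h4 : (C + 1) * M <= r / 2.
  rewrite mulrC -ler_pdivlMr ?ltr_wpDl//; apply: le_trans Mr _.
  by rewrite le_eqVlt; apply/orP; left; apply/eqP; field; rewrite gt_eqF// ltr_wpDl.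
nra.
Qed.

End ApproximateMaximumPrinciple.

(** * Approximate multipliers *)

Section Glue.
Context {R : realType}.

Lemma li_if (S : R) (h1 h2 : R -> R) : li h1 -> li h2 ->
  li (fun t => if t <= S then h1 t else h2 t).
Proof.
move=> l1 l2.
have -> : (fun t => if t <= S then h1 t else h2 t) =
    (fun t => h1 t * \1_(`]-oo, S]) t + h2 t * \1_(`]S, +oo[) t).
  apply/funext => t; rewrite !indicE; have [tS|St] := leP t S.
    by rewrite mem_set ?memNset ?mulr1 ?mulr0 ?addr0//= in_itv/= ?tS// andbT; apply/negP; rewrite -leNgt.
  by rewrite memNset ?mem_set ?mulr1 ?mulr0 ?add0r//= in_itv/= ?St// ; apply/negP; rewrite -ltNge.
by apply: liD; apply: li_indic => //; exact: measurable_itv.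
Qed.

Lemma vmeas_if n (S : R) (y1 y2 : R -> 'rV[R]_n) : vmeas y1 -> vmeas y2 ->
  vmeas (fun t => if t <= S then y1 t else y2 t).
Proof.
move=> m1 m2 i.
have -> : (fun t => (if t <= S then y1 t else y2 t) ord0 i) =
    (fun t => if t <= S then y1 t ord0 i else y2 t ord0 i).
  by apply/funext => t; case: ifP.
apply: measurable_fun_ifT => //.
by apply: measurable_fun_ler.
Qed.

Lemma prim_if (S : R) (h1 h2 : R -> R) t : li h1 -> li h2 -> 0 <= S ->
  prim (fun t => if t <= S then h1 t else h2 t) t =
  if t <= S then prim h1 t else prim h1 S + (prim h2 t - prim h2 S).
Proof.
move=> l1 l2 S0; have [tS|St] := leP t S.
  by apply: eq_prim => s /andP[_ st]; rewrite (le_trans st).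
set h := fun t => _.
have lh : li h by exact: li_if.
have -> : prim h1 S = prim h S by apply: eq_prim => s /andP[_ st]; rewrite /h st.
rewrite -[LHS](subrK (prim h S)) addrC; congr (_ + _).
rewrite !prim_sub ?(ltW St)//; apply: eq_Rintegral => s /set_mem /=.
by rewrite in_itv/= => /andP[Ss _]; rewrite /h leNgt Ss.
Qed.

Lemma sol_glue n (S : R) (F1 F2 : R -> 'rV[R]_n -> 'rV[R]_n) y1 y2 : 0 <= S ->
  sol F1 y1 -> sol F2 y2 -> y1 S = y2 S ->
  sol (fun t z => if t <= S then F1 t z else F2 t z) (fun t => if t <= S then y1 t else y2 t).
Proof.
move=> S0 [m1 l1 E1] [m2 l2 E2] e.
have FE i : (fun t => (if t <= S then F1 t (if t <= S then y1 t else y2 t)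
      else F2 t (if t <= S then y1 t else y2 t)) ord0 i) =
   (fun t => if t <= S then F1 t (y1 t) ord0 i else F2 t (y2 t) ord0 i).
  by apply/funext => t; case: (t <= S).
split; first exact: vmeas_if.
  by move=> i; rewrite FE; exact: li_if.
move=> t; rewrite S0; apply/rowP => i; rewrite !mxE FE prim_if//.
have [tS|St] := leP t S; first by rewrite E1 !mxE.
have := e; rewrite E1 [y2 S]E2 => /rowP/(_ i); rewrite !mxE => h.
by rewrite E2 !mxE; lra.
Qed.

Lemma sol_scale n c (F G : R -> 'rV[R]_n -> 'rV[R]_n) y : sol F y ->
  (forall t, G t (c *: y t) = c *: F t (y t)) -> sol G (fun t => c *: y t).
Proof.
move=> [my lF yE] GF.
have GE i : (fun t => G t (c *: y t) ord0 i) = (fun t => c * F t (y t) ord0 i).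
  by apply/funext => t; rewrite GF mxE.
split.
- by move=> i; under eq_fun do rewrite mxE; exact: measurable_funM.
- by move=> i; rewrite GE; exact: liZ.
- move=> t; rewrite [in LHS]yE scalerDr; congr (_ + _).
  by apply/rowP => i; rewrite !mxE GE primZ.
Qed.

End Glue.

(** * Stability of the adjoint equation *)

Section AdjointStability.
Context {R : realType} {m k : nat}.
Notation X := 'rV[R]_m.
Notation Uc := 'rV[R]_k.
Variables (f : R -> X -> Uc -> X) (g : R -> X -> Uc -> R) (beta : nat -> R -> R).
Hypothesis rd : regular_data f g beta.
Notation ham := (hamiltonian f g).
Notation dham := (dhamiltonian f g).
Notation adjoint x u lam := (fun t p => - dham (x t) t (u t) lam p).

(** The difference of the right-hand sides splits into the linear expression in [(lam - nu, P - Q)]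
    along the first process and the effect of changing the process at fixed [(nu, Q)]; hence only
    [Q] has to be bounded. *)
Lemma adjoint_stability (v w : R -> Uc) (x y P Q : R -> X) lam nu n S (D : set R) B K :
  sol (adjoint x v lam) P -> sol (adjoint y w nu) Q ->
  measurable D -> (forall t, 0 <= t <= S -> differ v w t -> D t) -> 0 <= S ->
  (forall t, 0 <= t <= S -> [/\ `|x t| <= n%:R, `|y t| <= n%:R, `|v t| <= n%:R & `|w t| <= n%:R]) ->
  (forall t, 0 <= t <= S -> `|Q t| <= B) -> (forall t, 0 <= t <= S -> `|x t - y t| <= K) ->
  let Lam := prim (beta n) S in let W := m%:R * B + `|nu| in
  forall s t, 0 <= s <= S -> 0 <= t <= S ->
    `|P t - Q t| <= (`|P s - Q s| + (`|lam - nu| * Lam +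
       (2 * W * prim (fun t => beta n t * \1_D t) S + W * K * Lam))) * expR (m%:R * Lam).
Proof.
move=> [_ lP PE] [_ lQ QE] mD hD S0 hn hB hK Lam W s t hs ht.
have lb := li_beta rd n; have b0 := beta_ge0 rd n.
have lbD := li_indic mD lb.
have S00 : 0 <= (0 : R) <= S by rewrite lexx.
have B0 := le_trans (normr_ge0 _) (hB 0 S00).
have K0 := le_trans (normr_ge0 _) (hK 0 S00).
have W0 : 0 <= W by rewrite addr_ge0// mulr_ge0.
pose eta t := `|lam - nu| * beta n t + (2 * W * (beta n t * \1_D t) + W * K * beta n t).
have le : li eta by apply: liD; [exact: liZ|apply: liD; exact: liZ].
have e0 r : 0 <= eta r by rewrite /eta !addr_ge0 ?mulr_ge0.
have := @ode_gronwall _ _ P Q _ _ (fun t => m%:R * beta n t) eta S lP lQ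
  (fun t _ => PE t) (fun t _ => QE t) (liZ m%:R lb) _ le e0.
rewrite primZ// primD; [|exact: liZ|by apply: liD; exact: liZ].
rewrite primD; [|exact: liZ|exact: liZ].
rewrite !primZ//; apply => //.
  by move=> r; rewrite mulr_ge0.
move=> r hr; have [h1 h2 h3 h4] := hn r hr; have br := b0 r.
rewrite -opprD normrN.
have -> : dham (x r) r (v r) lam (P r) + - dham (y r) r (w r) nu (Q r) =
  dham (x r) r (v r) (lam - nu) (P r - Q r) +
  (dham (x r) r (v r) nu (Q r) - dham (y r) r (w r) nu (Q r)).
  by rewrite -(dhamB rd) addrA subrK.
have Wle : m%:R * `|Q r| + `|nu| <= W by rewrite lerD2r ler_wpM2l// hB.
have Wb : (m%:R * `|Q r| + `|nu|) * beta n r <= W * beta n r by rewrite ler_wpM2r.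
have i0 := dham_le rd r (lam - nu) (P r - Q r) h1 h3.
suff i1 : `|dham (x r) r (v r) nu (Q r) - dham (y r) r (w r) nu (Q r)| <=
    2 * W * (beta n r * \1_D r) + W * K * beta n r.
  apply: le_trans (ler_normD _ _) _; rewrite /eta.
  by move: i0 i1; rewrite mulrDl; lra.
have [Dr|nDr] := pselect (D r).
  rewrite indicE mem_set// mulr1; apply: le_trans (ler_normB _ _) _.
  have j1 := le_trans (dham_le rd r nu (Q r) h1 h3) Wb.
  have j2 := le_trans (dham_le rd r nu (Q r) h2 h4) Wb.
  have : 0 <= W * K * beta n r by rewrite !mulr_ge0.
  lra.
have -> : w r = v r by apply: contrapT => h; apply: nDr; apply: hD => // h'; apply: h.
rewrite indicE memNset// !mulr0 add0r.
apply: le_trans (dham_lip rd r nu (Q r) h1 h2 h3) _.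
rewrite mulrAC; apply: ler_pM; [by rewrite mulr_ge0// addr_ge0// mulr_ge0|exact: br| |exact: lexx].
by apply: ler_pM; [rewrite addr_ge0// mulr_ge0|exact: normr_ge0|exact: Wle|exact: hK].
Qed.

Lemma ham_cvg (xs : nat -> X) (ls : nat -> R) (ps : nat -> X) x l p t u :
  xs @ \oo --> x -> ls @ \oo --> l -> ps @ \oo --> p ->
  ham (xs j) t u (ls j) (ps j) @[j --> \oo] --> ham x t u l p.
Proof.
move=> xc lc pc.
have pair_c : (xs j, u) @[j --> \oo] --> (x, u) by exact: (cvg_pair xc (@cvg_cst _ u _ \oo _)).
have fc : f t (xs j) u @[j --> \oo] --> f t x u.
  have cf : continuous (fun z : X * Uc => f t z.1 z.2) by move=> z; exact: (cont_f rd).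
  exact: (cvg_comp (fun j => (xs j, u)) _ pair_c (cf (x, u))).
have gc : g t (xs j) u @[j --> \oo] --> g t x u.
  have cg : continuous (fun z : X * Uc => g t z.1 z.2) by move=> z; exact: (cont_g rd).
  exact: (cvg_comp (fun j => (xs j, u)) _ pair_c (cg (x, u))).
rewrite [ham x t u l p]hamE; under eq_fun do rewrite hamE dotE.
rewrite dotE; apply: cvgD; last exact: cvgM.
elim: (index_enum _) => [|i r ih].
  by rewrite big_nil; under eq_fun do rewrite big_nil; exact: cvg_cst.
rewrite big_cons; under eq_fun do rewrite big_cons.
by apply: cvgD => //; apply: cvgM; exact: rV_coord_cvg.
Qed.

End AdjointStability.

Section ApproximateMultipliers.
Context {R : realType} {m k : nat}.
Notation mu := (@lebesgue_measure R).
Notation X := 'rV[R]_m.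
Notation Uc := 'rV[R]_k.
Variables (f : R -> X -> Uc -> X) (g : R -> X -> Uc -> R) (beta : nat -> R -> R).
Hypothesis rd : regular_data f g beta.
Notation ham := (hamiltonian f g).
Notation dham := (dhamiltonian f g).
Notation adjoint x u lam := (fun t p => - dham (x t) t (u t) lam p).
Variables (U : R -> set Uc) (x_init : X) (u0 : R -> Uc) (x0 : R -> X).
Hypotheses (bu0 : borel_control u0) (lbu0 : locally_bounded u0)
  (Uu0 : forall t, 0 <= t -> U t (u0 t)) (borelU : borel_graph U)
  (sx0 : sol (fun t z => f t z (u0 t)) x0) (x00 : x0 0 = x_init).
Hypothesis opt : forall e M, 0 < e -> exists2 T, M <= T &
  forall S rho v x, admissible_process f U x_init u0 S rho v x ->
    cost g v x T <= cost g u0 x0 T + e.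

(* ap_control, ap_state and ap_costate come from the approximate maximum
   principle; ap_x and ap_psi solve (S), the latter vanishing at ap_time. *)
Record approximant := Approximant {
  ap_time : R; ap_lam : R; ap_control : R -> Uc; ap_state : R -> X; ap_costate : R -> X;
  ap_x : R -> X; ap_psi : R -> X }.

Definition approximates (S e M : R) (rho : nat) (a : approximant) :=
  [/\ M <= ap_time a /\ 0 < ap_lam a,
      sol (fun t z => f t z (u0 t)) (ap_x a),
      sol (adjoint (ap_x a) u0 (ap_lam a)) (ap_psi a) /\ ap_psi a (ap_time a) = 0,
      ap_lam a + `|ap_psi a 0| = 1 &
   [/\ forall t, 0 <= t <= S -> [/\ `|ap_x a t - x0 t| <= e, `|ap_state a t - x0 t| <= e &
        `|ap_costate a t - ap_psi a t| <= e],
      borel_control (ap_control a),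
      (mu (differ u0 (ap_control a)) <= e%:E)%E &
      {ae mu, forall t, 0 <= t <= S -> forall p, U t p -> `|p| <= rho%:R ->
       ham (ap_state a t) t p (ap_lam a) (ap_costate a t) <=
       ham (ap_state a t) t (ap_control a t) (ap_lam a) (ap_costate a t) + e}]].

Lemma approximation_exists S e M rho : 0 <= S -> 0 < e ->
  (forall t, 0 <= t <= S -> `|u0 t| <= rho%:R) -> exists a, approximates S e M rho a.
Proof.
move=> S0 e0 u0rho.
have S00 : 0 <= (0 : R) <= S by rewrite lexx.
have SS : 0 <= S <= S by rewrite lexx S0.
have [N1 [rN1 hN1]] := process_bounded rd U x_init lbu0 S rho S0.
have p0 : admissible_process f U x_init u0 S rho u0 x0 by split.
pose L1 := prim (beta N1) S.
have L10 : 0 <= L1 by apply: prim_ge0 => //; [exact: (li_beta rd)|exact: (beta_ge0 rd)].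
(* Bounds on [[0, S]] the state run backwards with [u0] from [Xs S], whose norm is at most [N1]. *)
pose B1 := N1%:R + (1 + N1%:R) * L1 * expR L1.
pose N := maxn N1 (Num.truncn B1).+1.
have NN1 : N1%:R <= N%:R :> R by rewrite ler_nat leq_maxl.
pose Lam := prim (beta N) S.
have lb := li_beta rd N; have b0 := beta_ge0 rd N.
have Lam0 : 0 <= Lam by exact: prim_ge0.
(* Integrated growth rate of the adjoint equation with multiplier 1, as
   [m * |p| + 1 <= (m + 1) * (1 + |p|)]. *)
pose Lp := prim (fun t => (m%:R + 1) * beta N t) S.
have lp : li (fun t => (m%:R + 1) * beta N t) by exact: liZ.
have lp0 t : 0 <= (m%:R + 1) * beta N t by rewrite mulr_ge0// addr_ge0.
have Lp0 : 0 <= Lp by exact: prim_ge0.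
(* The weight of the costate on [[0, S]] is at most [(1 + |psi 0|) * W1]; [W1] itself is known
   before the horizon. *)
pose W1 := m%:R * (1 + Lp * expR Lp) + 1.
have W10 : 0 <= W1 by rewrite addr_ge0// mulr_ge0// addr_ge0// mulr_ge0// expR_ge0.
pose E := expR Lam.
have E0 : 0 <= E by exact: expR_ge0.
(* All deviations will be at most [I * C], with [I] the integral of [beta N] over the set where the
   controls differ: [4 * E] serves the two state deviations, each at most [2 * I * E], the middle
   term the rescaled costate deviation, and 1 makes [C] positive. *)
pose C := 4 * E + W1 * (2 + 2 * E * Lam) * expR (m%:R * Lam) + 1.
have C1 : 0 <= W1 * (2 + 2 * E * Lam) * expR (m%:R * Lam).
  by rewrite !mulr_ge0 ?expR_ge0// addr_ge0// !mulr_ge0.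
have C0 : 0 < C by rewrite /C; lra.
have [d d0 hd] := prim_small S lb (divr_gt0 e0 C0).
pose gam := Num.min (d / 2) e.
have gam0 : 0 < gam by rewrite lt_min e0 divr_gt0.
have [T MT hT] := opt (Num.max M S) (exprn_gt0 2 gam0).
have ST : S <= T by apply: le_trans MT; rewrite le_max lexx orbT.
have MT' : M <= T by apply: le_trans MT; rewrite le_max lexx.
have [v [Xs [P [pv muv [sP PT] hmax]]]] :=
  approximate_maximum_principle rd bu0 lbu0 Uu0 S0 u0rho borelU ST gam0 p0 (hT S rho).
have [[bv Uv v_off v_rho] sX X0] := pv.
have mu0 := borel_control_vmeas bu0.
have mv := borel_control_vmeas bv.
pose D := differ u0 v.
have mD : measurable D by exact: measurable_differ_process p0 pv.
pose I := prim (fun t => beta N t * \1_D t) S.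
have I0 : 0 <= I by exact: prim_indic_ge0.
have Ie : I * C <= e.
  rewrite -ler_pdivlMr//; apply/ltW.
  have -> : I = prim (fun t => `|beta N t| * \1_D t) S.
    by congr prim; apply/funext => t; rewrite ger0_norm.
  apply: hd => //; apply: le_lt_trans muv _; rewrite lte_fin.
  by apply: (@le_lt_trans _ _ (d / 2)); [rewrite ge_min lexx|lra].
have [y [sy yS]] := trajectory_exists rd (Xs S) mu0 lbu0 S0.
pose x t := if t <= S then y t else Xs t.
have sx : sol (fun t z => f t z (u0 t)) x.
  have := sol_glue S0 sy sX yS; congr sol.
  apply/funext => t; apply/funext => z; case: leP => // St.
  by rewrite v_off// => /andP[_]; rewrite leNgt St.
have [mx _ _] := sx; have lbx := sol_bounded sx.
have xE t : t <= S -> x t = y t by move=> tS; rewrite /x tS.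
have xS : x S = Xs S by rewrite xE.
have [phi [sphi phiS]] := adjoint_exists rd 1 (P S) mx lbx mu0 lbu0 S0.
pose psi t := if t <= S then phi t else P t.
have spsi : sol (adjoint x u0 1) psi.
  have := sol_glue S0 sphi sP phiS; congr sol.
  apply/funext => t; apply/funext => z; rewrite /x; case: leP => // St.
  by rewrite v_off// => /andP[_]; rewrite leNgt St.
have psiT : psi T = 0.
  rewrite /psi; case: leP => // TS; have TE : T = S by apply/eqP; rewrite eq_le TS ST.
  by rewrite TE phiS -TE.
have psiS : psi S = P S by rewrite /psi lexx.
have hx t : 0 <= t <= S -> `|x t| <= N%:R.
  move=> ht; have := sol_growth sx (li_beta rd N1) (beta_ge0 rd N1) (S := S).
  move=> /(_ _ S t SS ht)/wrap[].
    by move=> s hs; apply: (growth_f rd); rewrite (le_trans (u0rho s hs))// ler_nat.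
  move=> /le_trans; apply; apply: (@le_trans _ _ B1); last first.
    by rewrite (le_trans (ltW (truncnS_gt B1)))// ler_nat leq_maxr.
  rewrite xS; have [h _] := hN1 _ _ pv S SS; rewrite /B1 -/L1.
  have z0 : 0 <= L1 * expR L1 by rewrite mulr_ge0// expR_ge0.
  by rewrite -!mulrA; apply: lerD => //; rewrite ler_wpM2r// lerD2l.
have hXN t : 0 <= t <= S -> `|Xs t| <= N%:R /\ `|v t| <= N%:R.
  by move=> /(hN1 _ _ pv)[h1 h2]; split; exact: le_trans NN1.
have hx0N t : 0 <= t <= S -> `|x0 t| <= N%:R /\ `|u0 t| <= N%:R.
  by move=> /(hN1 _ _ p0)[h1 h2]; split; exact: le_trans NN1.
have vD t : 0 <= t <= S -> differ v u0 t -> D t by move=> _; rewrite differ_sym.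
have dX t : 0 <= t <= S -> `|Xs t - x0 t| <= 2 * I * E.
  move=> ht; have := sol_stability rd (n := N) sX sx0 mD vD _ S00 ht.
  rewrite X0 x00 subrr normr0 add0r; apply => s hs.
  by have [? ?] := hXN s hs; have [? ?] := hx0N s hs.
have dXx t : 0 <= t <= S -> `|Xs t - x t| <= 2 * I * E.
  move=> ht; have := sol_stability rd (n := N) sX sx mD vD _ SS ht.
  rewrite xS subrr normr0 add0r; apply => s hs.
  by have [? ?] := hXN s hs; have [? ?] := hx0N s hs; split => //; exact: hx.
pose a0 := `|psi 0|.
have a00 : 0 <= a0 by exact: normr_ge0.
pose B := (1 + a0) * (1 + Lp * expR Lp).
have z0 : 0 <= Lp * expR Lp by rewrite mulr_ge0// expR_ge0.
have hpsi t : 0 <= t <= S -> `|psi t| <= B.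
  move=> ht; have := sol_growth spsi lp lp0 (S := S).
  move=> /(_ _ 0 t S00 ht)/wrap[].
    move=> s hs; rewrite normrN.
    apply: le_trans (dham_le rd s 1 (psi s) (hx s hs) (hx0N s hs).2) _.
    rewrite normr1 mulrAC ler_wpM2r//.
    have := normr_ge0 (psi s); set q := `|psi s| => q0.
    have m0 : (0 : R) <= m%:R by [].
    by rewrite mulrDl mul1r mulrDr mulr1; lra.
  move=> /le_trans; apply; rewrite -/Lp -/a0 /B -mulrA; lra.
have sPs t : 0 <= t <= S ->
    `|P t - psi t| <= (1 + a0) * (I * (W1 * (2 + 2 * E * Lam) * expR (m%:R * Lam))).
  move=> ht.
  have := adjoint_stability rd (n := N) sP spsi mD vD S0 _ hpsi dXx SS ht.
  move=> /(_ _)/wrap[].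
    by move=> s hs; have [? ?] := hXN s hs; have [? ?] := hx0N s hs; split => //; exact: hx.
  rewrite psiS !subrr !normr0 mul0r !add0r normr1 -/Lam -/I => h; apply: le_trans h _.
  have WB : m%:R * B + 1 <= (1 + a0) * W1.
    rewrite /B /W1; set q := 1 + Lp * expR Lp.
    rewrite -subr_ge0; have -> : (1 + a0) * (m%:R * q + 1) - (m%:R * ((1 + a0) * q) + 1) = a0 by ring.
    exact: a00.
  have q0 : 0 <= I * (2 + 2 * E * Lam) by rewrite mulr_ge0// addr_ge0// !mulr_ge0.
  have := ler_wpM2r q0 WB; set u := m%:R * B + 1; set u' := 1 + a0; set ex := expR _.
  move=> h.
  have -> : 2 * u * I + u * (2 * I * E) * Lam = u * (I * (2 + 2 * E * Lam)) by ring.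
  have -> : u' * (I * (W1 * (2 + 2 * E * Lam) * ex)) = u' * W1 * (I * (2 + 2 * E * Lam)) * ex by ring.
  by apply: ler_wpM2r => //; exact: expR_ge0.
(* Scaling by [lam] normalises the pair and cancels the factor [1 + a0] in [sPs]. *)
pose lam := (1 + a0)^-1.
have a1 : 0 < 1 + a0 by lra.
have lam0 : 0 < lam by rewrite invr_gt0.
have lam1 : lam <= 1 by rewrite invf_le1//; lra.
exists (Approximant T lam v Xs (fun t => lam *: P t) x (fun t => lam *: psi t)).
have IC : I * (4 * E) <= e.
  apply: le_trans Ie; apply: (ler_wpM2l I0); rewrite /C -addrA lerDl.
  by apply: addr_ge0; [exact: C1|exact: ler01].
have IW : I * (W1 * (2 + 2 * E * Lam) * expR (m%:R * Lam)) <= e.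
  apply: le_trans Ie; apply: (ler_wpM2l I0).
  have -> : C = (4 * E + 1) + W1 * (2 + 2 * E * Lam) * expR (m%:R * Lam) by rewrite /C addrAC.
  rewrite lerDr.
  by apply: addr_ge0; [apply: mulr_ge0; [exact: ler0n|exact: E0]|exact: ler01].
have IE0 : 0 <= I * E by exact: mulr_ge0.
have lama : lam * (1 + a0) = 1 by apply: mulVf; rewrite gt_eqF.
split; [by split; [exact: MT'|exact: lam0]|exact: sx| | |split; [|exact: bv| |]].
- split; last by rewrite /ap_psi /ap_time psiT scaler0.
  apply: (sol_scale spsi) => t; rewrite /ap_x /ap_lam -{1}[lam]mulr1 (dhamZ rd).
  by rewrite scalerN.
- rewrite /ap_lam /ap_psi normrZ (gtr0_norm lam0) -/a0 -{1}[lam]mulr1 -mulrDr.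
  by apply: mulVf; rewrite gt_eqF.
- move=> t ht; rewrite /ap_x /ap_state /ap_costate /ap_psi; split.
  + have -> : x t - x0 t = (Xs t - x0 t) - (Xs t - x t).
      by rewrite [RHS]addrC opprB addrA subrK.
    apply: le_trans (ler_normB _ _) _; apply: le_trans IC.
    have -> : I * (4 * E) = 2 * I * E + 2 * I * E by ring.
    by apply: lerD; [exact: dX|exact: dXx].
  + apply: le_trans (dX t ht) _; apply: le_trans IC.
    have -> : I * (4 * E) = 2 * I * E + 2 * (I * E) by ring.
    by rewrite lerDl; apply: mulr_ge0.
  + rewrite -scalerBr normrZ (gtr0_norm lam0).
    apply: le_trans IW; apply: le_trans (ler_wpM2l (ltW lam0) (sPs t ht)) _.
    by rewrite [leLHS]mulrA lama mul1r.
- rewrite /ap_control; apply: le_trans muv _; rewrite lee_fin.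
  by rewrite ge_min lexx orbT.
- apply: (ae_imp hmax) => t h ht p Up pr; rewrite /ap_state /ap_lam /ap_costate /ap_control.
  have lamE q : ham (Xs t) t q lam (lam *: P t) = lam * ham (Xs t) t q 1 (P t).
    by rewrite -hamZ mulr1.
  rewrite !lamE.
  have ge : gam <= e by rewrite ge_min lexx orbT.
  have hh := ler_wpM2l (ltW lam0) (h ht p Up pr).
  apply: le_trans hh _; rewrite mulrDr lerD2l; apply: le_trans ge.
  by apply: ler_piMl => //; exact: ltW.
Qed.

End ApproximateMultipliers.

(** * Passage to the limit *)

Section Subsequences.
Context {R : realType}.

Lemma cluster_subsequence (V : pseudoMetricType R) (u : nat -> V) l :
  cluster (u @ \oo) l -> exists phi : nat -> nat,
    {homo phi : i j / (i < j)%N} /\ u (phi i) @[i --> \oo] --> l.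
Proof.
move=> cl.
have : forall p : nat * nat, exists n, (p.1 < n)%N /\ ball l (p.2.+1%:R^-1 : R) (u n).
  move=> [N j] /=.
  have hN : (u @ \oo) (u @` [set n | (N < n)%N]).
    by exists N.+1 => // n /= Nn; exists n.
  have hB : nbhs l (ball l (j.+1%:R^-1 : R)) by apply: nbhsx_ballx; rewrite invr_gt0.
  by have [_ [[n Nn <-] h]] := cl _ _ hN hB; exists n.
move=> /choice[nxt hnxt].
pose fix phi j := nxt (if j is j'.+1 then phi j' else 0%N, j).
have phiS j : (phi j < phi j.+1)%N by have [] := hnxt (phi j, j.+1).
have hb j : ball l (j.+1%:R^-1 : R) (u (phi j)).
  by case: j => [|j]; [have [] := hnxt (0%N, 0%N)|have [] := hnxt (phi j, j.+1)].
exists phi; split; first exact: (homo_ltn ltn_trans phiS).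
apply/cvg_ballP => e e0.
have := @cvg_harmonic R => /cvgrPdist_lt/(_ e e0); apply: filterS => j.
rewrite /= sub0r normrN ger0_norm ?invr_ge0// => /ltW je.
by apply: le_ball (hb j).
Qed.

Lemma cvg_dist_le (V : normedModType R) (y : nat -> V) l (d : nat -> R) :
  d @ \oo --> (0 : R) -> (\forall i \near \oo, `|y i - l| <= d i) -> y @ \oo --> l.
Proof.
move=> d0 yd; apply/cvgrPdist_le => e e0.
have /cvgrPdist_le/(_ e e0) := d0; apply: filterS2 yd => i h.
rewrite sub0r normrN => h2; rewrite distrC; apply: le_trans h _.
exact: le_trans (ler_norm _) h2.
Qed.

Lemma cvg_norm_sub (V : normedModType R) (y : nat -> V) l :
  y @ \oo --> l -> `|y i - l| @[i --> \oo] --> (0 : R).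
Proof.
move=> yl; rewrite -(normr0 V) -(subrr l).
by apply: cvg_norm; apply: cvgB => //; exact: cvg_cst.
Qed.

Lemma euclidean_normZ n c (q : 'rV[R]_n) : 0 <= c ->
  euclidean_norm (c *: q) = c * euclidean_norm q.
Proof.
move=> c0; rewrite /euclidean_norm.
under eq_bigr do rewrite mxE exprMn.
by rewrite -mulr_sumr sqrtrM ?sqr_ge0// sqrtr_sqr ger0_norm.
Qed.

Lemma euclidean_norm_eq0 n (q : 'rV[R]_n) : euclidean_norm q = 0 -> q = 0.
Proof.
move=> h; apply/rowP => i; rewrite mxE; apply/eqP; rewrite -sqrf_eq0.
have s0 : 0 <= \sum_(i < n) q ord0 i ^+ 2 by apply: sumr_ge0 => j _; exact: sqr_ge0.
have : \sum_(i < n) q ord0 i ^+ 2 <= 0.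
  by rewrite -(sqr_sqrtr s0) -/(euclidean_norm q) h expr0n.
rewrite (bigD1 i)//= => h2; rewrite eq_le sqr_ge0 andbT; apply: le_trans h2.
by rewrite lerDl; apply: sumr_ge0 => j _; exact: sqr_ge0.
Qed.

Lemma euclidean_norm_ge0 n (q : 'rV[R]_n) : 0 <= euclidean_norm q.
Proof. exact: sqrtr_ge0. Qed.

End Subsequences.

Section VanishingLimit.
Context {R : realType} {m k : nat}.
Notation mu := (@lebesgue_measure R).
Notation X := 'rV[R]_m.
Notation Uc := 'rV[R]_k.
Variables (f : R -> X -> Uc -> X) (g : R -> X -> Uc -> R) (beta : nat -> R -> R).
Hypothesis rd : regular_data f g beta.
Notation ham := (hamiltonian f g).
Notation dham := (dhamiltonian f g).
Notation adjoint x u lam := (fun t p => - dham (x t) t (u t) lam p).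
Variables (U : R -> set Uc) (x_init : X) (u0 : R -> Uc) (x0 : R -> X).
Hypotheses (bu0 : borel_control u0) (lbu0 : locally_bounded u0)
  (Uu0 : forall t, 0 <= t -> U t (u0 t)) (borelU : borel_graph U)
  (sx0 : sol (fun t z => f t z (u0 t)) x0) (x00 : x0 0 = x_init).
Hypothesis opt : forall e M, 0 < e -> exists2 T, M <= T &
  forall S rho v x, admissible_process f U x_init u0 S rho v x ->
    cost g v x T <= cost g u0 x0 T + e.

(** The base 4 is chosen for the interleaved sequence of controls: halving the index still leaves
    the rate of powers of 1/2 that [control_limit] requires. *)
Let e (j : nat) : R := 4^-1 ^+ j.

Let e_gt0 j : 0 < e j. Proof. by rewrite exprn_gt0. Qed.

Let e_le i j : (i <= j)%N -> e j <= e i.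
Proof. by move=> ij; rewrite /e ler_wiXn2l// invf_le1// ler1n. Qed.

Let e_cvg : e @ \oo --> (0 : R).
Proof. by apply: cvg_expr; rewrite ger0_norm ?invr_ge0// invf_lt1// ltr1n. Qed.

(** Compactness is used only for the finite-dimensional data [(lambda, psi 0)], which determine the
    limiting costate; the convergence of the costates themselves will follow from stability. *)
Lemma approximating_sequence : exists (rho : nat -> nat) (b : nat -> @approximant R m k),
  [/\ forall i, (i <= rho i)%N,
      forall i, approximates f g U u0 x0 i%:R (e i) i%:R (rho i) (b i),
      {homo (fun i => ap_time (b i)) : i j / (i < j)%N >-> i < j} &
      exists (lam : R) (q : X), ap_lam (b i) @[i --> \oo] --> lam /\ ap_psi (b i) 0 @[i --> \oo] --> q].
Proof.
have : forall j : nat, exists r : nat, (j <= r)%N /\ forall t, 0 <= t <= j%:R -> `|u0 t| <= r%:R.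
  move=> j; have [N hN] := lbu0 j%:R; exists (maxn j N); split; first exact: leq_maxl.
  by move=> t /andP[_ /hN h]; rewrite (le_trans h)// ler_nat leq_maxr.
move=> /choice[rho hrho].
have : forall p : nat * R, exists a, approximates f g U u0 x0 p.1%:R (e p.1) p.2 (rho p.1) a.
  move=> [j M] /=; apply: (approximation_exists rd bu0 lbu0 Uu0 borelU sx0 x00 opt) => //.
  by case: (hrho j).
move=> /choice[A hA].
(* Each horizon is required to exceed the previous one by 1, so the vanishing times increase
   strictly. *)
pose fix ap j := A (j, Num.max j%:R (if j is j'.+1 then ap_time (ap j') + 1 else 0)).
have apE j : exists2 M, approximates f g U u0 x0 j%:R (e j) M (rho j) (ap j) &
    j%:R <= M /\ (if j is j'.+1 then ap_time (ap j') + 1 <= M else True).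
  case: j => [|j].
    exists (Num.max 0 0); first exact: (hA (0%N, _)).
    by rewrite le_max lexx.
  exists (Num.max j.+1%:R (ap_time (ap j) + 1)); first exact: (hA (j.+1, _)).
  by rewrite !le_max !lexx orbT.
have ap_ok j : approximates f g U u0 x0 j%:R (e j) j%:R (rho j) (ap j).
  by have [M [[h1 h2] h3 h4 h5 h6] [jM _]] := apE j; split => //; split => //; exact: le_trans h1.
have apS j : ap_time (ap j) < ap_time (ap j.+1).
  have [M [[h1 _] _ _ _ _] [_ jM]] := apE j.+1.
  by apply: lt_le_trans h1; apply: lt_le_trans jM; rewrite ltrDl.
pose z j : R * X := (ap_lam (ap j), ap_psi (ap j) 0).
pose K := `[0 : R, 1]%classic `*` [set q : X | `|q| <= 1].
have cK : compact K.
  by apply: compact_setX; [exact: segment_compact|exact: compact_norm_ball].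
have zK : (z @ \oo) K.
  exists 0%N => // j _; have [[_ l0] _ _ h _] := ap_ok j.
  by split => /=; rewrite ?in_itv/=; have := normr_ge0 (ap_psi (ap j) 0); lra.
have [[l q] [_ cl]] := cK _ _ zK.
have [phi [phi_incr phi_cvg]] := cluster_subsequence cl.
(* Hence the approximant of index [phi i] meets the weaker requirements of index [i], and the
   extracted sequence can be renumbered. *)
have phi_ge i : (i <= phi i)%N.
  by elim: i => // i ih; apply: leq_ltn_trans ih _; exact: phi_incr.
exists (fun i => rho (phi i)), (fun i => ap (phi i)); split.
- by move=> i; apply: leq_trans (phi_ge i) _; case: (hrho (phi i)).
- move=> i; have [[h1 h2] h3 h4 h5 [h6 h7 h8 h9]] := ap_ok (phi i).
  have ii : i%:R <= (phi i)%:R :> R by rewrite ler_nat.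
  have ee := e_le (phi_ge i).
  split => //; first by split => //; exact: le_trans h1.
  split => //.
  + move=> t /andP[t0 ti]; have [|j1 j2 j3] := h6 t; first by rewrite t0 (le_trans ti).
    by split; apply: le_trans ee.
  + by apply: le_trans h8 _; rewrite lee_fin.
  + apply: (ae_imp h9) => t h /andP[t0 ti] p Up pr.
    have ht : 0 <= t <= (phi i)%:R by rewrite t0 (le_trans ti).
    by apply: le_trans (h ht p Up pr) _; rewrite lerD2l.
- by move=> i j /phi_incr; exact: (homo_ltn lt_trans apS).
- exists l, q; split.
    exact: (cvg_comp _ _ phi_cvg (@cvg_fst _ _ _ _ _)).
  exact: (cvg_comp _ _ phi_cvg (@cvg_snd _ _ _ _ _)).
Qed.

(** [psi0] is defined as the adjoint solution along [x0] with the limiting initial data. On a fixed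
    interval the costates converge to it by stability with the same control on both sides, so that
    the set of disagreement is empty. *)
Lemma unnormalized_limit : exists (lam0 : R) (psi0 : R -> X) (b : nat -> @approximant R m k),
  [/\ [/\ forall i, i%:R <= ap_time (b i),
        {homo (fun i => ap_time (b i)) : i j / (i < j)%N >-> i < j} &
        forall i, [/\ 0 < ap_lam (b i), sol (fun t z => f t z (u0 t)) (ap_x (b i)),
          sol (adjoint (ap_x (b i)) u0 (ap_lam (b i))) (ap_psi (b i)) &
          ap_psi (b i) (ap_time (b i)) = 0]],
      0 <= lam0, lam0 + `|psi0 0| = 1, sol (adjoint x0 u0 lam0) psi0 &
   [/\ forall t, 0 <= t -> ap_psi (b i) t @[i --> \oo] --> psi0 t,
       forall t, 0 <= t -> ap_x (b i) t @[i --> \oo] --> x0 t,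
       ap_lam (b i) @[i --> \oo] --> lam0 &
       {ae mu, forall t, 0 <= t -> forall p, U t p ->
          ham (x0 t) t p lam0 (psi0 t) <= ham (x0 t) t (u0 t) lam0 (psi0 t)}]].
Proof.
have [rho [b [rho_ge hb tb [l [q [lc qc]]]]]] := approximating_sequence.
have mu0 := borel_control_vmeas bu0; have lbx0 := sol_bounded sx0.
have [mx0 _ _] := sx0.
have [psi0 [spsi0 psi00]] := adjoint_exists rd l q mx0 lbx0 mu0 lbu0 (lexx 0).
exists l, psi0, b.
have near_ge t : \forall i \near \oo, t <= i%:R :> R by exact: nbhs_infty_ger.
have xc t : 0 <= t -> ap_x (b i) t @[i --> \oo] --> x0 t.
  move=> t0; apply: (cvg_dist_le e_cvg); apply: filterS (near_ge t) => i ti.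
  have [_ _ _ _ [h _ _ _]] := hb i.
  by have [|] := h t; first by rewrite t0.
have psic t : 0 <= t -> ap_psi (b i) t @[i --> \oo] --> psi0 t.
  move=> t0; pose S : R := (Num.truncn t).+1%:R.
  have tS : t <= S by exact/ltW/truncnS_gt.
  have S0 : 0 <= S by [].
  have [N1 hN1] := lbx0 S; have [N2 hN2] := lbu0 S; have [N3 hN3] := sol_bounded spsi0 S.
  (* The successor absorbs the distance [e i <= 1] between [ap_x (b i)] and [x0]. *)
  pose N := maxn N1.+1 N2.
  have lb := li_beta rd N.
  pose Lam := prim (beta N) S; pose W := m%:R * N3%:R + `|l|.
  pose d i := (`|ap_psi (b i) 0 - q| + (`|ap_lam (b i) - l| * Lam + W * e i * Lam)) * expR (m%:R * Lam).
  apply: (@cvg_dist_le _ _ _ _ d).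
    have -> : (0 : R) = (0 + (0 * Lam + W * 0 * Lam)) * expR (m%:R * Lam).
      by rewrite mulr0 !mul0r !addr0 mul0r.
    apply: cvgMl; apply: cvgD; first exact: cvg_norm_sub.
    apply: cvgD; last by apply: cvgMl; apply: cvgMr.
    by apply: cvgMl; exact: cvg_norm_sub.
  apply: filterS (near_ge S) => i Si.
  have [_ sx [sp _] _ [hx _ _ _]] := hb i.
  have hn s : 0 <= s <= S -> [/\ `|ap_x (b i) s| <= N%:R, `|x0 s| <= N%:R, `|u0 s| <= N%:R & `|u0 s| <= N%:R].
    move=> /andP[s0 sS]; have [|h _ _] := hx s; first by rewrite s0 (le_trans sS).
    have e1 : e i <= 1 by rewrite /e exprn_ile1// invf_le1// ler1n.
    have u0N : `|u0 s| <= N%:R by rewrite (le_trans (hN2 s sS))// ler_nat leq_maxr.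
    have x0N : `|x0 s| <= N1%:R by exact: hN1.
    have N1N : N1%:R + 1 <= N%:R :> R by rewrite natr1 ler_nat leq_maxl.
    split => //; last by lra.
    by have := ler_normD (ap_x (b i) s - x0 s) (x0 s); rewrite subrK; lra.
  have hK s : 0 <= s <= S -> `|ap_x (b i) s - x0 s| <= e i.
    by move=> /andP[s0 sS]; have [|] := hx s; first by rewrite s0 (le_trans sS).
  have hB s : 0 <= s <= S -> `|psi0 s| <= N3%:R by move=> /andP[_ sS]; exact: hN3.
  have S00 : 0 <= (0 : R) <= S by rewrite lexx.
  have ht : 0 <= t <= S by rewrite t0.
  have D0 s : 0 <= s <= S -> differ u0 u0 s -> set0 s by move=> _; apply.
  have := adjoint_stability rd (D := set0) sp spsi0 measurable0 D0 S0 hn hB hK S00 ht.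
  rewrite psi00; suff -> : prim (fun t => beta N t * \1_set0 t) S = 0.
    by rewrite mulr0 add0r.
  rewrite [X in prim X](_ : _ = fun t : R => 0 * beta N t); first by rewrite primZ// mul0r.
  by apply/funext => s; rewrite indicE in_set0 mulr0 mul0r.
have l0 : 0 <= l.
  by apply: (cvgr_to_ge lc); apply: nearW => i; have [[_ /ltW]] := hb i.
split; [|exact: l0| |exact: spsi0|].
- split; [|exact: tb|].
  + by move=> i; have [[]] := hb i.
  + by move=> i; have [[_ h1] h2 [h3 h4] _ _] := hb i.
- rewrite psi00.
  have c1 : ap_lam (b i) + `|ap_psi (b i) 0| @[i --> \oo] --> l + `|q|.
    by apply: cvgD => //; exact: cvg_norm.
  have c2 : ap_lam (b i) + `|ap_psi (b i) 0| @[i --> \oo] --> (1 : R).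
    have -> : (fun i => ap_lam (b i) + `|ap_psi (b i) 0|) = (fun=> 1).
      by apply/funext => i; have [_ _ _ h _] := hb i.
    exact: cvg_cst.
  exact: (cvg_unique _ c1 c2).
split; [exact: psic|exact: xc|exact: lc|].
(* Interleaved with u0, the controls converge pointwise almost everywhere only if
   they are eventually equal to u0. *)
pose w j := if odd j then ap_control (b j./2) else u0.
have bw j : borel_control (w j).
  by rewrite /w; case: ifP => // _; have [_ _ _ _ [_ h _ _]] := hb j./2.
have hw j : (mu (differ (w j) (w j.+1)) <= (2 * 2^-1 ^+ j)%:E)%E.
  have ej : e j./2 <= 2 * 2^-1 ^+ j.
    have -> : e j./2 = 2^-1 ^+ (j./2.*2).
      by rewrite /e -mul2n exprM; congr (_ ^+ _); rewrite expr2 -invfM; congr (_^-1); rewrite -natrM.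
    rewrite -{2}(odd_double_half j) exprD; case: (odd j) => /=.
      by rewrite expr1 mulrA divff// mul1r.
    by rewrite expr0 mul1r ler_peMl ?exprn_ge0// ler1n.
  have [_ _ _ _ [_ _ h _]] := hb j./2.
  apply: (@le_trans _ _ (e j./2)%:E); last by rewrite lee_fin.
  rewrite /w /=; case: (boolP (odd j)) => oj /=; first by rewrite differ_sym.
  by rewrite uphalf_half (negbTE oj) add0n.
have [v [_ _ _ vae]] := control_limit bu0 bw hw.
have hae : {ae mu, forall t, forall i, 0 <= t <= i%:R -> forall p, U t p -> `|p| <= (rho i)%:R ->
   ham (ap_state (b i) t) t p (ap_lam (b i)) (ap_costate (b i) t) <=
   ham (ap_state (b i) t) t (ap_control (b i) t) (ap_lam (b i)) (ap_costate (b i) t) + e i}.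
  by apply/ae_foralln => i; have [_ _ _ _ [_ _ _ h]] := hb i.
apply: (ae_imp2 vae hae) => t [n0 hn0] hmax t0 p Up.
have Xc : ap_state (b i) t @[i --> \oo] --> x0 t.
  apply: (cvg_dist_le e_cvg); apply: filterS (near_ge t) => i ti.
  have [_ _ _ _ [h _ _ _]] := hb i.
  by have [|] := h t; first by rewrite t0.
have Pc : ap_costate (b i) t @[i --> \oo] --> psi0 t.
  have -> : (fun i => ap_costate (b i) t) =
     (fun i => (ap_costate (b i) t - ap_psi (b i) t) + ap_psi (b i) t).
    by apply/funext => i; rewrite subrK.
  rewrite -[X in _ --> X]add0r; apply: cvgD; last exact: psic.
  apply: (cvg_dist_le e_cvg); apply: filterS (near_ge t) => i ti.
  have [_ _ _ _ [h _ _ _]] := hb i; rewrite subr0.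
  by have [|] := h t; first by rewrite t0.
have c1 := ham_cvg rd (t := t) (u := p) Xc lc Pc.
have c2 : ham (ap_state (b i) t) t (u0 t) (ap_lam (b i)) (ap_costate (b i) t) + e i @[i --> \oo] -->
    ham (x0 t) t (u0 t) l (psi0 t) + 0.
  by apply: cvgD => //; exact: (ham_cvg rd (t := t) (u := u0 t) Xc lc Pc).
rewrite addr0 in c2.
apply: (ler_cvg_to c1 c2).
have np : \forall i \near \oo, (Num.truncn `|p| < i)%N by exact: nbhs_infty_ge.
have nn : \forall i \near \oo, (n0 <= i)%N by exact: nbhs_infty_ge.
near=> i.
have ti : t <= i%:R by near: i; exact: near_ge.
have pi : (Num.truncn `|p| < i)%N by near: i.
have ni : (n0 <= i)%N by near: i.
have -> : u0 t = ap_control (b i) t.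
  have h1 := hn0 i.*2; have h2 := hn0 i.*2.+1.
  rewrite /w/= odd_double/= in h1; rewrite /w/= odd_double/= uphalf_double in h2.
  have i2 : (n0 <= i.*2)%N by rewrite -addnn; exact: leq_trans (leq_addr _ _).
  by rewrite h1// h2// (leq_trans i2).
apply: hmax => //; first by rewrite t0.
apply: le_trans (ltW (truncnS_gt _)) _; rewrite ler_nat; apply: leq_trans pi (rho_ge i).
Unshelve. all: by end_near. Qed.

Lemma vanishing_limit : exists (tau : nat -> R) (lam0 : R) (psi0 : R -> X) (lam : nat -> R) (psi x : nat -> R -> X),
  [/\ [/\ forall i, i%:R <= tau i, {homo tau : i j / (i < j)%N >-> i < j} &
        forall i, [/\ 0 <= lam i, sol (fun t z => f t z (u0 t)) (x i),
          sol (adjoint (x i) u0 (lam i)) (psi i) & psi i (tau i) = 0]],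
      lam0 = 1 \/ (lam0 = 0 /\ euclidean_norm (psi0 0) = 1),
      sol (adjoint x0 u0 lam0) psi0 &
   [/\ forall t, 0 <= t -> psi i t @[i --> \oo] --> psi0 t,
       forall t, 0 <= t -> x i t @[i --> \oo] --> x0 t,
       lam i @[i --> \oo] --> lam0 &
       {ae mu, forall t, 0 <= t -> forall p, U t p ->
          ham (x0 t) t p lam0 (psi0 t) <= ham (x0 t) t (u0 t) lam0 (psi0 t)}]].
Proof.
have [l [psi0 [b [[h1 h2 h3] l0 ln spsi0 [c1 c2 c3 hmax]]]]] := unnormalized_limit.
(* Positive scaling preserves every other property. If [l] is positive, [c] is its inverse;
   otherwise [psi0 0] has sup norm 1, so its Euclidean norm is positive and can be inverted. *)
suff [c c0 hc] : exists2 c, 0 < c & c * l = 1 \/ (c * l = 0 /\ euclidean_norm (c *: psi0 0) = 1).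
  have scale y u lam' psi' : sol (adjoint y u lam') psi' ->
      sol (adjoint y u (c * lam')) (fun t => c *: psi' t).
    by move=> s; apply: (sol_scale s) => t; rewrite (dhamZ rd) scalerN.
  exists (fun i => ap_time (b i)), (c * l), (fun t => c *: psi0 t), (fun i => c * ap_lam (b i)),
    (fun i t => c *: ap_psi (b i) t), (fun i => ap_x (b i)); split; [|exact: hc| |].
  - split; [exact: h1|exact: h2|] => i; have [k1 k2 k3 k4] := h3 i; split.
    + by rewrite mulr_ge0 ?ltW.
    + exact: k2.
    + exact: scale.
    + by rewrite k4 scaler0.
  - exact: scale.
  - split.
    + by move=> t t0; apply: cvgZr; exact: c1.
    + exact: c2.
    + exact: cvgMr.
    + apply: (ae_imp hmax) => t h t0 p Up; rewrite !hamZ.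
      by rewrite ler_pM2l//; exact: h.
move: l0; rewrite le_eqVlt => /predU1P[l0|l0].
  have q0 : 0 < euclidean_norm (psi0 0).
    rewrite lt_neqAle euclidean_norm_ge0 andbT eq_sym; apply/eqP => /euclidean_norm_eq0 h.
    by move: ln; rewrite -l0 h normr0 addr0 => /esym/eqP; rewrite oner_eq0.
  exists (euclidean_norm (psi0 0))^-1; first by rewrite invr_gt0.
  right; rewrite -l0 mulr0; split => //; rewrite euclidean_normZ ?invr_ge0 ?ltW//.
  by rewrite mulVf// gt_eqF.
exists l^-1; first by rewrite invr_gt0.
by left; rewrite mulVf// gt_eqF.
Qed.

End VanishingLimit.

(** * Exceptional null sets *)

Section NullSets.
Context d (T : measurableType d) (R : realType) (mu : {measure set T -> \bar R}).
Import HBNNSimple.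

(* Neither function is assumed measurable: on the exceptional null set nothing
   is known about t |-> g t (x t) (u t). *)
Lemma ge0_integral_le_off_null (D N : set T) (f g : T -> \bar R) :
  measurable N -> mu N = 0%E ->
  (forall x, D x -> (0 <= f x)%E) -> (forall x, D x -> (0 <= g x)%E) ->
  (forall x, D x -> ~ N x -> (f x <= g x)%E) ->
  (\int[mu]_(x in D) f x <= \int[mu]_(x in D) g x)%E.
Proof.
move=> mN N0 f0 g0 fg; rewrite !ge0_integralE//.
apply/ge_ereal_sup => _ [h /= hf <-]; apply: ereal_sup_ubound.
(* A simple function below [f] is set to 0 on [N]; it is then below [g] and has the same
   integral. *)
exists (proj_nnsfun h (measurableC mN)) => /= [x|].
  rewrite /proj_nnsfun/= mindicE; have := hf x; rewrite /patch.
  case: (boolP (x \in D)) => [/set_mem Dx|_] hx.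
    have [/set_mem Nx|/negP nN] := boolP (x \in ~` N); last first.
      by rewrite mulr0; exact: g0.
    by rewrite mulr1; apply: le_trans hx (fg _ Dx Nx).
  apply: le_trans hx; rewrite lee_fin ler_piMr//.
  by case: (_ \in _).
rewrite -!integralT_nnsfun; apply: ae_eq_integral => //.
- exact/measurable_EFinP.
- exact/measurable_EFinP.
- exists N; split => // x /= /not_implyP[_]; apply: contra_notP => Nx.
  by rewrite /proj_nnsfun/= mindicE mem_set ?mulr1.
Qed.

Lemma integral_eq_off_null (D N : set T) (f g : T -> \bar R) :
  measurable N -> mu N = 0%E -> (forall x, D x -> ~ N x -> f x = g x) ->
  (\int[mu]_(x in D) f x = \int[mu]_(x in D) g x)%E.
Proof.
move=> mN N0 fg.
have ge0 (F G : T -> \bar R) : (forall x, 0 <= F x)%E -> (forall x, 0 <= G x)%E ->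
    (forall x, D x -> ~ N x -> F x = G x) ->
    (\int[mu]_(x in D) F x = \int[mu]_(x in D) G x)%E.
  move=> F0 G0 FG; apply/eqP; rewrite eq_le.
  by apply/andP; split; apply: (ge0_integral_le_off_null mN N0) => // x Dx Nx; rewrite FG.
rewrite integralE [RHS]integralE; congr (_ - _)%E; apply: ge0 => x.
- exact: funepos_ge0.
- exact: funepos_ge0.
- by move=> Dx Nx; rewrite !funeposE fg.
- exact: funeneg_ge0.
- exact: funeneg_ge0.
- by move=> Dx Nx; rewrite !funenegE fg.
Qed.

End NullSets.

Section Rates.
Context {R : realType}.
Notation mu := (@lebesgue_measure R).

Lemma ae_time_conull (P : R -> Prop) : ae_time P -> exists2 N : set R,
  measurable N /\ mu N = 0%E & forall t, 0 <= t -> ~ N t -> P t.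
Proof.
move=> [N [mN N0 PN]]; exists N => // t t0; apply: contra_notP => nP.
by apply: PN => h; apply: nP; exact: h.
Qed.

Lemma limf_einf_pinfty (h : R -> \bar R) e M : limf_einf h (pinfty_nbhs R) = 0%E -> 0 < e ->
  exists2 T, M <= T & (h T < e%:E)%E.
Proof.
rewrite limf_einfE => h0 e0.
pose V := [set T : R | M < T].
have : (ereal_inf (h @` V) <= 0)%E.
  rewrite -h0; apply: ereal_sup_ubound; exists V => //.
  by exists M; split => //; exact: num_real.
move=> hinf; have : (ereal_inf (h @` V) < e%:E)%E.
  by apply: le_lt_trans hinf _; rewrite lte_fin.
by move=> /ereal_inf_lt[_ [T /= MT <-] Te]; exists T => //; exact: ltW.
Qed.

Lemma loc_integrable_rate (L : R -> R) : loc_integrable L -> exists h : R -> R,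
  [/\ li h, forall t, 0 <= h t & ae_time (fun t => L t <= h t)].
Proof.
move=> [L' [iL' LL']]; exists ((fun t => `|L' t|) \_ (`[0, +oo[%classic : set R)).
have mL' : measurable_fun (`[0, +oo[%classic : set R) L'.
  have -> : `[0, +oo[%classic = \bigcup_n `[0, n%:R]%classic :> set R.
    apply/seteqP; split => [t /=|t [n _]]; rewrite /= !in_itv/= ?andbT; last by case/andP.
    move=> t0; exists (Num.truncn t).+1 => //=; rewrite in_itv/= t0; exact/ltW/truncnS_gt.
  apply/measurable_fun_bigcup => [n|n]; first exact: measurable_itv.
  by apply/measurable_EFinP; have /measurable_int := iL' n%:R.
have mh : measurable_fun setT ((fun t => `|L' t|) \_ (`[0, +oo[%classic : set R)).
  apply/(measurable_restrict _ _ measurableT) => //; rewrite setTI.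
  exact: measurableT_comp.
split.
- split => // a b; apply/integrable_mkcond => //.
  have := iL' b; move=> /integrable_mkcond/wrap[|]; first exact: measurable_itv.
  apply: le_integrable => //.
    apply/(measurable_restrict _ _ measurableT); rewrite ?setTI//.
    by apply/measurable_EFinP; exact: measurable_funTS.
  move=> t _; rewrite /patch; case: ifPn => [/set_mem|_]; last by rewrite abse0 abse_ge0.
  rewrite /= in_itv/= => /andP[_ tb]; case: ifPn => [/set_mem|_]; last by rewrite normr0 abse_ge0.
  rewrite /= in_itv/= andbT => t0; rewrite mem_set/= ?normr_id//.
  by rewrite in_itv/= t0.
- by move=> t; rewrite /patch; case: ifP.
- apply: (ae_imp LL') => t h t0; rewrite h// /patch mem_set; first exact: ler_norm.
  by rewrite /= in_itv/= t0.
Qed.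

End Rates.

(** * Cutting off the data in time *)

Section Cutoff.
Context {R : realType} {m k : nat}.
Notation mu := (@lebesgue_measure R).
Notation X := 'rV[R]_m.
Notation Uc := 'rV[R]_k.

Section Tame.
Context {V : normedModType R}.

(** Regularity at a single time, in a form that the zero function satisfies too, so that it survives
    cutting off. *)
Definition tame (b : X -> Uc -> V) (r : nat -> R) :=
  continuous (fun z : X * Uc => b z.1 z.2) /\
  forall n x u, `|x| <= n%:R -> `|u| <= n%:R -> `|b x u| <= r n /\
    forall y, `|y| <= n%:R -> `|b x u - b y u| <= r n * `|x - y|.

Lemma tame_le b r r' : tame b r -> (forall n, r n <= r' n) -> tame b r'.
Proof.
move=> [cb hb] rr'; split => // n x u xn un; have [h1 h2] := hb n x u xn un.
split=> [|y yn]; first exact: le_trans (rr' n).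
by apply: le_trans (h2 y yn) _; rewrite ler_wpM2r.
Qed.

Lemma tame0 r : (forall n, 0 <= r n) -> tame (fun _ _ => 0) r.
Proof.
move=> r0; split => [z|n x u _ _]; first exact: cst_continuous.
by split => [|y _]; rewrite ?subrr normr0 ?mulr_ge0.
Qed.

Lemma regular_rate (a : R -> X -> Uc -> V) : regular a -> exists h : nat -> R -> R,
  [/\ forall n, li (h n), forall n t, 0 <= h n t & ae_time (fun t => tame (a t) (h ^~ t))].
Proof.
move=> [[_ ca] lipa bda].
pose K n : set (X * Uc) := [set x | `|x| <= n%:R] `*` [set u | `|u| <= n%:R].
have cK n : compact (K n) by apply: compact_setX; exact: compact_norm_ball.
have : forall n, exists h : R -> R, [/\ li h, forall t, 0 <= h t &
    ae_time (fun t => forall x u, `|x| <= n%:R -> `|u| <= n%:R -> `|a t x u| <= h t /\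
      forall y, `|y| <= n%:R -> `|a t x u - a t y u| <= h t * `|x - y|)].
  move=> n; have [L [/loc_integrable_rate[L' [lL L0 LL]] _ hL]] := lipa _ (cK n).
  have [M [/loc_integrable_rate[M' [lM M0 MM]] _ hM]] := bda _ (cK n).
  exists (fun t => L' t + M' t); split; [exact: liD|by move=> t; rewrite addr_ge0|].
  apply: (ae_imp2 LL MM) => t h1 h2 t0 x u xn un; split => [|y yn].
    apply: le_trans (hM t x u t0 _) _; first by split.
    by apply: le_trans (h2 t0) _; rewrite lerDr.
  apply: le_trans (hL t x y u t0 _ _) _; [by split|by split|].
  by rewrite ler_wpM2r//; apply: le_trans (h1 t0) _; rewrite lerDl.
move=> /choice[h hh]; exists h; split.
- by move=> n; case: (hh n).
- by move=> n; case: (hh n).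
- have /ae_foralln hae : forall n, ae_time (fun t => forall x u, `|x| <= n%:R -> `|u| <= n%:R ->
      `|a t x u| <= h n t /\
      forall y, `|y| <= n%:R -> `|a t x u - a t y u| <= h n t * `|x - y|).
    by move=> n; case: (hh n).
  by apply: (ae_imp2 ca hae) => t h1 h2 t0; split => [|n]; [exact: h1|exact: h2].
Qed.

Definition cutoff (G : set R) (a : R -> X -> Uc -> V) t x u := if t \in G then a t x u else 0.

Lemma cutoff_tame (G : set R) a r t : (G t -> tame (a t) r) -> (forall n, 0 <= r n) -> tame (cutoff G a t) r.
Proof.
move=> ta r0; have [/set_mem Gt|nG] := boolP (t \in G).
  rewrite (_ : cutoff G a t = a t); first exact: ta.
  by apply/funext => x; apply/funext => u; rewrite /cutoff mem_set.
rewrite (_ : cutoff G a t = fun _ _ => 0); first exact: tame0.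
by apply/funext => x; apply/funext => u; rewrite /cutoff (negbTE nG).
Qed.

Lemma measurable_cutoff (G : set R) (a : R -> X -> Uc -> V) (c : V -> R) x u : measurable G ->
  G `<=` `[0, +oo[%classic -> borel_in_time (fun t => a t x u) -> continuous c -> c 0 = 0 ->
  measurable_fun setT (fun t => c (cutoff G a t x u)).
Proof.
move=> mG G0 ba cc c0.
rewrite (_ : (fun t => _) = (fun t => c (a t x u)) \_ G); last first.
  by apply/funext => t; rewrite /cutoff /patch; case: ifP.
apply/(measurable_restrict _ mG measurableT); rewrite setTI.
apply: (measurable_funS _ G0); first exact: measurable_itv.
apply: (measurability _ (RGenOpens.measurableE R)).
move=> _ [_ [b [b' ->] <-]].
apply: (ba (measurable_itv _) (c @^-1` `]b, b'[%classic)).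
apply: sub_sigma_algebra; apply: open_comp; last exact: interval_open.
by move=> v _; exact: cc.
Qed.

End Tame.

Lemma jacobian_cutoff G (f : R -> X -> Uc -> X) t x u :
  'J (fun y => cutoff G f t y u) x = cutoff G (fun t x u => 'J (fun y => f t y u) x) t x u.
Proof.
rewrite /cutoff; case: ifP => // _; rewrite /jacobian.
have -> : ('d (fun=> 0 : X) x : X -> X) = 0 by exact: diff_cst.
by apply/matrixP => i j; rewrite !mxE.
Qed.

Lemma grad_cutoff G (g : R -> X -> Uc -> R) t x u :
  grad (fun y => cutoff G g t y u) x = cutoff G (fun t x u => grad (fun y => g t y u) x) t x u.
Proof.
rewrite /cutoff; case: ifP => // _.
by apply/rowP => i; rewrite !mxE derive_cst.
Qed.

(** Each hypothesis holds almost everywhere for each integer radius; these countably many conditions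
    share one null set [N]. Since the cutoff is in time only, it commutes with differentiation in
    the state. *)
Lemma regular_data_cutoff (f : R -> X -> Uc -> X) (g : R -> X -> Uc -> R) :
  regularity_conditions f g -> exists (N : set R) (beta : nat -> R -> R),
  [/\ measurable N, mu N = 0%E &
      regular_data (cutoff (`[0, +oo[ `\` N) f) (cutoff (`[0, +oo[ `\` N) g) beta].
Proof.
move=> [[rf rg] [df dg] rfx rgx gr].
have [hf [lf f0 tf]] := regular_rate rf.
have [hg [lg g0 tg]] := regular_rate rg.
have [hfx [lfx fx0 tfx]] := regular_rate rfx.
have [hgx [lgx gx0 tgx]] := regular_rate rgx.
have : forall n : nat, exists h : R -> R, [/\ li h, forall t, 0 <= h t &
    ae_time (fun t => forall x u, `|u| <= n%:R -> `|f t x u| <= h t * (1 + `|x|))].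
  move=> n; have [l /loc_integrable_rate[h [lh h0 hl]] hfl] := gr _ (@compact_norm_ball R k n%:R).
  exists h; split => //; apply: (ae_imp hl) => t ht t0 x u un.
  apply: le_trans (hfl t x u t0 un) _.
  by rewrite ler_wpM2r ?addr_ge0//; exact: ht.
move=> /choice[hl hhl].
have /ae_foralln tl : forall n : nat, ae_time (fun t => forall x u, `|u| <= n%:R -> `|f t x u| <= hl n t * (1 + `|x|)).
  by move=> n; case: (hhl n).
have ll n : li (hl n) by case: (hhl n).
have l0 n t : 0 <= hl n t by case: (hhl n).
have tall : ae_time (fun t => [/\ tame (f t) (hf ^~ t), tame (g t) (hg ^~ t),
   tame (fun x u => 'J (fun y => f t y u) x) (hfx ^~ t),
   tame (fun x u => grad (fun y => g t y u) x) (hgx ^~ t) &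
   forall n x u, `|u| <= n%:R -> `|f t x u| <= hl n t * (1 + `|x|)]).
  apply: (ae_imp2 tf (ae_imp2 tg (ae_imp2 tfx (ae_imp2 tgx tl _) _) _)) => [t h1 h2|t h1 h2|t h1 h2|t h1 h2].
  - exact: (conj h1 h2).
  - exact: (conj h1 h2).
  - exact: (conj h1 h2).
  - move=> t0; case: h2 => h2 [h3 [h4 h5]]; split;
      [exact: h1|exact: h2|exact: h3|exact: h4|by move=> n; exact: h5].
have [N [mN N0] hN] := ae_time_conull tall.
pose G := `[0 : R, +oo[ `\` N.
have mG : measurable G by apply: measurableD.
have G0 : G `<=` `[0, +oo[%classic by move=> t [].
have hG t : G t -> 0 <= t /\ ~ N t by case=> /=; rewrite in_itv/= andbT.
pose r i t := hf i t + (hg i t + (hfx i t + (hgx i t + hl i t))).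
have lr i : li (r i) by do 4 (apply: liD => //).
have r0 i t : 0 <= r i t by rewrite !addr_ge0.
have rhf i t : hf i t <= r i t by rewrite lerDl !addr_ge0.
have rhg i t : hg i t <= r i t.
  have := f0 i t; have := fx0 i t; have := gx0 i t; have := l0 i t; rewrite /r; lra.
have rhfx i t : hfx i t <= r i t.
  have := f0 i t; have := g0 i t; have := gx0 i t; have := l0 i t; rewrite /r; lra.
have rhgx i t : hgx i t <= r i t.
  have := f0 i t; have := g0 i t; have := fx0 i t; have := l0 i t; rewrite /r; lra.
have rhl i t : hl i t <= r i t.
  have := f0 i t; have := g0 i t; have := fx0 i t; have := gx0 i t; rewrite /r; lra.
(* Summing over all smaller radii makes the rates monotone in the radius. *)
pose beta n t := \sum_(i <- iota 0 n.+1) r i t.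
have rb n t : r n t <= beta n t.
  rewrite /beta (bigD1_seq n) ?iota_uniq ?mem_iota//= lerDl.
  by apply: sumr_ge0 => i _; exact: r0.
have b0 n t : 0 <= beta n t by apply: le_trans (rb n t).
exists N, beta; split => //.
have tamef t : tame (cutoff G f t) (beta ^~ t).
  apply: cutoff_tame => // /hG[t0 nN]; have [h _ _ _ _] := hN t t0 nN.
  by apply: (tame_le h) => n; apply: le_trans (rb n t).
have tameg t : tame (cutoff G g t) (beta ^~ t).
  apply: cutoff_tame => // /hG[t0 nN]; have [_ h _ _ _] := hN t t0 nN.
  by apply: (tame_le h) => n; apply: le_trans (rb n t).
have tamefx t : tame (cutoff G (fun t x u => 'J (fun y => f t y u) x) t) (beta ^~ t).
  apply: cutoff_tame => // /hG[t0 nN]; have [_ _ h _ _] := hN t t0 nN.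
  by apply: (tame_le h) => n; apply: le_trans (rb n t).
have tamegx t : tame (cutoff G (fun t x u => grad (fun y => g t y u) x) t) (beta ^~ t).
  apply: cutoff_tame => // /hG[t0 nN]; have [_ _ _ h _] := hN t t0 nN.
  by apply: (tame_le h) => n; apply: le_trans (rb n t).
have Jz t : (fun z : X * Uc => 'J (fun y => cutoff G f t y z.2) z.1) =
    (fun z => cutoff G (fun t x u => 'J (fun y => f t y u) x) t z.1 z.2).
  by apply/funext => z; rewrite jacobian_cutoff.
have Dz t : (fun z : X * Uc => grad (fun y => cutoff G g t y z.2) z.1) =
    (fun z => cutoff G (fun t x u => grad (fun y => g t y u) x) t z.1 z.2).
  by apply/funext => z; rewrite grad_cutoff.
split.
- move=> x u i; apply: (@measurable_cutoff _ G f (fun v : X => v ord0 i)) => //.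
  + by case: rf => -[].
  + exact: coord_continuous.
  + by rewrite mxE.
- move=> x u; apply: (@measurable_cutoff _ G g id) => //.
  + by case: rg => -[].
  + by move=> v; exact: cvg_id.
- move=> x u i j.
  rewrite (_ : (fun t => _) = fun t => cutoff G (fun t x u => 'J (fun y => f t y u) x) t x u i j);
    last by apply/funext => t; rewrite jacobian_cutoff.
  apply: (@measurable_cutoff _ G _ (fun v : 'M[R]_m => v i j)) => //.
  + by case: rfx => -[].
  + exact: coord_continuous.
  + by rewrite mxE.
- move=> x u i.
  rewrite (_ : (fun t => _) =
      fun t => cutoff G (fun t x u => grad (fun y => g t y u) x) t x u ord0 i);
    last by apply/funext => t; rewrite grad_cutoff.
  apply: (@measurable_cutoff _ G _ (fun v : X => v ord0 i)) => //.
  + by case: rgx => -[].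
  + exact: coord_continuous.
  + by rewrite mxE.
- by move=> t; case: (tamef t).
- by move=> t; case: (tameg t).
- by move=> t; rewrite Jz; case: (tamefx t).
- by move=> t; rewrite Dz; case: (tamegx t).
- by move=> n; exact: li_sum.
- exact: b0.
- move=> n p t np; rewrite /beta -(subnK np) addnC -addSn iotaD big_cat lerDl.
  by apply: sumr_ge0 => i _; exact: r0.
- by move=> n t x u xn un; have [_ /(_ n x u xn un)[]] := tamef t.
- by move=> n t x u xn un; have [_ /(_ n x u xn un)[]] := tameg t.
- by move=> n t x u xn un; rewrite jacobian_cutoff; have [_ /(_ n x u xn un)[]] := tamefx t.
- by move=> n t x u xn un; rewrite grad_cutoff; have [_ /(_ n x u xn un)[]] := tamegx t.
- by move=> n t x y u xn yn un; have [_ /(_ n x u xn un)[_ /(_ y yn)]] := tamef t.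
- by move=> n t x y u xn yn un; have [_ /(_ n x u xn un)[_ /(_ y yn)]] := tameg t.
- move=> n t x y u xn yn un; rewrite !jacobian_cutoff.
  by have [_ /(_ n x u xn un)[_ /(_ y yn)]] := tamefx t.
- move=> n t x y u xn yn un; rewrite !grad_cutoff.
  by have [_ /(_ n x u xn un)[_ /(_ y yn)]] := tamegx t.
- move=> n t x u un; rewrite /cutoff; case: ifPn => [/set_mem/hG[t0 nN]|_]; last first.
    by rewrite normr0 mulr_ge0// addr_ge0.
  have [_ _ _ _ h] := hN t t0 nN; apply: le_trans (h n x u un) _.
  by rewrite ler_wpM2r ?addr_ge0//; apply: le_trans (rb n t).
- move=> t x u; rewrite /cutoff; case: (boolP (t \in G)) => [/set_mem/hG[t0 _]|_].
    exact: df.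
  exact: differentiable_cst.
- move=> t x u; rewrite /cutoff; case: (boolP (t \in G)) => [/set_mem/hG[t0 _]|_].
    exact: dg.
  exact: differentiable_cst.
Qed.

End Cutoff.

(** * From the half-line to the whole line *)

Section HalfLine.
Context {R : realType}.

Lemma ode_sol_ae (V : normedModType R) (y F G : R -> V) :
  ode_sol y F -> ae_time (fun t => F t = G t) -> ode_sol y G.
Proof.
move=> [acy dy] FG; split => //; apply: (ae_imp2 dy FG) => t h1 h2 t0.
by rewrite -h2//; exact: h1.
Qed.

Lemma ode_sol_cst (V : normedModType R) (c : V) : ode_sol (fun=> c) (fun=> 0).
Proof.
split=> [T e e0|]; first by exists 1 => // n I _ _ _; rewrite big1// => i _; rewrite subrr normr0.
by exists set0; split => // t /= ; apply: contra_notP => _ _; exact: is_derive_cst.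
Qed.

Lemma abs_continuous_maxr (V : normedModType R) (y : R -> V) :
  (forall T, abs_continuous 0 T y) -> continuous (fun t : R => y (Num.max 0 t)).
Proof.
move=> acy t; apply/cvgrPdist_lt => e e0.
pose T := Num.max 0 t + 1; have [d d0 hd] := acy T e e0.
have close a b : 0 <= a -> a <= b -> b <= T -> b - a < d -> `|y b - y a| < e.
  move=> a0 ab bT bad; have := hd 1%N (fun=> (a, b)); rewrite !big_ord_recl !big_ord0 !addr0 /=.
  by apply => //= i j _ _ _; rewrite (ord1 i) (ord1 j).
near=> s.
have st : `|s - t| < Num.min d 1.
  near: s; apply/nbhs_ballP; exists (Num.min d 1) => /= [|s]; first by rewrite lt_min d0/=.
  by rewrite /ball/= distrC.
move: st; rewrite lt_min !ltr_norml => /andP[/andP[d1 d2] /andP[d3 d4]].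
have m0 (u : R) : 0 <= Num.max 0 u by rewrite le_max lexx.
have mT : Num.max 0 s <= T.
  by rewrite /T; have [] := leP 0 t; have [] := leP 0 s; lra.
have tT : Num.max 0 t <= T by rewrite lerDl.
have [st|ts] := leP (Num.max 0 s) (Num.max 0 t).
  apply: close => //; move: st; have [] := leP 0 t; have [] := leP 0 s; lra.
rewrite distrC; apply: close => //; first exact: ltW.
by move: ts; have [] := leP 0 t; have [] := leP 0 s; lra.
Unshelve. all: by end_near. Qed.

Lemma continuous_vmeas n (y : R -> 'rV[R]_n) : continuous y -> vmeas y.
Proof.
move=> cy i; apply: continuous_measurable_fun => t.
by apply: (@rV_coord_cvg _ _ _ _ y); exact: cy.
Qed.

Lemma maxr_locally_bounded n (y : R -> 'rV[R]_n) :
  continuous (fun t : R => y (Num.max 0 t)) -> locally_bounded (fun t : R => y (Num.max 0 t)).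
Proof.
move=> cy T; pose z t := `|y (Num.max 0 t)|.
have T0 : 0 <= Num.max 0 T by rewrite le_max lexx.
have cz : {within `[0, Num.max 0 T], continuous z}.
  apply: continuous_subspaceT => t; apply: (@cvg_comp _ _ _ _ (fun v : 'rV[R]_n => `|v|)).
    exact: cy.
  exact: norm_continuous.
have [c _ hc] := EVT_max T0 cz.
exists (Num.truncn (z c)).+1 => t tT; apply: le_trans (ltW (truncnS_gt _)).
have -> : `|y (Num.max 0 t)| = z (Num.max 0 t) by rewrite /z maxA maxxx.
by apply: hc; rewrite in_itv/= le_max lexx/= ge_max T0 le_max tT orbT.
Qed.

(* Functions of time are arbitrary on the negative half-line, where measurability
   on the whole line would fail; this and precomposition with Num.max 0 tame them. *)
Definition zero_before n (u : R -> 'rV[R]_n) t := if 0 <= t then u t else 0.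

Lemma zero_before_borel k (u : R -> 'rV[R]_k) : borel_in_time u -> borel_control (zero_before u).
Proof.
move=> bu O oO.
rewrite (_ : _ @^-1` _ = (`[0, +oo[ `&` u @^-1` O) `|` (`]-oo, 0[ `&` (fun=> 0 : 'rV[R]_k) @^-1` O)).
  apply: measurableU.
    by apply: (bu (measurable_itv _) O); exact: sub_sigma_algebra.
  apply: measurableI; first exact: measurable_itv.
  have [h0|h0] := pselect (O 0).
    by rewrite (_ : _ @^-1` _ = setT)//; apply/seteqP; split.
  by rewrite (_ : _ @^-1` _ = set0)//; apply/seteqP; split.
apply/seteqP; split => t; rewrite /zero_before /= !in_itv/= andbT.
  by case: leP => t0 Ou; [left|right].
by case: leP => t0 [] [].
Qed.

Lemma zero_before_bounded n (u : R -> 'rV[R]_n) :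
  (forall T, exists M, forall t, 0 <= t <= T -> `|u t| <= M) -> locally_bounded (zero_before u).
Proof.
move=> hu T; have [M hM] := hu T; exists (Num.truncn M).+1 => t tT.
rewrite /zero_before; case: ifP => t0; last by rewrite normr0.
by apply: le_trans (ltW (truncnS_gt _)); apply: hM; rewrite t0.
Qed.

Lemma borel_control_in_time k (v : R -> 'rV[R]_k) : borel_control v -> borel_in_time v.
Proof.
move=> bv; rewrite /borel_in_time.
apply: (@measurability _ _ _ (g_sigma_algebraType (@open 'rV[R]_k)) _ _ (@open 'rV[R]_k)) => // _ [V oV <-].
by apply: measurableI; [exact: measurable_itv|exact: bv].
Qed.

End HalfLine.

(** * Transfer between the cut-off system and the original one *)

Section CutoffSystem.
Context {R : realType} {m k : nat}.
Notation mu := (@lebesgue_measure R).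
Notation X := 'rV[R]_m.
Notation Uc := 'rV[R]_k.
Variables (f : R -> X -> Uc -> X) (g : R -> X -> Uc -> R) (N : set R).
Hypotheses (mN : measurable N) (N0 : mu N = 0%E).
Notation fN := (cutoff (`[0 : R, +oo[ `\` N) f).
Notation gN := (cutoff (`[0 : R, +oo[ `\` N) g).

Lemma cutoffE (V : normedModType R) (a : R -> X -> Uc -> V) t : 0 <= t -> ~ N t ->
  cutoff (`[0, +oo[ `\` N) a t = a t.
Proof.
move=> t0 nN; apply/funext => x; apply/funext => u.
by rewrite /cutoff mem_set//=; split => //=; rewrite in_itv/= t0.
Qed.

Lemma ae_time_off_null (P : R -> Prop) : (forall t, 0 <= t -> ~ N t -> P t) -> ae_time P.
Proof.
move=> hP; exists N; split => // t /= ht; apply: contra_notP ht => nN t0; exact: hP.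
Qed.

Lemma hamiltonian_cutoff x t u lam psi : 0 <= t -> ~ N t ->
  hamiltonian fN gN x t u lam psi = hamiltonian f g x t u lam psi.
Proof. by move=> t0 nN; rewrite /hamiltonian !cutoffE. Qed.

Lemma dhamiltonian_cutoff x t u lam psi : 0 <= t -> ~ N t ->
  dhamiltonian fN gN x t u lam psi = dhamiltonian f g x t u lam psi.
Proof.
move=> t0 nN; rewrite /dhamiltonian; congr (grad _ x).
by apply/funext => y; exact: hamiltonian_cutoff.
Qed.

Lemma payoff_cutoff (x x' : R -> X) (u u' : R -> Uc) T :
  (forall t, 0 <= t -> x t = x' t /\ u t = u' t) ->
  payoff g x u T = cost gN u' x' T.
Proof.
move=> xx; rewrite /payoff /cost /prim /Rintegral; congr fine.
apply: (@integral_eq_off_null _ _ _ mu _ N) => // t /=; rewrite in_itv/= => /andP[t0 _] nN.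
by have [-> ->] := xx t t0; rewrite cutoffE.
Qed.

Variables (beta : nat -> R -> R) (rd : regular_data fN gN beta).

Lemma trajectory_sol (x : R -> X) (u : R -> Uc) : borel_in_time u ->
  (forall T, exists M, forall t, 0 <= t <= T -> `|u t| <= M) ->
  ode_sol x (fun t => f t (x t) (u t)) ->
  sol (fun t z => fN t z (zero_before u t)) (fun t : R => x (Num.max 0 t)).
Proof.
move=> bu lbu sx; have [acx _] := sx.
have cx := abs_continuous_maxr acx; have mx := continuous_vmeas cx.
have bx := maxr_locally_bounded cx.
have bu' := zero_before_bounded lbu.
have mu' := borel_control_vmeas (zero_before_borel bu).
have lF : vli (fun t => fN t (x (Num.max 0 t)) (zero_before u t)).
  have [q [hq lq]] := locally_bounded_rate bx bu' (li_beta rd).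
  apply: (vli_le _ lq); first exact: (vmeas_f rd mx mu').
  by move=> t; have [h1 h2] := hq t; exact: (bound_f rd).
split => // t.
rewrite maxxx -vprim_maxr; apply: (ode_sol_vprim lF); last by rewrite le_max lexx.
apply: (ode_sol_ae sx); apply: ae_time_off_null => s s0 nN.
by rewrite cutoffE// /zero_before s0 (max_idPr s0).
Qed.

Lemma sol_trajectory (x : R -> X) (v w : R -> Uc) :
  (forall t, 0 <= t -> v t = w t) -> sol (fun t z => fN t z (v t)) x ->
  ode_sol x (fun t => f t (x t) (w t)).
Proof.
move=> vw /sol_ode sx; apply: (ode_sol_ae sx); apply: ae_time_off_null => t t0 nN.
by rewrite cutoffE// vw.
Qed.

Lemma sol_adjoint (x y : R -> X) (v w : R -> Uc) lam psi :
  (forall t, 0 <= t -> x t = y t /\ v t = w t) ->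
  sol (fun t p => - dhamiltonian fN gN (x t) t (v t) lam p) psi ->
  ode_sol psi (fun t => - dhamiltonian f g (y t) t (w t) lam (psi t)).
Proof.
move=> xy /sol_ode sp; apply: (ode_sol_ae sp); apply: ae_time_off_null => t t0 nN.
by have [-> ->] := xy t t0; rewrite dhamiltonian_cutoff.
Qed.

Variables (U : R -> set Uc) (x_init : X) (u0 : R -> Uc) (x0 : R -> X).
Hypothesis lbu0 : forall T, exists M, forall t, 0 <= t <= T -> `|u0 t| <= M.

(** Processes of the cut-off system are trajectories of the original one with the same payoff, hence
    among the competitors in the supremum, which falls below [e] at arbitrarily late times. *)
Lemma cutoff_optimal : weakly_unif_overtaking_optimal f g U x_init u0 x0 ->
  forall e M, 0 < e -> exists2 T, M <= T & forall S rho v x,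
    admissible_process fN U x_init (zero_before u0) S rho v x ->
    cost gN v x T <= cost gN (zero_before u0) (fun t : R => x0 (Num.max 0 t)) T + e.
Proof.
move=> opt e M e0; have [T MT Te] := limf_einf_pinfty M opt e0.
exists T => // S rho v x pv.
have [[bv Uv _ _] sx xi] := pv.
have bv' := process_locally_bounded (zero_before_bounded lbu0) pv.
have adm : admissible_control U v.
  split => //; first exact: borel_control_in_time.
  by move=> T'; have [n hn] := bv' T'; exists n%:R => t /andP[_]; exact: hn.
have traj : trajectory f x_init v x by split => //; exact: sol_trajectory sx.
have : ((payoff g x v T - payoff g x0 u0 T)%:E < e%:E)%E.
  by apply: le_lt_trans Te; apply: ereal_sup_ubound; exists v, x.
rewrite lte_fin -(@payoff_cutoff x x v v)// => h.
rewrite -(@payoff_cutoff x0 _ u0); last first.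
  by move=> t t0; rewrite (max_idPr t0) /zero_before t0.
by lra.
Qed.

End CutoffSystem.

Theorem corollary2 (R : realType) (m k : nat)
    (f : R -> 'rV[R]_m -> 'rV[R]_k -> 'rV[R]_m)
    (g : R -> 'rV[R]_m -> 'rV[R]_k -> R)
    (U : R -> set 'rV[R]_k) (x_init : 'rV[R]_m)
    (u0 : R -> 'rV[R]_k) (x0 : R -> 'rV[R]_m)
    (closedU : closed_valued U) (borelU : borel_graph U)
    (regfg : regularity_conditions f g)
    (u0_adm : admissible_control U u0)
    (x0_traj : trajectory f x_init u0 x0)
    (opt : weakly_unif_overtaking_optimal f g U x_init u0 x0) :
  exists tau : nat -> R,
    [/\ forall n, 0 <= tau n,
        forall M : R, exists n, M < tau n &
        exists (lam0 : R) (psi0 : R -> 'rV[R]_m),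
          Lambda f g U u0 x0 lam0 psi0 /\
          vanishing_multiplier f g U tau u0 x0 lam0 psi0].
Proof.
have [bu0 lbu0 Uu0] := u0_adm; have [x00 sx0] := x0_traj.
have [N [beta [mN N0 rd]]] := regular_data_cutoff regfg.
have u0E t : 0 <= t -> zero_before u0 t = u0 t by rewrite /zero_before => ->.
have Uu0' t : 0 <= t -> U t (zero_before u0 t) by move=> t0; rewrite u0E//; exact: Uu0.
have x00' : x0 (Num.max 0 0) = x_init by rewrite maxxx.
have [tau [l [psi0 [lam [psi [x [[tau_ge tau_homo hn] ln spsi0 [cpsi cx cl hmax]]]]]]]] :=
  vanishing_limit rd (zero_before_borel bu0) (zero_before_bounded lbu0) Uu0' borelU
    (trajectory_sol mN N0 rd bu0 lbu0 sx0) x00' (cutoff_optimal mN N0 lbu0 opt).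
have x0E t : 0 <= t -> x0 (Num.max 0 t) = x0 t by move=> t0; rewrite (max_idPr t0).
have hpsi0 : ode_sol psi0 (fun t => - dhamiltonian f g (x0 t) t (u0 t) l (psi0 t)).
  by apply: (sol_adjoint mN N0 _ spsi0) => t t0; rewrite x0E// u0E.
have mult : lagrange_multiplier f g U u0 x0 l psi0.
  split => //.
  - split; first by case: ln => [->|[-> _]]; rewrite ?ler01 ?lexx.
    have [acp _] := hpsi0; have cp := abs_continuous_maxr acp.
    apply: (@subspace_eq_continuous _ _ _ (fun t : R => psi0 (Num.max 0 t))).
      by move=> t /set_mem; rewrite /= in_itv/= andbT => t0; rewrite (max_idPr t0).
    exact: continuous_subspaceT.
  - move=> [l0 p0]; case: ln => [|[_]]; first by rewrite l0 => /esym/eqP; rewrite oner_eq0.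
    rewrite p0// /euclidean_norm big1 => [|i _]; last by rewrite mxE expr0n.
    by rewrite sqrtr0 => /esym/eqP; rewrite oner_eq0.
  - have hN : ae_time (fun t => ~ N t) by exact: (ae_time_off_null mN N0).
    apply: (ae_imp2 hmax hN) => t h1 h2 t0; have nN := h2 t0.
    apply/eqP; rewrite eq_le; apply/andP; split.
      apply: ge_ereal_sup => _ [p Up <-]; rewrite lee_fin.
      have := h1 t0 p Up; rewrite !hamiltonian_cutoff//.
      by rewrite x0E// u0E.
    by apply: ereal_sup_ubound; exists (u0 t) => //; exact: Uu0.
exists tau; split.
- by move=> n; exact: le_trans (tau_ge n).
- move=> M; exists (Num.truncn M).+1; apply: lt_le_trans (tau_ge _); exact: truncnS_gt.
exists l, psi0; split; first by split.
(* The sequence [tau] already consists of the vanishing times of the extracted approximants, so the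
   subsequence is [tau] itself. *)
split => //; exists id, psi, x, (fun n => fun=> lam n); split => //.
- split; first exact: tau_homo.
  apply/cvgryPge => A.
  have : \forall i \near \oo, A <= i%:R :> R by exact: nbhs_infty_ger.
  by apply: filterS => i /le_trans; apply.
- move=> n; have [k1 k2 k3 k4] := hn n; split => //.
  + by apply: (sol_adjoint mN N0 _ k3) => t t0; rewrite u0E.
  + by apply: (sol_trajectory mN N0 _ k2) => t t0; rewrite u0E.
  + exact: ode_sol_cst.
- by move=> t t0; split; [exact: cpsi|rewrite -(x0E _ t0); exact: cx|exact: cl].
- by move=> n; have [] := hn n.
Qed.
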